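(* Let $n\ge2$, $m\in\mathbb{Z}$, and \[ F^{(2)}_{m,n}(x):=\prod_{\substack{i,j=1\\ i\ne j}}^n\frac{(x_ix_j^{-1};q)_\infty}{(x_ix_j^{-1}z;q)_\infty}\prod_{i=1}^n\frac{(q^{1/2}x_iy;q)_\infty(q^{1/2}x_i^{-1}y^{-1};q)_\infty}{(q^{-1/2}x_iyz;q)_\infty(q^{1/2}x_i^{-1}y^{-1}z;q)_\infty}\sum_{i=1}^nx_i^m. \] Let $C^{(2)}_m(y,z)$ be the coefficient of $x_1^0\cdots x_{n-1}^0$ in $F^{(2)}_{m,n}(x_1,\dots,x_{n-1},(x_1\cdots x_{n-1})^{-1})$. Then \[ C^{(2)}_0(y,z)=n!\,n\,\frac{(z;q)_\infty^n}{(q;q)_\infty^{n-1}(qz^n;q)_\infty(z;z)_n}\sum_{k\in\mathbb{Z}}(-1)^{nk}y^{nk}q^{nk^2/2}\prod_{i=1}^n\frac{(z^iq^{-k},z^iq^{k+1};q)_\infty}{(z^{i+1},z^{i-1}q;q)_\infty}, \] \[ C^{(2)}_1(y,z)=n!\,y^{-1}q^{1/2}\frac{(z;q)_\infty^n(1-z^n)}{(q;q)_\infty^{n-1}(1-z)(qz^n;q)_\infty(z;z)_n}\sum_{k\in\mathbb{Z}}(-1)^{nk}y^{nk}q^{nk^2/2}\frac{1-zq^k}{z^n-q^k}\prod_{i=1}^n\frac{(z^iq^{-k},z^iq^{k+1};q)_\infty}{(z^{i+1},z^{i-1}q;q)_\infty}. \]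
   Context: $q,z,y$ are indeterminates (with $|q|<1$, $|z|<1$, $y\neq0$); $(a;q)_\infty=\prod_{k\ge0}(1-aq^k)$, $(a;q)_n=\prod_{k=0}^{n-1}(1-aq^k)$, $(a_1,\dots,a_r;q)_\infty=\prod_i(a_i;q)_\infty$. The products are expanded as formal Laurent series in the variables $x_1,\dots,x_n$ (e.g. via the Jacobi triple product and Euler's identities, power series in $z$ and $q^{1/2}$ coefficientwise), and coefficients are extracted coefficientwise. *)

(* Defs.v *)
From mathcomp Require Import all_boot all_order all_algebra.
From Stdlib Require Import ClassicalEpsilon.
Set Implicit Arguments. Unset Strict Implicit. Unset Printing Implicit Defensive.
Import Order.TTheory GRing.Theory Num.Theory.
Local Open Scope ring_scope.

(* Variables: t = q^(1/2), z, y, x_1..x_k.  A monomial t^a z^b y^c x^v is    *)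
(* encoded by its exponent (a, b, c, v) : expo k.  A series is the function *)
(* exponent |-> coefficient.  Note q = t^2.                                  *)

Definition expo (k : nat) : zmodType := (int * int * int * 'rV[int]_k)%type.
Definition tdeg {k} (e : expo k) : int := e.1.1.1.
Definition zdeg {k} (e : expo k) : int := e.1.1.2.
Definition ydeg {k} (e : expo k) : int := e.1.2.
Definition xdeg {k} (e : expo k) : 'rV[int]_k := e.2.

Definition series (k : nat) := expo k -> rat.

(* sum of a function with finite support (0 if the support is infinite) *)
Definition fsum {T : eqType} (h : T -> rat) : rat :=
  let P := fun s : seq T => uniq s /\ (forall x, h x != 0 <-> x \in s) in
  match excluded_middle_informative (exists s, P s) with
  | left _ => \sum_(x <- epsilon (inhabits [::]) P) h x
  | right _ => 0
  end.

Section Ops.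
Variable k : nat.
Implicit Types f g : series k.

Definition szero : series k := fun _ => 0.
Definition smon (c : rat) (e : expo k) : series k := fun e' => if e' == e then c else 0.
Definition sone : series k := smon 1 0.
Definition sadd f g : series k := fun e => f e + g e.
Definition sopp f : series k := fun e => - f e.
Definition ssub f g : series k := sadd f (sopp g).
(* Cauchy product (the convolution sums are finite for all series used) *)
Definition smul f g : series k := fun e => fsum (fun e1 : expo k => f e1 * g (e - e1)).
Definition spow f (m : nat) : series k := iter m (smul f) sone.

(* the ring in which everything lives: Laurent series in t (bounded below for
   each z-degree) with Laurent-polynomial coefficients in y, x, power series in z *)
Definition admissible f : Prop :=
  (forall e, f e != 0 -> 0 <= zdeg e) /\
  (forall a, exists L : int, forall e, f e != 0 -> zdeg e = a -> L <= tdeg e) /\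
  (forall a b, exists s : seq (expo k),
      forall e, f e != 0 -> zdeg e = a -> tdeg e = b -> e \in s).

(* the (unique) inverse inside the admissible ring *)
Definition sinv f : series k :=
  epsilon (inhabits szero) (fun g => admissible g /\ smul f g = sone).
Definition sdiv f g : series k := smul f (sinv g).

Definition slim (u : nat -> series k) : series k := fun e =>
  epsilon (inhabits 0) (fun v => exists N, forall m, (N <= m)%N -> u m e = v).

(* sum over k in Z, coefficientwise (finitely many nonzero terms per coefficient) *)
Definition ssumZ (u : int -> series k) : series k := fun e => fsum (fun j : int => u j e).

Definition qpow (m : int) : series k := smon 1 (2 * m, 0, 0, 0).

Definition qpochn (a b : series k) (N : nat) : series k :=
  \big[smul/sone]_(l < N) ssub sone (smul a (spow b l)).
Definition qpoch (a : series k) : series k := slim (qpochn a (qpow 1)).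
End Ops.

Definition mono {k} (a b c : int) (v : 'rV[int]_k) : series k := smon 1 (a, b, c, v).
Definition xv {k} (i : 'I_k) : 'rV[int]_k := \row_j ((j == i) : nat)%:Z.

Definition F2 (n : nat) (m : int) : series n :=
  smul (smul
    (\big[@smul n/@sone n]_(i < n) \big[@smul n/@sone n]_(j < n | i != j)
        sdiv (qpoch (mono 0 0 0 (xv i - xv j)))
             (qpoch (mono 0 1 0 (xv i - xv j))))
    (\big[@smul n/@sone n]_(i < n)
        sdiv (smul (qpoch (mono 1 0 1 (xv i))) (qpoch (mono 1 0 (-1) (- xv i))))
             (smul (qpoch (mono (-1) 1 1 (xv i))) (qpoch (mono 1 1 (-1) (- xv i))))))
    (\big[@sadd n/@szero n]_(i < n) mono 0 0 0 (m *: xv i)).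

Arguments F2 : clear implicits.

Definition xcoord {k} (v : 'rV[int]_k) (i : nat) : int :=
  if insub i is Some j then v 0 j else 0.

(* substitution x_n := (x_1 ... x_{n-1})^{-1}: the monomial x^v becomes
   prod_{i<n-1} x_i^(v_i - v_n) *)
Definition subst_last {n} (f : series n) : series n.-1 := fun e' =>
  fsum (fun e : expo n =>
    if (tdeg e, zdeg e, ydeg e, \row_(i < n.-1) (xcoord (xdeg e) i - xcoord (xdeg e) n.-1))
         == e' then f e else 0).

Definition C2 (n : nat) (m : int) : series 0 := fun e =>
  subst_last (F2 n m) (tdeg e, zdeg e, ydeg e, 0).

Notation S := (series 0).
Definition Z0 : 'rV[int]_0 := 0.
Definition cst (c : rat) : S := smon c 0.
Definition tz (a b : int) : S := mono a b 0 Z0.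

Definition Pk (n : nat) (kk : int) : S :=
  \big[@smul 0/@sone 0]_(i < n)
    sdiv (smul (qpoch (tz (- 2 * kk) i.+1%:Z)) (qpoch (tz (2 * (kk + 1)) i.+1%:Z)))
         (smul (qpoch (tz 0 i.+2%:Z)) (qpoch (tz 2 i%:Z))).

Definition wk (n : nat) (kk : int) : S :=
  smon ((-1) ^ (n%:Z * kk)) (n%:Z * (kk * kk), 0, n%:Z * kk, Z0).

Definition pref (n : nat) : S :=
  sdiv (spow (qpoch (tz 0 1)) n)
       (smul (smul (spow (qpoch (tz 2 0)) n.-1) (qpoch (tz 2 n%:Z)))
             (qpochn (tz 0 1) (tz 0 1) n)).

Definition RHS0 (n : nat) : S :=
  smul (smul (cst (n`! * n)%:R) (pref n))
       (ssumZ (fun kk => smul (wk n kk) (Pk n kk))).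

Definition RHS1 (n : nat) : S :=
  smul (smul (smul (cst (n`!)%:R) (mono 1 0 (-1) Z0))
             (sdiv (smul (pref n) (ssub (@sone 0) (tz 0 n%:Z))) (ssub (@sone 0) (tz 0 1))))
       (ssumZ (fun kk => smul (wk n kk)
           (smul (sdiv (ssub (@sone 0) (tz (2 * kk) 1)) (ssub (tz 0 n%:Z) (tz (2 * kk) 0)))
                 (Pk n kk)))).

(* Main.v *)
(* The coefficient of y^(nk) is the constant term of (x_1...x_n)^(-k) times the A_(n-1) Macdonald
   weight times one-variable weights f(u) = (u, q/u)_oo / (A u, B q/u)_oo with A = z/q, B = z, so
   the theorem is a q-Morris identity with non-integral parameters.  All series are expanded
   in z, and the constant term is invariant under x_i -> q x_i.
   After symmetrisation one may replace the weight by
   W = prod_(i<j) (v, q/v)_oo / (z v, q z/v)_oo, v = x_i/x_j, which is invariant under the cyclic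
   shift x_i -> x_(i-1), x_1 -> q x_n; moreover (z u_i - u_(i+1)) W is antisymmetric under the
   exchange of i and i+1.  Together these give two-term recurrences for the constant terms of
   u_1...u_r and of prod_(i<=r) (u_i - q B) (q-Aomoto).  The first recurrence produces the case
   m = 1 and the step k -> k-1; both combined give the step B -> q B.  Iterating the latter from
   B = z and from B = 1, where the constant term is that of W alone, and letting B -> 0 yields the
   value at k = 0 up to the constant term of W; the choice u_i = x_i/x_(n+1) turns
   the same formula into a recurrence in n for the constant term of W. *)
Require Import Defs.
From HB Require Import structures.
From mathcomp Require Import all_boot all_order all_algebra.
From mathcomp Require Import fingroup perm.
From mathcomp Require Import boolp.
From mathcomp Require Import zify ring.
From Stdlib Require Import ClassicalEpsilon.
Set Implicit Arguments. Unset Strict Implicit. Unset Printing Implicit Defensive.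
Import Order.TTheory GRing.Theory Num.Theory.
Local Open Scope ring_scope.

(** * Finite sums and the Cauchy product *)

(** The sum over k is never evaluated. The product without the factor $\sum x_i^m$ is invariant
    under x_i -> q x_i, y -> y/q, so in each of its terms the y-degree is the total x-degree, and
    each power of y meets at most one k. With u_i = q^(1/2) x_i y the theorem becomes one closed
    formula per k. The q-shifts force a ring smaller than that of the admissible series, stable
    under them; inverses found there agree with [sinv] by uniqueness. The limit B -> 0 by itself
    gives nothing, as the limiting constant term is unknown. The chains B = z q^N and B = q^N have
    the same limit, which is thereby eliminated. At B = 1 the factor (q/u)_oo cancels and the weight
    involves only nonnegative powers of u, so scaling u by q^N drives it to 1 without changing the
    constant term. No limit is formed: both sides are compared modulo weight N for every N. All
    identities are kept in cleared form, and only units are cancelled: monomials free of z, series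
    whose part of z-degree 0 is 1, and (q;q)_oo. *)

Section Fsum.
Variable T : eqType.
Implicit Types (h : T -> rat) (s : seq T).

Lemma fsumE h s : uniq s -> (forall x, h x != 0 -> x \in s) ->
  fsum h = \sum_(x <- s) h x.
Proof.
move=> us hs; rewrite /fsum.
set P := fun s' : seq T => _.
case: excluded_middle_informative => [ex|nex].
  move: (epsilon_spec (inhabits [::]) P ex); set s' := epsilon _ _ => -[u' hu'].
  rewrite [RHS](bigID (fun x => h x != 0)) /= [X in _ + X]big1 ?addr0; last first.
    by move=> i /negbNE/eqP.
  rewrite -[RHS]big_filter; apply: perm_big; apply: uniq_perm => //.
    exact: filter_uniq.
  move=> x; rewrite mem_filter; apply/idP/andP => [/hu' hx|[/hu' //]].
  by split => //; exact: hs.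
case: nex; exists [seq x <- s | h x != 0]; split; first exact: filter_uniq.
move=> x; rewrite mem_filter; split=> [hx|/andP[]//].
by rewrite hx hs.
Qed.

Definition fin_supp h := exists s : seq T, forall x, h x != 0 -> x \in s.

Lemma fin_suppP h : fin_supp h -> exists2 s, uniq s & forall x, h x != 0 -> x \in s.
Proof.
move=> [s hs]; exists (undup s); first exact: undup_uniq.
by move=> x /hs; rewrite mem_undup.
Qed.

Lemma fsum0 h : (forall x, h x = 0) -> fsum h = 0.
Proof.
move=> h0; rewrite (@fsumE h [::]) ?big_nil // => x.
by rewrite h0 eqxx.
Qed.

Lemma fsum1 h a : (forall x, x != a -> h x = 0) -> fsum h = h a.
Proof.
move=> h0; rewrite (@fsumE h [:: a]) ?big_seq1 // => x.
by apply: contraNT; rewrite inE => /h0 ->.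
Qed.

Lemma eq_fsum h h' : h =1 h' -> fsum h = fsum h'.
Proof. by move=> /funext ->. Qed.

(** Since an infinite support gives the default value 0, a nonzero sum also certifies finiteness. *)
Lemma fsum_neq0 h : fsum h != 0 -> exists2 x, h x != 0 & fin_supp h.
Proof.
move=> hn; have [[s hs]|nf] := EM (fin_supp h).
  have [ex|nex] := EM (exists x, h x != 0).
    by have [x hx] := ex; exists x => //; exists s.
  case/eqP: hn; apply: fsum0 => x; apply/eqP; apply/negP => /negP hx.
  by apply: nex; exists x.
case/eqP: hn; rewrite /fsum; case: excluded_middle_informative => // -[s [_ hs]].
by case: nf; exists s => x /hs.
Qed.

Lemma fsumD h h' : fin_supp h -> fin_supp h' ->
  fsum (fun x => h x + h' x) = fsum h + fsum h'.
Proof.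
move=> [s hs] [s' hs'].
have u : uniq (undup (s ++ s')) by exact: undup_uniq.
rewrite !(fsumE u) ?big_split // => x; rewrite mem_undup mem_cat.
- by move=> /hs' ->; rewrite orbT.
- by move=> /hs ->.
apply: contraR; rewrite negb_or => /andP[xs xs'].
have -> : h x = 0 by apply/eqP; apply: contraR xs => /hs.
have -> : h' x = 0 by apply/eqP; apply: contraR xs' => /hs'.
by rewrite addr0.
Qed.

Lemma fsumZ c h : fin_supp h -> fsum (fun x => c * h x) = c * fsum h.
Proof.
move=> /fin_suppP[s us hs]; rewrite !(fsumE us) ?mulr_sumr // => x.
by apply: contraR => /(contraR (@hs x))/eqP ->; rewrite mulr0.
Qed.

Lemma fsumZr c h : fin_supp h -> fsum (fun x => h x * c) = fsum h * c.
Proof.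
by move=> /(fsumZ c); rewrite mulrC => <-; apply: eq_fsum => x; rewrite mulrC.
Qed.
End Fsum.

Lemma fsum_reindex (T U : eqType) (g : T -> U) (h : U -> rat) :
  injective g -> (forall y, h y != 0 -> exists x, g x = y) -> fin_supp h ->
  fsum h = fsum (fun x => h (g x)).
Proof.
move=> gi gs /fin_suppP[s us hs].
have [s' es'] : exists s', map g s' = [seq y <- s | h y != 0].
  have: all (fun y => h y != 0) [seq y <- s | h y != 0] by exact: filter_all.
  elim: [seq y <- s | h y != 0] => [|y r IH] /=; first by exists [::].
  by move=> /andP[/gs[x <-] /IH[r' <-]]; exists (x :: r').
have um : uniq (map g s') by rewrite es' filter_uniq.
rewrite (@fsumE _ h (map g s')) //; last first.
  by move=> y hy; rewrite es' mem_filter hy hs.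
rewrite big_map (@fsumE _ (fun x => h (g x)) s') //; first exact: (map_uniq um).
by move=> x hx; rewrite -(mem_map gi) es' mem_filter hx hs.
Qed.

Lemma fsum_exchange (T U : eqType) (H : T -> U -> rat) :
  (exists s : seq (T * U), forall x y, H x y != 0 -> (x, y) \in s) ->
  fsum (fun x => fsum (fun y => H x y)) = fsum (fun y => fsum (fun x => H x y)).
Proof.
move=> [s hs].
set X := undup (map fst s); set Y := undup (map snd s).
have uX : uniq X by exact: undup_uniq.
have uY : uniq Y by exact: undup_uniq.
have hX x y : H x y != 0 -> x \in X.
  by move=> /hs xy; rewrite mem_undup; apply/mapP; exists (x, y).
have hY x y : H x y != 0 -> y \in Y.
  by move=> /hs xy; rewrite mem_undup; apply/mapP; exists (x, y).
have eX x : fsum (H x) = \sum_(y <- Y) H x y by apply: fsumE => // y; apply: hY.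
have eY y : fsum (H^~ y) = \sum_(x <- X) H x y by apply: fsumE => // x; apply: hX.
rewrite (fsumE uX); last by move=> x /fsum_neq0[y /hX].
rewrite (fsumE uY); last by move=> y /fsum_neq0[x /hY].
rewrite (eq_bigr _ (fun x _ => eX x)) (eq_bigr _ (fun y _ => eY y)).
exact: exchange_big.
Qed.

(** * Admissible series: finiteness and ring laws of the Cauchy product *)

Section Admissible.
Variable k : nat.
Implicit Types (f g h : series k) (e : expo k).

Lemma tdegD e e' : tdeg (e + e') = tdeg e + tdeg e'. Proof. by []. Qed.
Lemma zdegD e e' : zdeg (e + e') = zdeg e + zdeg e'. Proof. by []. Qed.
Lemma ydegD e e' : ydeg (e + e') = ydeg e + ydeg e'. Proof. by []. Qed.
Lemma xdegD e e' : xdeg (e + e') = xdeg e + xdeg e'. Proof. by []. Qed.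
Lemma tdegB e e' : tdeg (e - e') = tdeg e - tdeg e'. Proof. by []. Qed.
Lemma zdegB e e' : zdeg (e - e') = zdeg e - zdeg e'. Proof. by []. Qed.
Lemma ydegB e e' : ydeg (e - e') = ydeg e - ydeg e'. Proof. by []. Qed.
Lemma xdegB e e' : xdeg (e - e') = xdeg e - xdeg e'. Proof. by []. Qed.

Lemma adm_lb f : admissible f -> forall b : int, exists L : int,
  forall e, f e != 0 -> zdeg e <= b -> L <= tdeg e.
Proof.
move=> [fz [ft _]] b.
have [b0|b0] := ltP b 0.
  by exists 0 => e /fz ez /(le_trans ez); lia.
rewrite -[b]gez0_abs //; elim: `|b|%N => [|m [L IH]].
  by have [L hL] := ft 0; exists L => e he hz; apply: hL => //; have := fz e he; lia.
have [L' hL'] := ft m.+1; exists (Num.min L L') => e he hz.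
rewrite ge_min; have [em|em] := eqVneq (zdeg e) m.+1.
  by rewrite hL' ?orbT.
by rewrite IH //; lia.
Qed.

Lemma adm_box f : admissible f -> forall a b : int, exists s : seq (expo k),
  forall e, f e != 0 -> zdeg e <= b -> tdeg e <= a -> e \in s.
Proof.
move=> fA a b; have [L hL] := adm_lb fA b; have [fz [_ fs]] := fA.
have [s hs] : exists s : int -> int -> seq (expo k),
    forall z t e, f e != 0 -> zdeg e = z -> tdeg e = t -> e \in s z t.
  have /choice[s hs] : forall zt : int * int, exists s : seq (expo k),
    forall e, f e != 0 -> zdeg e = zt.1 -> tdeg e = zt.2 -> e \in s by move=> zt; exact: fs.
  by exists (fun z t => s (z, t)) => z t e; exact: (hs (z, t)).
exists (flatten [seq s (i%:Z) (L + j%:Z) | i <- iota 0 `|b|.+1, j <- iota 0 `|a - L|.+1]).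
move=> e he eb ea; have z0 := fz e he; have Lt := hL e he eb.
apply/flattenP; exists (s `|zdeg e|%N (L + `|tdeg e - L|%N)); last by apply: hs => //; lia.
by apply/allpairsP; exists (`|zdeg e|%N, `|tdeg e - L|%N); rewrite !mem_iota; split => //=; lia.
Qed.

(** Both z-degrees are nonnegative, hence at most that of e; the lower bound on the t-degrees of g
    then bounds those of f from above, which leaves a finite box. *)
Lemma smul_fin f g : admissible f -> admissible g -> forall e,
  fin_supp (fun e1 => f e1 * g (e - e1)).
Proof.
move=> fA gA e; have [L hL] := adm_lb gA (zdeg e).
have [s hs] := adm_box fA (tdeg e - L) (zdeg e).
exists s => e1; rewrite mulf_eq0 negb_or => /andP[f1 g1].
have := fA.1 _ f1; have := gA.1 _ g1; rewrite zdegB => z1 z2.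
have := hL _ g1; rewrite tdegB zdegB => t1.
by apply: hs => //; lia.
Qed.

Lemma smul_neq0 f g e : smul f g e != 0 ->
  exists e1, f e1 != 0 /\ g (e - e1) != 0.
Proof.
by move=> /fsum_neq0[e1 + _]; rewrite mulf_eq0 negb_or => /andP[]; exists e1.
Qed.

Lemma smul_fin3 f g h : admissible f -> admissible g -> admissible h -> forall e,
  exists s : seq (expo k * expo k), forall d a,
    f a * g (d - a) * h (e - d) != 0 -> (d, a) \in s.
Proof.
move=> fA gA hA e; have [F hF] := adm_lb fA (zdeg e).
have [G hG] := adm_lb gA (zdeg e); have [H hH] := adm_lb hA (zdeg e).
have [s hs] := adm_box fA (tdeg e - G - H) (zdeg e).
have [s' hs'] := adm_box gA (tdeg e - F - H) (zdeg e).
exists [seq (a + b, a) | a <- s, b <- s'] => d a.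
rewrite !mulf_eq0 !negb_or -andbA => /and3P[f0 g0 h0].
have := fA.1 _ f0; have := gA.1 _ g0; have := hA.1 _ h0; rewrite !zdegB => z1 z2 z3.
have := hF _ f0; have := hG _ g0; have := hH _ h0; rewrite !zdegB !tdegB => t1 t2 t3.
apply/allpairsP; exists (a, d - a) => /=; split.
- by apply: hs => //; lia.
- by apply: hs' => //; rewrite ?zdegB ?tdegB; lia.
by rewrite addrC subrK.
Qed.

Lemma expo_subI e : injective (fun e1 : expo k => e - e1).
Proof. by move=> a b /addrI /oppr_inj. Qed.

Lemma smulC f g : admissible f -> admissible g -> smul f g = smul g f.
Proof.
move=> fA gA; apply/funext => e; rewrite /smul.
rewrite (fsum_reindex (@expo_subI e)).
- by apply: eq_fsum => e1; rewrite mulrC subKr.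
- by move=> y _; exists (e - y); rewrite subKr.
- exact: smul_fin.
Qed.

Lemma smulA f g h : admissible f -> admissible g -> admissible h ->
  smul f (smul g h) = smul (smul f g) h.
Proof.
move=> fA gA hA; apply/funext => e.
transitivity (fsum (fun a => fsum (fun d => f a * g (d - a) * h (e - d)))).
  apply: eq_fsum => a; rewrite -fsumZ; last exact: smul_fin.
  have ia : injective (fun d : expo k => d - a) by move=> x y /addIr.
  rewrite (fsum_reindex ia) /=.
  - by apply: eq_fsum => d; rewrite mulrA opprB addrA subrK.
  - by move=> y _; exists (y + a); rewrite addrK.
  have [s hs] := smul_fin gA hA (e - a); exists s => x.
  by move=> xn; apply: hs; apply: contraNN xn => /eqP ->; rewrite mulr0.
rewrite fsum_exchange; last first.
  have [s hs] := smul_fin3 fA gA hA e.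
  by exists [seq (p.2, p.1) | p <- s] => a d /hs ds; apply/mapP; exists (d, a).
apply: eq_fsum => d; rewrite -fsumZr //; exact: smul_fin.
Qed.

Lemma smul1 f : smul (@sone k) f = f.
Proof.
apply/funext => e; rewrite /smul (@fsum1 _ _ 0); last first.
  by move=> x x0; rewrite /sone /smon (negbTE x0) mul0r.
by rewrite /sone /smon eqxx mul1r subr0.
Qed.

Lemma smulDl f g h : admissible f -> admissible g -> admissible h ->
  smul (sadd f g) h = sadd (smul f h) (smul g h).
Proof.
move=> fA gA hA; apply/funext => e; rewrite /smul /sadd -fsumD; [|exact: smul_fin..].
by apply: eq_fsum => x; rewrite mulrDl.
Qed.

Lemma adm_sone : admissible (@sone k).
Proof.
have s0 e : sone e != 0 -> e = 0 :> expo k.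
  by rewrite /sone /smon; case: (e =P 0) => // _; rewrite eqxx.
split; first by move=> e /s0 ->.
split; first by move=> a; exists 0 => e /s0 ->.
by move=> a b; exists [:: 0] => e /s0 ->; rewrite inE.
Qed.

(** This allows inverses to be constructed in any subring of the admissible series. *)
Lemma sinv_unique f g : admissible f -> admissible g -> smul f g = @sone k ->
  sinv f = g.
Proof.
move=> fA gA fg.
have [hA fh] : admissible (sinv f) /\ smul f (sinv f) = @sone k.
  by apply: (epsilon_spec (inhabits _) (fun g => admissible g /\ _)); exists g.
by rewrite -[sinv f]smul1 -fg [smul f _]smulC // -smulA // fh smulC // ?smul1 //; exact: adm_sone.
Qed.
End Admissible.

(** * The ring of series with superlinear q-degree *)

Section Good.
Variable k : nat.
Implicit Types (f g : series k) (e : expo k).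

Definition yxlin (lam : expo k -> int) :=
  (forall e e', lam (e + e') = lam e + lam e') /\ forall a b, lam (a, b, 0, 0) = 0.

(* Unlike admissibility, this is stable under the substitutions x_i -> q^d x_i:
   the t-degree outgrows every linear function of the x- and y-degrees. *)
Definition good f :=
  (forall e, f e != 0 -> 0 <= zdeg e) /\
  forall lam, yxlin lam -> forall b : int, exists L : int,
    forall e, f e != 0 -> zdeg e <= b -> L <= tdeg e + lam e.

Lemma yxlin0 : yxlin (fun=> 0).
Proof. by []. Qed.

Lemma yxlin_y c : yxlin (fun e => c * ydeg e).
Proof. by split=> [e e'|a b]; rewrite ?ydegD ?mulrDr // /ydeg /= mulr0. Qed.

Lemma yxlin_x c i : yxlin (fun e => c * xdeg e 0 i).
Proof. by split=> [e e'|a b]; rewrite ?xdegD ?mxE ?mulrDr // mulr0. Qed.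

Lemma expo_eta e : e = (tdeg e, zdeg e, ydeg e, xdeg e).
Proof. by case: e => [[[]]]. Qed.

Lemma yxlinE lam e : yxlin lam -> lam e = lam (0, 0, ydeg e, xdeg e).
Proof.
move=> [lD l0]; rewrite [in LHS](_ : e = (tdeg e, zdeg e, 0, 0) + (0, 0, ydeg e, xdeg e)).
  by rewrite lD l0 add0r.
rewrite {1}[e]expo_eta; congr (_, _, _, _) => /=; rewrite ?addr0 ?add0r //.
Qed.

(** At fixed t- and z-degree the forms +y, -y, +x_i, -x_i bound every remaining exponent in absolute
    value; M is a common bound, and the box of side 2M+1 is the finite list. *)
Lemma good_adm f : good f -> admissible f.
Proof.
move=> [fz fl]; split=> //; split.
  move=> a; have [L hL] := fl _ yxlin0 a; exists L => e he ez.
  by have := hL e he; rewrite addr0 ez => ->.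
move=> a b.
have [Y1 hY1] := fl _ (yxlin_y 1) a; have [Y2 hY2] := fl _ (yxlin_y (-1)) a.
have /choice[X1 hX1] := fun i => fl _ (yxlin_x 1 i) a.
have /choice[X2 hX2] := fun i => fl _ (yxlin_x (-1) i) a.
pose M := (`|b| + `|Y1| + `|Y2| + \sum_i `|X1 i| + \sum_i `|X2 i|)%N.
pose dec (j : 'I_(M + M).+1) : int := j%:Z - M%:Z.
pose T := ('I_(M + M).+1 * {ffun 'I_k -> 'I_(M + M).+1})%type.
pose E (p : T) : expo k := (b, a, dec p.1, \row_i dec (p.2 i)).
exists (codom E) => e he ez et.
have hM (x : int) : (`|x| <= M)%N -> exists j, dec j = x.
  move=> xM; have jb : (absz (x + M%:Z)%R < (M + M).+1)%N by clear -xM; lia.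
  by exists (Ordinal jb); rewrite /dec /=; lia.
have le_ez : zdeg e <= a by rewrite ez.
have [jy hjy] : exists j, dec j = ydeg e.
  apply: hM; have := hY1 e he le_ez; have := hY2 e he le_ez; rewrite /M et; lia.
have /choice[jx hjx] : forall i, exists j, dec j = xdeg e 0 i.
  move=> i; apply: hM; have := hX1 i e he le_ez; have := hX2 i e he le_ez.
  rewrite /M et (bigD1 i) // (bigD1 i (F := fun i => `|X2 i|%N)) //=.
  set S1 := (\sum_(_ | _) _)%N; set S2 := (\sum_(_ | _) _)%N; lia.
apply/codomP; exists (jy, finfun jx); rewrite /E /=.
rewrite [e in LHS]expo_eta et ez hjy; congr (_, _, _, _).
by apply/rowP => i; rewrite mxE ffunE hjx.
Qed.

Lemma good_smon c e : 0 <= zdeg e -> good (smon c e).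
Proof.
move=> ze; have s0 e' : smon c e e' != 0 -> e' = e.
  by rewrite /smon; case: (e' =P e) => // _; rewrite eqxx.
by split=> [e' /s0 -> //|lam _ b]; exists (tdeg e + lam e) => e' /s0 ->.
Qed.

Lemma good_sadd f g : good f -> good g -> good (sadd f g).
Proof.
have s0 e : sadd f g e != 0 -> f e != 0 \/ g e != 0.
  rewrite /sadd; case: (eqVneq (f e) 0) => [->|]; last by left.
  by rewrite add0r; right.
move=> [fz fl] [gz gl]; split=> [e /s0[/fz|/gz]//|lam ll b].
have [L hL] := fl _ ll b; have [L' hL'] := gl _ ll b.
exists (Num.min L L') => e /s0[he|he] eb; rewrite ge_min.
  by rewrite hL.
by rewrite hL' ?orbT.
Qed.

Lemma good_sopp f : good f -> good (sopp f).
Proof.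
move=> [fz fl]; split=> [e|lam ll b]; first by rewrite oppr_eq0; apply: fz.
by have [L hL] := fl _ ll b; exists L => e; rewrite oppr_eq0; apply: hL.
Qed.

Lemma good_smul f g : good f -> good g -> good (smul f g).
Proof.
move=> [fz fl] [gz gl]; split.
  by move=> e /smul_neq0[e1 [/fz + /gz]]; rewrite zdegB; lia.
move=> lam ll b.
have [L hL] := fl _ ll b; have [L' hL'] := gl _ ll b.
exists (L + L') => e /smul_neq0[e1 [f1 g1]] eb.
have := fz _ f1; have := gz _ g1; rewrite zdegB => z1 z2.
have := hL _ f1; have := hL' _ g1; rewrite zdegB tdegB.
have -> : lam e = lam e1 + lam (e - e1) by rewrite -ll.1 addrC subrK.
lia.
Qed.
End Good.

Record gser (k : nat) := Gser { gsv :> expo k -> rat; gsvP : good gsv }.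

Section GserRing.
Variable k : nat.
Implicit Types f g h : gser k.

Lemma gser_eqP f g : (forall e, f e = g e) -> f = g.
Proof.
case: f g => [f fP] [g gP] /= /funext fg; case: _ / fg gP => gP.
by rewrite (Prop_irrelevance fP gP).
Qed.

HB.instance Definition _ := gen_eqMixin (gser k).
HB.instance Definition _ := gen_choiceMixin (gser k).

Definition gadd f g := Gser (good_sadd (gsvP f) (gsvP g)).
Definition gopp f := Gser (good_sopp (gsvP f)).
Definition gmul f g := Gser (good_smul (gsvP f) (gsvP g)).
Lemma good_szero : good (@szero k).
Proof. by split=> [e|lam _ b]; [|exists 0 => e]; rewrite /szero eqxx. Qed.
Definition gzero := Gser good_szero.
Lemma good_sone : good (@sone k).
Proof. exact: good_smon. Qed.
Definition gone := Gser good_sone.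

Lemma gaddA : associative gadd.
Proof. by move=> f g h; apply: gser_eqP => e; rewrite /= /sadd addrA. Qed.
Lemma gaddC : commutative gadd.
Proof. by move=> f g; apply: gser_eqP => e; rewrite /= /sadd addrC. Qed.
Lemma gadd0 : left_id gzero gadd.
Proof. by move=> f; apply: gser_eqP => e; rewrite /= /sadd add0r. Qed.
Lemma gaddN : left_inverse gzero gopp gadd.
Proof. by move=> f; apply: gser_eqP => e; rewrite /= /sadd /sopp addNr. Qed.
HB.instance Definition _ := GRing.isZmodule.Build (gser k) gaddA gaddC gadd0 gaddN.

Lemma gmulA : associative gmul.
Proof.
by move=> f g h; apply: gser_eqP => e; rewrite /= smulA //; apply/good_adm/gsvP.
Qed.
Lemma gmulC : commutative gmul.
Proof.
by move=> f g; apply: gser_eqP => e; rewrite /= smulC //; apply/good_adm/gsvP.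
Qed.
Lemma gmul1 : left_id gone gmul.
Proof. by move=> f; apply: gser_eqP => e; rewrite /= smul1. Qed.
Lemma gmulDl : left_distributive gmul gadd.
Proof.
by move=> f g h; apply: gser_eqP => e; rewrite /= smulDl //; apply/good_adm/gsvP.
Qed.
Lemma gone_neq0 : gone != 0.
Proof.
apply/eqP => /(congr1 (fun f : gser k => f 0)) /=.
by rewrite /sone /smon eqxx.
Qed.
HB.instance Definition _ :=
  GRing.Zmodule_isComNzRing.Build (gser k) gmulA gmulC gmul1 gmulDl gone_neq0.

Definition gunit : pred (gser k) := fun f => `[< exists g, g * f = 1 >].
Definition ginv f : gser k :=
  epsilon (inhabits f) (fun g => if gunit f then g * f = 1 else g = f).
Lemma gmulV : {in gunit, left_inverse 1 ginv *%R}.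
Proof.
move=> f uf0; have uf : gunit f := uf0; have /asboolP[g gf] := uf.
have := epsilon_spec (inhabits f) (fun g => if gunit f then g * f = 1 else g = f).
by rewrite -/(ginv f) uf => /(_ (ex_intro _ g gf)).
Qed.
Lemma gunitP f g : g * f = 1 -> gunit f.
Proof. by move=> gf; apply/asboolP; exists g. Qed.
Lemma ginv_out : {in [predC gunit], ginv =1 id}.
Proof.
move=> f uf0; have uf : ~~ gunit f := uf0.
have := epsilon_spec (inhabits f) (fun g => if gunit f then g * f = 1 else g = f).
by rewrite -/(ginv f) (negbTE uf) => /(_ (ex_intro _ f erefl)).
Qed.
HB.instance Definition _ :=
  GRing.ComNzRing_hasMulInverse.Build (gser k) gmulV gunitP ginv_out.

Lemma gsvM f g : gsv (f * g) = smul (gsv f) (gsv g). Proof. by []. Qed.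
Lemma gsvD f g : gsv (f + g) = sadd (gsv f) (gsv g). Proof. by []. Qed.
Lemma gsvB f g : gsv (f - g) = ssub (gsv f) (gsv g). Proof. by []. Qed.
Lemma gsv1 : gsv (1 : gser k) = @sone k. Proof. by []. Qed.
Lemma gsv0 : gsv (0 : gser k) = @szero k. Proof. by []. Qed.
Lemma gsvX f m : gsv (f ^+ m) = spow (gsv f) m.
Proof. by elim: m => [|m IH] //; rewrite exprS gsvM IH. Qed.

Lemma gsvV f : f \is a GRing.unit -> gsv f^-1 = sinv (gsv f).
Proof.
move=> uf; apply/esym/sinv_unique; [exact/good_adm/gsvP..|].
by rewrite -gsvM divrr.
Qed.

Lemma gsv_div f g : g \is a GRing.unit -> gsv (f / g) = sdiv (gsv f) (gsv g).
Proof. by move=> ug; rewrite gsvM gsvV. Qed.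

Lemma gsv_prod (I : Type) (r : seq I) (P : pred I) (F : I -> gser k) :
  gsv (\prod_(i <- r | P i) F i) = \big[@smul k/@sone k]_(i <- r | P i) gsv (F i).
Proof. exact: (@big_morph (series k) (gser k) (@gsv k) _ (@smul k) _ *%R gsvM gsv1). Qed.

Lemma gsv_sum (I : Type) (r : seq I) (P : pred I) (F : I -> gser k) :
  gsv (\sum_(i <- r | P i) F i) = \big[@sadd k/@szero k]_(i <- r | P i) gsv (F i).
Proof. exact: (@big_morph (series k) (gser k) (@gsv k) _ (@sadd k) _ +%R gsvD gsv0). Qed.

Lemma gaddE f g e : (f + g) e = f e + g e. Proof. by []. Qed.
Lemma goppE f e : (- f) e = - f e. Proof. by []. Qed.
Lemma gone_E e : (1 : gser k) e = (e == 0)%:R.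
Proof. by rewrite gsv1 /sone /smon; case: ifP. Qed.
Lemma gsumE (I : Type) (r : seq I) (P : pred I) (F : I -> gser k) e :
  (\sum_(i <- r | P i) F i) e = \sum_(i <- r | P i) F i e.
Proof. exact: (big_morph (fun f : gser k => f e) (fun f g => gaddE f g e) erefl). Qed.
End GserRing.

(** * Monomials, substitutions and the constant term *)

Section Mon.
Variable k : nat.
Implicit Types (a c : int) (b : nat) (v : 'rV[int]_k) (f : gser k) (e : expo k).

Lemma good_mon a b c v : good (@mono k a b%:Z c v).
Proof. exact: good_smon. Qed.
(** The z-exponent is a natural number, which makes every such monomial good. *)
Definition mon a b c v : gser k := Gser (good_mon a b c v).

Lemma monE a b c v e : mon a b c v e = (e == (a, b%:Z, c, v))%:R.
Proof. by rewrite /= /mono /smon; case: ifP. Qed.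

Lemma mon_mulE a b c v f e : (mon a b c v * f) e = f (e - (a, b%:Z, c, v)).
Proof.
rewrite gsvM /smul (@fsum1 _ _ (a, b%:Z, c, v)); first by rewrite monE eqxx mul1r.
by move=> x xm; rewrite monE (negbTE xm) mul0r.
Qed.

Lemma monM a b c v a' b' c' v' :
  mon a b c v * mon a' b' c' v' = mon (a + a') (b + b') (c + c') (v + v').
Proof.
apply: gser_eqP => e; rewrite mon_mulE !monE subr_eq; congr ((_ == _)%:R).
by rewrite PoszD ![_ + (a, _, _, _)]addrC.
Qed.

Lemma mon0 : mon 0 0 0 0 = 1.
Proof. by apply: gser_eqP => e; rewrite monE gone_E. Qed.

Lemma monX a b c v m : mon a b c v ^+ m = mon (a *+ m) (b * m) (c *+ m) (v *+ m).
Proof.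
elim: m => [|m IH]; first by rewrite muln0 mon0.
by rewrite exprS IH monM !mulrS mulnS.
Qed.

Lemma mon_unit a c v : mon a 0 c v \is a GRing.unit.
Proof.
apply/unitrP; exists (mon (- a) 0 (- c) (- v)).
by rewrite !monM !addNr !subrr mon0.
Qed.
End Mon.

Structure expmap (k k' : nat) := Expmap {
  em :> expo k -> expo k';
  emi : expo k' -> expo k;
  emD : forall e e', em (e + e') = em e + em e';
  emK : cancel em emi;
  em0 : forall a b, em (a, b, 0, 0) = (a, b, 0, 0);
  emz : forall e, zdeg (em e) = zdeg e }.

Section Push.
Variables (k k' : nat) (L : expmap k k').
Implicit Types (f g : gser k).

(** [emi] is only a left inverse of L, so the test decides whether e lies in the image of L. *)
Definition pushs f : series k' := fun e =>
  if L (emi L e) == e then f (emi L e) else 0.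

Lemma pushs_em f e : pushs f (L e) = f e.
Proof. by rewrite /pushs emK eqxx. Qed.

Lemma pushs_neq0 f e : pushs f e != 0 -> exists2 e1, e = L e1 & f e1 != 0.
Proof.
rewrite /pushs; case: (L (emi L e) =P e) => [<-|]; last by rewrite eqxx.
by rewrite emK; exists (emi L e).
Qed.

Lemma em00 : L 0 = 0.
Proof. by apply: (addrI (L 0)); rewrite -emD !addr0. Qed.

(** Composing t-degree plus [lam] with L gives the t-degree plus another form that vanishes on
    powers of t and z. This is why [good] quantifies over all such forms. *)
Lemma good_pushs f : good (pushs f).
Proof.
have [fz fl] := gsvP f; split.
  by move=> e /pushs_neq0[e1 -> /fz]; rewrite emz.
move=> lam [lD l0] b.
have [] := fl (fun e => tdeg (L e) + lam (L e) - tdeg e) _ b.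
  split=> [e e'|a c]; first by rewrite emD lD !tdegD; lia.
  by rewrite em0 l0 /tdeg /=; lia.
move=> B hB; exists B => e /pushs_neq0[e1 -> e1f]; rewrite emz => /(hB _ e1f); lia.
Qed.

Definition push f := Gser (good_pushs f).

Lemma push_em f e : push f (L e) = f e.
Proof. exact: pushs_em. Qed.

Lemma push_eqP f (g : gser k') : (forall e, g (L e) = f e) ->
  (forall e, g e != 0 -> exists e1, e = L e1) -> push f = g.
Proof.
move=> gL gS; apply: gser_eqP => e.
have [[e1 ->]|ne] := EM (exists e1, e = L e1); first by rewrite push_em gL.
transitivity (0 : rat).
  by apply/eqP; apply: contraPT ne => /pushs_neq0[e1 -> _]; apply; exists e1.
by apply/esym/eqP; apply: contraPT ne => /gS ex; apply.
Qed.

Lemma push_zmod : zmod_morphism push.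
Proof.
move=> f g; apply: push_eqP => e; first by rewrite gaddE goppE !push_em.
rewrite gaddE goppE; case: (eqVneq (push f e) 0) => [->|/pushs_neq0[e1 -> _] _].
  by rewrite add0r oppr_eq0 => /pushs_neq0[e1 -> _]; exists e1.
by exists e1.
Qed.

Lemma em_inj : injective L. Proof. exact: can_inj (@emK _ _ L). Qed.

Lemma emB e e' : L (e - e') = L e - L e'.
Proof. by apply: (addIr (L e')); rewrite -emD !subrK. Qed.

Lemma push_monoid : monoid_morphism push.
Proof.
split.
  apply: push_eqP => [e|e]; rewrite !gone_E.
    by rewrite -{1}em00 (inj_eq em_inj).
  by case: (e =P 0) => [-> _|]; [exists 0; rewrite em00|rewrite eqxx].
move=> f g; apply: push_eqP => e.
  rewrite !gsvM /smul (fsum_reindex em_inj).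
  - by apply: eq_fsum => e1; rewrite -emB !push_em.
  - move=> y; rewrite mulf_eq0 negb_or => /andP[/pushs_neq0[e1 -> _] _].
    by exists e1.
  by apply: smul_fin; exact/good_adm/gsvP.
rewrite gsvM => /smul_neq0[e1 [/pushs_neq0[e2 e12 _] /pushs_neq0[e3 e13 _]]].
by exists (e2 + e3); rewrite emD -e12 -e13 addrC subrK.
Qed.
HB.instance Definition _ := GRing.isZmodMorphism.Build (gser k) (gser k') push push_zmod.
HB.instance Definition _ := GRing.isMonoidMorphism.Build (gser k) (gser k') push push_monoid.

Lemma push_mon a b c v a' c' v' : L (a, b%:Z, c, v) = (a', b%:Z, c', v') ->
  push (mon a b c v) = mon a' b c' v'.
Proof.
move=> Le; apply: push_eqP => e; rewrite !monE -Le ?(inj_eq em_inj) //.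
by case: (e =P _) => [->|]; [exists (a, b%:Z, c, v)|rewrite eqxx].
Qed.
End Push.

Section CT.
Variable k : nat.
Implicit Types (f g c : gser k).

Definition cts f : series k := fun e => if (ydeg e == 0) && (xdeg e == 0) then f e else 0.

Lemma good_cts f : good (cts f).
Proof.
have [fz fl] := gsvP f; have s0 e : cts f e != 0 -> f e != 0.
  by rewrite /cts; case: ifP => //; rewrite eqxx.
split=> [e /s0/fz //|lam ll b]; have [B hB] := fl lam ll b.
by exists B => e /s0; apply: hB.
Qed.
(** The constant term stays in the same ring, so a scalar, a series in t and z alone, is recognised
    by [CT c = c]. *)
Definition CT f := Gser (good_cts f).

Lemma CTE f e : CT f e = if (ydeg e == 0) && (xdeg e == 0) then f e else 0.
Proof. by []. Qed.

Lemma CT_zmod : zmod_morphism CT.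
Proof.
by move=> f g; apply: gser_eqP => e; rewrite gaddE goppE !CTE gaddE goppE; case: ifP.
Qed.
HB.instance Definition _ := GRing.isZmodMorphism.Build (gser k) (gser k) CT CT_zmod.

Lemma cst_neq0 c e : CT c = c -> c e != 0 -> (ydeg e == 0) && (xdeg e == 0).
Proof. by move=> <-; rewrite CTE; case: ifP; rewrite ?eqxx. Qed.

Lemma CTZ c f : CT c = c -> CT (c * f) = c * CT f.
Proof.
move=> cc; apply: gser_eqP => e; rewrite CTE !gsvM /smul.
case: ifP => ec.
  apply: eq_fsum => e1; case: (eqVneq (c e1) 0) => [->|/(cst_neq0 cc)/andP[/eqP y0 /eqP x0]].
    by rewrite !mul0r.
  by rewrite CTE ydegB xdegB y0 x0 !subr0 ec.
rewrite fsum0 // => e1.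
case: (eqVneq (c e1) 0) => [->|/(cst_neq0 cc)/andP[/eqP y0 /eqP x0]]; first by rewrite mul0r.
by rewrite CTE ydegB xdegB y0 x0 !subr0 ec mulr0.
Qed.

Lemma CT1 : CT 1 = 1.
Proof.
apply: gser_eqP => e; rewrite CTE gone_E.
case: (e =P 0) => [->|_]; last by case: ifP.
by rewrite /ydeg /xdeg /= !eqxx.
Qed.

Lemma cst_mon a b : CT (mon a b 0 0) = mon a b 0 0.
Proof.
apply: gser_eqP => e; rewrite CTE monE.
case: (e =P _) => [->|_]; last by case: ifP.
by rewrite /ydeg /xdeg /= !eqxx.
Qed.

Lemma cstM c c' : CT c = c -> CT c' = c' -> CT (c * c') = c * c'.
Proof. by move=> cc cc'; rewrite CTZ // cc'. Qed.

Lemma cstB c c' : CT c = c -> CT c' = c' -> CT (c - c') = c - c'.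
Proof. by move=> cc cc'; rewrite raddfB /= cc cc'. Qed.

Lemma cstN c : CT c = c -> CT (- c) = - c.
Proof. by move=> cc; rewrite raddfN /= cc. Qed.

Lemma cst_prod (I : Type) (r : seq I) (P : pred I) (F : I -> gser k) :
  (forall i, P i -> CT (F i) = F i) ->
  CT (\prod_(i <- r | P i) F i) = \prod_(i <- r | P i) F i.
Proof.
move=> cF; elim/big_ind: _ => //; [exact: CT1 | by move=> *; exact: cstM].
Qed.

Lemma cstX c m : CT c = c -> CT (c ^+ m) = c ^+ m.
Proof.
by move=> cc; elim: m => [|m IH]; [exact: CT1|rewrite exprS cstM].
Qed.

Lemma cst_nat m : CT m%:R = m%:R.
Proof. by rewrite raddfMn /= CT1. Qed.
End CT.

(** * Infinite q-shifted factorials *)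

Section Qp.
Variable k : nat.
Implicit Types (a c : int) (b : nat) (v : 'rV[int]_k) (f : gser k) (e : expo k).

Definition qpn a b c v N : gser k := \prod_(l < N) (1 - mon (a + (l.*2)%:Z) b c v).

Lemma qpnS a b c v N :
  qpn a b c v N.+1 = qpn a b c v N * (1 - mon (a + (N.*2)%:Z) b c v).
Proof. by rewrite /qpn big_ord_recr. Qed.

Lemma qpnSl a b c v N : qpn a b c v N.+1 = (1 - mon a b c v) * qpn (a + 2) b c v N.
Proof.
rewrite /qpn big_ord_recl /= addr0; congr (_ * _); apply: eq_bigr => i _.
by congr (1 - mon _ _ _ _); rewrite /bump /= add1n; lia.
Qed.

Lemma mul_1mon_E a b c v f e :
  ((1 - mon a b c v) * f) e = f e - f (e - (a, b%:Z, c, v)).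
Proof. by rewrite mulrBl mul1r gaddE goppE mon_mulE. Qed.

(* A product of s distinct factors - a q^l carries q to the power at least s(s-1)/2. *)
Definition qsupp a b c v e := exists s j : nat, (s * s <= j.*2 + s)%N /\
  e = (a *+ s + (j.*2)%:Z, (b * s)%:Z, c *+ s, v *+ s).

(** Choosing the term q^N of the last factor raises s by 1 and j by N; the clause [s <= N] is what
    preserves the quadratic bound in the induction. *)
Lemma qpn_supp a b c v N e : qpn a b c v N e != 0 ->
  exists s j : nat, [/\ (s <= N)%N, (s * s <= j.*2 + s)%N &
  e = (a *+ s + (j.*2)%:Z, (b * s)%:Z, c *+ s, v *+ s)].
Proof.
elim: N e => [|N IH] e.
  rewrite /qpn big_ord0 gone_E; case: (e =P 0) => [-> _|_ /eqP//].
  by exists 0%N, 0%N; split; rewrite // muln0 !mulr0n.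
rewrite qpnS mulrC mul_1mon_E.
have [->|/IH + _] := eqVneq (qpn a b c v N e) 0; last first.
  by move=> [s [j [sN sj ->]]]; exists s, j; split => //; rewrite ltnW.
rewrite sub0r oppr_eq0 => /IH[s [j [sN sj /eqP]]]; rewrite subr_eq => /eqP ->.
exists s.+1, (j + N)%N; split => //; first by nia.
congr (_, _, _, _) => /=.
- by rewrite mulrSr doubleD PoszD; lia.
- by rewrite mulnS PoszD addrC.
- by rewrite mulrSr.
- by rewrite mulrSr.
Qed.

(** Since s(s-1) + a s >= -(a-1)^2, a term using the factor of index N has t-degree at least a + 2N
    - (a-1)^2; beyond this bound that factor no longer affects the coefficient. *)
Definition qbound a : int := (a - 1) ^+ 2 + `|a| + 1.

Lemma qpn_stable a b c v e N : tdeg e + qbound a <= (N.*2)%:Z ->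
  qpn a b c v N.+1 e = qpn a b c v N e.
Proof.
move=> eN; rewrite qpnS mulrC mul_1mon_E; set e' := e - _.
case: (eqVneq (qpn a b c v N e') 0) => [->|]; first by rewrite subr0.
move=> /qpn_supp[s [j [_ sj /eqP]]]; rewrite subr_eq => /eqP ee.
have : tdeg e = a *+ s + (j.*2)%:Z + (a + (N.*2)%:Z) by rewrite ee.
move: eN; rewrite /qbound -mulr_natr; set x := tdeg e => xN xe.
have : (s%:Z * s%:Z <= (j.*2)%:Z + s%:Z) by lia.
have sR : (s%:R : int) = s by rewrite natz.
rewrite sR in xe; clear sR; nia.
Qed.

Definition qpf a b c v : series k := fun e =>
  qpn a b c v (absz (tdeg e + qbound a)).+1 e.

Lemma qpn_qpf a b c v e : exists N0, forall N, (N0 <= N)%N ->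
  qpn a b c v N e = qpf a b c v e.
Proof.
exists (absz (tdeg e + qbound a)).+1; rewrite /qpf; set M := _.+1.
elim=> [|N IH] //; rewrite leq_eqVlt => /predU1P[<- //|]; rewrite ltnS => MN.
by rewrite qpn_stable; [exact: IH|rewrite /M in MN; lia].
Qed.

Lemma qpf_supp a b c v e : qpf a b c v e != 0 -> qsupp a b c v e.
Proof. by move=> /qpn_supp[s [j [_ sj ->]]]; exists s, j. Qed.

Lemma yxlinMn lam s e : @yxlin k lam -> lam (e *+ s) = lam e *+ s.
Proof.
move=> [lD l0]; elim: s => [|s IH]; first by rewrite !mulr0n (l0 0 0).
by rewrite !mulrS lD IH.
Qed.

Lemma expoMn (x z y : int) (w : 'rV[int]_k) s :
  ((x, z, y, w) : expo k) *+ s = (x *+ s, z *+ s, y *+ s, w *+ s).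
Proof. by elim: s => [|s IH] //; rewrite !mulrS IH. Qed.

Lemma good_qpf a b c v : good (qpf a b c v).
Proof.
split; first by move=> e /qpf_supp[s [j [_ ->]]].
move=> lam ll z; pose m := lam (0, 0, c, v).
exists (- (a + m - 1) ^+ 2) => e /qpf_supp[s [j [sj ->]]] _.
rewrite (yxlinE _ ll) /tdeg /ydeg /xdeg /=.
have -> : lam (0, 0, c *+ s, v *+ s) = m *+ s.
  by rewrite /m -yxlinMn // expoMn !mul0rn.
have mE x : x *+ s = x * s%:Z :> int by rewrite -mulr_natr natz.
rewrite !mE.
have : (s%:Z * s%:Z <= (j.*2)%:Z + s%:Z) by lia.
have := sqr_ge0 (s%:Z + (a + m - 1)); have := sqr_ge0 s%:Z; have := sqr_ge0 (a + m - 1).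
move: (s%:Z) (j.*2%:Z) m => S J m; rewrite !expr2; clear; lia.
Qed.

Definition qp a b c v : gser k := Gser (good_qpf a b c v).

Lemma qp_lim a b c v e : exists N0, forall N, (N0 <= N)%N ->
  qpn a b c v N e = qp a b c v e.
Proof. exact: qpn_qpf. Qed.

Lemma qp_supp a b c v e : qp a b c v e != 0 -> qsupp a b c v e.
Proof. exact: qpf_supp. Qed.

Lemma gsv_qpn a b c v N : gsv (qpn a b c v N) = qpochn (mono a b%:Z c v) (@qpow k 1) N.
Proof.
rewrite gsv_prod /qpochn; apply: eq_bigr => l _.
rewrite gsvB gsv1; congr (ssub _ _).
have -> : spow (@qpow k 1) l = gsv (mon (l.*2)%:Z 0 0 0 : gser k).
  have -> : @qpow k 1 = gsv (mon 2 0 0 0 : gser k) by [].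
  rewrite -gsvX monX mul0n !mul0rn; congr (gsv (mon _ _ _ _)).
  by rewrite -mulr_natr natz; lia.
have -> : mono a b%:Z c v = gsv (mon a b c v) by [].
by rewrite -gsvM monM addn0 !addr0.
Qed.

Lemma qpochE a b c v : qpoch (mono a b%:Z c v) = gsv (qp a b c v).
Proof.
apply/funext => e; rewrite /qpoch /slim.
have [N0 h0] := qp_lim a b c v e.
pose P w := exists N, forall m, (N <= m)%N -> qpochn (mono a b%:Z c v) (@qpow k 1) m e = w.
have [N1 h1] : P (epsilon (inhabits 0) P).
  apply: epsilon_spec; exists (qp a b c v e), N0 => m /h0 <-.
  by rewrite gsv_qpn.
have := h1 (maxn N0 N1); rewrite leq_maxr -gsv_qpn h0 ?leq_maxl // => ->//.
Qed.

Lemma qpS a b c v : qp a b c v = (1 - mon a b c v) * qp (a + 2) b c v.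
Proof.
apply: gser_eqP => e; rewrite mul_1mon_E; set e' := e - _.
have [N0 h0] := qp_lim a b c v e; have [N1 h1] := qp_lim (a + 2) b c v e.
have [N2 h2] := qp_lim (a + 2) b c v e'.
pose N := (N0 + N1 + N2)%N.
rewrite -(h0 N.+1) -1?(h1 N) -1?(h2 N) ?/N; try lia.
by rewrite qpnSl mul_1mon_E.
Qed.

Lemma cst_qp a b : CT (qp a b 0 0) = qp a b 0 0.
Proof.
apply: gser_eqP => e; rewrite CTE; case: ifP => //.
case: (eqVneq (qp a b 0 0 e) 0) => [-> //|/qp_supp[s [j [_ ->]]]].
by rewrite /ydeg /xdeg /= !mul0rn !eqxx.
Qed.
End Qp.

Lemma push_qp k k' (L : expmap k k') a b c v a' c' v' :
  L (a, b%:Z, c, v) = (a', b%:Z, c', v') ->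
  push L (qp a b c v) = qp a' b c' v'.
Proof.
move=> Le; have LN N : push L (qpn a b c v N) = qpn a' b c' v' N.
  rewrite rmorph_prod; apply: eq_bigr => l _; rewrite rmorphB rmorph1.
  congr (_ - _); apply: push_mon.
  have -> : (a + (l.*2)%:Z, b%:Z, c, v) = (a, b%:Z, c, v) + ((l.*2)%:Z, 0, 0, 0) :> expo k.
    by congr (_, _, _, _) => /=; rewrite addr0.
  by rewrite emD em0 Le; congr (_, _, _, _) => /=; rewrite addr0.
apply: gser_eqP => e; have [N0 h0] := qp_lim a' b c' v' e.
have [N1 h1] := qp_lim a b c v (emi L e).
rewrite -(h0 (N0 + N1)%N) ?leq_addr // -LN /push /= /pushs.
by rewrite -(h1 (N0 + N1)%N) ?leq_addl.
Qed.

(** * Units and a grading for limits in q *)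

Section Geometric.
Variables (k : nat) (w : expo k -> int) (h : gser k).
Hypothesis wD : forall e e', w (e + e') = w e + w e'.
Hypothesis hw : forall e, h e != 0 -> 1 <= w e.

Lemma weight0 : w 0 = 0. Proof. by apply: (addrI (w 0)); rewrite -wD !addr0. Qed.
Lemma weightB e e' : w (e - e') = w e - w e'.
Proof. by apply: (addIr (w e')); rewrite -wD !subrK. Qed.

Definition geon m : gser k := \sum_(j < m) h ^+ j.

Lemma geonS m : geon m.+1 = 1 + h * geon m.
Proof.
rewrite /geon big_ord_recl expr0 mulr_sumr; congr (_ + _).
by apply: eq_bigr => j _; rewrite -exprS.
Qed.

Lemma geo_pow j e : (h ^+ j) e != 0 -> j%:Z <= w e.
Proof.
elim: j e => [|j IH] e.
  by rewrite expr0 gone_E; case: (e =P 0) => [-> _|_ /eqP//]; rewrite weight0.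
rewrite exprS gsvM => /smul_neq0[e1 [/hw h1 /IH]]; rewrite weightB; lia.
Qed.

Lemma geon_stable m m' e : w e < m%:Z -> (m <= m')%N -> geon m' e = geon m e.
Proof.
move=> em; elim: m' => [|m' IH]; first by rewrite leqn0 => /eqP ->.
rewrite leq_eqVlt => /predU1P[<- //|]; rewrite ltnS => mm'.
rewrite /geon big_ord_recr gaddE /= -/(geon m') IH //.
have [->|/geo_pow] := eqVneq ((h ^+ m') e) 0; first by rewrite addr0.
lia.
Qed.

(** The geometric series in h: h^j vanishes at e once j exceeds [w e], so a truncation gives the
    coefficient. The weight alone does not make the sum good, hence the hypothesis of [unit_geo]. *)
Definition geo : series k := fun e => geon (absz (w e)).+1 e.

Lemma geoE m e : w e < m%:Z -> geo e = geon m e.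
Proof.
move=> em; rewrite /geo -(@geon_stable _ (maxn m (absz (w e)).+1)) ?leq_maxr //; last by lia.
by rewrite -(@geon_stable m (maxn m (absz (w e)).+1)) ?leq_maxl //; lia.
Qed.

Lemma unit_geo : good geo -> 1 - h \is a GRing.unit.
Proof.
move=> gP; pose g := Gser gP; apply/unitrP; exists g; rewrite [_ * g]mulrC; split => //.
all: rewrite mulrC mulrBl mul1r; apply: gser_eqP => e; rewrite gaddE goppE.
all: pose m := (absz (w e)).+1.
all: have -> : g e = geon m.+1 e by apply: geoE; rewrite /m; lia.
all: suff -> : (h * g) e = (h * geon m) e by rewrite geonS gaddE addrK.
all: rewrite !gsvM; apply: eq_fsum => e1; have [->|/hw e1w] := eqVneq (h e1) 0;
  rewrite ?mul0r // [gsv g _](@geoE m) // weightB /m; lia.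
Qed.
End Geometric.

Section Units.
Variable k : nat.
Implicit Types (a c : int) (b : nat) (v : 'rV[int]_k) (f h : gser k) (e : expo k).

(** Here 1 - f has positive z-degree, and up to z-degree b the geometric series coincides with one
    fixed truncation, so it inherits goodness. *)
Lemma unit_zdeg f : (forall e, zdeg e <= 0 -> f e = (e == 0)%:R) -> f \is a GRing.unit.
Proof.
move=> f0; pose h := 1 - f.
have hw e : h e != 0 -> 1 <= zdeg e.
  move=> he; have [//|e0] := leP 1 (zdeg e); case/eqP: he.
  by rewrite gaddE goppE gone_E f0 ?subrr //; lia.
have -> : f = 1 - h by rewrite subKr.
apply: (unit_geo (w := @zdeg k)) => //; split.
  move=> e; rewrite /geo; set m := _.+1; exact: (gsvP _).1.
move=> lam ll b; have [B hB] := (gsvP (geon h (absz b).+1)).2 _ ll b.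
exists B => e + eb; rewrite (@geoE _ _ _ _ hw (absz b).+1) //; last by lia.
by move=> /hB; apply.
Qed.

Lemma qpn_weight (w : expo k -> int) a b c v :
  (forall e e', w (e + e') = w e + w e') ->
  (forall e, qsupp a b c v e -> 0 <= w e) ->
  (forall l : nat, 1 <= w (a + l.*2%:Z, b%:Z, c, v)) ->
  forall e, w e <= 0 -> qp a b c v e = (e == 0)%:R.
Proof.
move=> wD w0 w1 e ew; have [N /(_ N (leqnn _)) <-] := qp_lim a b c v e.
elim: N => [|N IH]; first by rewrite /qpn big_ord0 gone_E.
rewrite qpnS mulrC mul_1mon_E IH; set e' := e - _.
have [->|] := eqVneq (qpn a b c v N e') 0; first by rewrite subr0.
move=> /qpn_supp[s [j [_ sj e'E]]].
have : 0 <= w e' by apply: w0; exists s, j.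
have : w e' + w (a + N.*2%:Z, b%:Z, c, v) = w e by rewrite -wD subrK.
by have := w1 N; lia.
Qed.

Lemma qp_zdeg a b c v e : (0 < b)%N -> zdeg e <= 0 -> qp a b c v e = (e == 0)%:R.
Proof.
by move=> b0; apply: qpn_weight => // e' [s [j [_ ->]]].
Qed.

Lemma qp_unit a b c v : (0 < b)%N -> qp a b c v \is a GRing.unit.
Proof. by move=> b0; apply: unit_zdeg => e; apply: qp_zdeg. Qed.

(** (q;q)_oo has no z, so the t-degree serves as weight; goodness of the inverse holds because all
    powers of 1 - (q;q)_oo involve t only. *)
Lemma qq_unit : qp 2 0 0 0 \is a @GRing.unit (gser k).
Proof.
pose h : gser k := 1 - qp 2 0 0 0.
have hw e : h e != 0 -> 1 <= tdeg e.
  move=> he; have [//|e0] := leP 1 (tdeg e); case/eqP: he.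
  rewrite gaddE goppE gone_E (@qpn_weight (@tdeg k)) ?subrr //.
  by move=> e' [s [j [_ ->]]]; rewrite /tdeg /= -mulr_natr natz; lia.
have -> : qp 2 0 0 0 = 1 - h by rewrite subKr.
have hp j e : (h ^+ j) e != 0 -> e = (tdeg e, 0, 0, 0).
  elim: j e => [|j IH] e; first by rewrite expr0 gone_E; case: (e =P 0) => [-> //|_ /eqP].
  rewrite exprS gsvM => /smul_neq0[e1 [h1 /IH]].
  have : e1 = (tdeg e1, 0, 0, 0).
    move: h1; rewrite gaddE goppE gone_E; case: (e1 =P 0) => [-> //|_].
    rewrite sub0r oppr_eq0 => /qp_supp[s [i [_ ->]]].
    by rewrite /tdeg /= mul0n !mul0rn.
  have -> : tdeg e = tdeg (e - e1) + tdeg e1 by rewrite -tdegD subrK.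
  set x := tdeg (e - e1); set y := tdeg e1 => E1 E2.
  rewrite -[LHS](subrK e1) E2 E1.
  by congr (_, _, _, _) => /=; rewrite addr0.
have hs e : geo (@tdeg k) h e != 0 -> e = (tdeg e, 0, 0, 0) /\ 0 <= tdeg e.
  rewrite /geo /geon gsumE => sn.
  have [j hj] : exists j, (h ^+ j) e != 0.
    apply: contrapT => nj; case/eqP: sn; apply: big1 => j _.
    by apply/eqP; apply: contraPT nj => hj; apply; exists j.
  split; first exact: (hp j).
  by have := geo_pow (fun e e' => erefl) hw hj; lia.
apply: (unit_geo (w := @tdeg k)) => //; split; first by move=> e /hs[-> _].
by move=> lam ll b; exists 0 => e /hs[-> ?] _; rewrite ll.2 addr0.
Qed.

(* The factor 2 makes z/q = t^-2 z have nonnegative weight. *)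
Definition wge (M : int) f := forall e, f e != 0 -> M <= tdeg e + 2 * zdeg e.

Lemma wgeW M M' f : M' <= M -> wge M f -> wge M' f.
Proof. by move=> MM fM e /fM; apply: le_trans. Qed.

Lemma wgeM M M' f g : wge M f -> wge M' g -> wge (M + M') (f * g).
Proof.
move=> fM gM e; rewrite gsvM => /smul_neq0[e1 [/fM + /gM]].
rewrite zdegB tdegB; lia.
Qed.

Lemma wge0M f g : wge 0 f -> wge 0 g -> wge 0 (f * g).
Proof. exact: wgeM. Qed.

Lemma wgeMr M f g : wge M f -> wge 0 g -> wge M (f * g).
Proof. by move=> fM g0; rewrite -[M]addr0; exact: wgeM. Qed.

Lemma wgeMl M f g : wge M f -> wge 0 g -> wge M (g * f).
Proof. by rewrite mulrC; exact: wgeMr. Qed.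

Lemma wgeN M f : wge M f -> wge M (- f).
Proof. by move=> fM e; rewrite goppE oppr_eq0; exact: fM. Qed.

Lemma wgeD M f g : wge M f -> wge M g -> wge M (f + g).
Proof.
move=> fM gM e; rewrite gaddE; have [->|/fM //] := eqVneq (f e) 0.
by rewrite add0r; exact: gM.
Qed.

Lemma wgeB M f g : wge M f -> wge M g -> wge M (f - g).
Proof. by move=> fM gM; apply: wgeD => //; exact: wgeN. Qed.

Lemma wge_mon a b c v : wge (a + 2 * b%:Z) (mon a b c v).
Proof. by move=> e; rewrite monE; case: (e =P _) => [-> //|_ /eqP]. Qed.

Lemma wge1 : wge 0 (1 : gser k).
Proof. by rewrite -mon0; exact: wge_mon. Qed.

Lemma wge_prod (I : Type) (r : seq I) (P : pred I) (F : I -> gser k) :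
  (forall i, P i -> wge 0 (F i)) -> wge 0 (\prod_(i <- r | P i) F i).
Proof. by move=> FP; apply: big_ind => //; [exact: wge1 | exact: wge0M]. Qed.

Lemma wge_prod1 M (I : Type) (r : seq I) (P : pred I) (F : I -> gser k) : 0 <= M ->
  (forall i, P i -> wge M (F i - 1)) -> wge M (\prod_(i <- r | P i) F i - 1).
Proof.
move=> M0 FP; apply: (big_ind (fun x => wge M (x - 1))) => //; first by move=> e; rewrite subrr eqxx.
move=> x y xM yM; have -> : x * y - 1 = (x - 1) * (y - 1) + (x - 1) + (y - 1).
  by rewrite mulrBl mulrBr; ring.
apply: wgeD => //; apply: wgeD => //; apply: wgeMr => //.
exact: wgeW yM.
Qed.

Lemma wge_CT M f : wge M f -> wge M (CT f).
Proof. by move=> fM e; rewrite CTE; case: ifP => // _; exact: fM. Qed.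

(** Every exponent has a finite weight, so the filtration is separated; this replaces passing to the
    limit. *)
Lemma wge_eq f g : (forall N : nat, wge N%:Z (f - g)) -> f = g.
Proof.
move=> fg; apply/eqP; rewrite -subr_eq0; apply/eqP; apply: gser_eqP => e.
apply/eqP; apply: contraT => /(fg (absz (tdeg e + 2 * zdeg e)).+1); lia.
Qed.

Lemma wge_qpn a b c v N : 0 <= a + 2 * b%:Z -> wge 0 (qpn a b c v N).
Proof.
move=> ab e /qpn_supp[s [j [_ _ ->]]]; rewrite /tdeg /zdeg /=.
have -> : a *+ s = a * s%:Z by rewrite -mulr_natr natz.
by rewrite PoszM; nia.
Qed.

Lemma wge_qp a b c v : 0 <= a + 2 * b%:Z -> wge 0 (qp a b c v).
Proof.
move=> ab e; have [N /(_ N (leqnn _)) <-] := qp_lim a b c v e.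
exact: wge_qpn.
Qed.

Lemma wge_qp1 a b c v : 0 <= a + 2 * b%:Z -> wge (a + 2 * b%:Z) (qp a b c v - 1).
Proof.
move=> ab e; rewrite gaddE goppE; have [N /(_ N (leqnn _)) <-] := qp_lim a b c v e.
rewrite -goppE -gaddE; apply: wge_prod1 => // l _.
by rewrite addrAC subrr sub0r; apply: wgeN; apply: (wgeW _ (@wge_mon _ _ _ _)); lia.
Qed.

Lemma qp_shift a b c v N : qp a b c v = qpn a b c v N * qp (a + (N.*2)%:Z) b c v.
Proof.
elim: N => [|N IH]; first by rewrite /qpn big_ord0 mul1r addr0.
rewrite IH qpnS -mulrA; congr (_ * _); rewrite qpS; congr (_ * qp _ _ _ _); lia.
Qed.

Lemma wge_qpnB a b c v N : 0 <= a + 2 * b%:Z ->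
  wge (a + 2 * b%:Z + (N.*2)%:Z) (qp a b c v - qpn a b c v N).
Proof.
move=> ab; rewrite (qp_shift _ _ _ _ N) -{2}[qpn _ _ _ _ _]mulr1 -mulrBr.
apply: wgeMl; last exact: wge_qpn.
have -> : a + 2 * b%:Z + (N.*2)%:Z = (a + (N.*2)%:Z) + 2 * b%:Z by lia.
by apply: wge_qp1; lia.
Qed.

(** With h = 1 - f one has f^-1 = 1 + h f^-1, and h raises the z-degree: induction on the
    z-degree. *)
Lemma wge_inv f : (forall e, zdeg e <= 0 -> f e = (e == 0)%:R) -> wge 0 f -> wge 0 f^-1.
Proof.
move=> f0 fw; have fu := unit_zdeg f0; pose h := 1 - f.
have fE : f^-1 = 1 + h * f^-1 by rewrite mulrBl mul1r divrr // addrC subrK.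
have hw : wge 0 h by apply: wgeB => //; exact: wge1.
have hz e : h e != 0 -> 1 <= zdeg e.
  move=> he; have [//|e0] := leP 1 (zdeg e); case/eqP: he.
  by rewrite gaddE goppE gone_E f0 ?subrr //; lia.
suff main m e : zdeg e < m%:Z -> f^-1 e != 0 -> 0 <= tdeg e + 2 * zdeg e.
  by move=> e; apply: (main (absz (zdeg e)).+1); lia.
elim: m e => [|m IH] e em fe; first by have := (gsvP f^-1).1 e fe; lia.
move: fe; rewrite fE gaddE; have [->|/wge1 //] := eqVneq ((1 : gser k) e) 0.
rewrite add0r gsvM => /smul_neq0[e1 [h1 f1]].
have := hw _ h1; have := hz _ h1; have := IH _ _ f1; rewrite zdegB tdegB; lia.
Qed.

Lemma wge_qpV a b c v : (0 < b)%N -> 0 <= a + 2 * b%:Z -> wge 0 (qp a b c v)^-1.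
Proof. by move=> b0 ab; apply: wge_inv; [move=> e; exact: qp_zdeg|exact: wge_qp]. Qed.

Lemma wge_qpV1 a b c v : (0 < b)%N -> 0 <= a + 2 * b%:Z ->
  wge (a + 2 * b%:Z) ((qp a b c v)^-1 - 1).
Proof.
move=> b0 ab; have -> : (qp a b c v)^-1 - 1 = (qp a b c v)^-1 * - (qp a b c v - 1).
  by rewrite mulrN mulrBr mulVr ?qp_unit // mulr1 opprB.
by apply: wgeMl; [apply: wgeN; exact: wge_qp1|exact: wge_qpV].
Qed.

Lemma unit_1mon a b c v : (0 < b)%N -> 1 - mon a b c v \is a GRing.unit.
Proof.
move=> b0; apply: unit_zdeg => e ez; rewrite gaddE goppE gone_E monE.
have /negbTE -> : e != (a, b%:Z, c, v) :> expo k.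
  by apply: contraTneq ez => ->; rewrite /zdeg /=; lia.
by rewrite subr0.
Qed.
End Units.

(** * Permutations and q-shifts of the variables *)

Section Act.
Variable k : nat.
Implicit Types (a c : int) (b : nat) (d v : 'rV[int]_k) (f : gser k) (e : expo k).
Implicit Types s : 'S_k.

Definition dot d v : int := \sum_i d 0 i * v 0 i.

Lemma dotD d v v' : dot d (v + v') = dot d v + dot d v'.
Proof. by rewrite -big_split; apply: eq_bigr => i _; rewrite mxE mulrDr. Qed.
Lemma dot0 d : dot d 0 = 0.
Proof. by apply: big1 => i _; rewrite mxE mulr0. Qed.
Lemma dotN d v : dot d (- v) = - dot d v.
Proof. by apply: (addrI (dot d v)); rewrite -dotD !subrr dot0. Qed.
Lemma dot0l v : dot 0 v = 0.
Proof. by apply: big1 => i _; rewrite mxE mul0r. Qed.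

(** The substitution y -> q^dy y, x_i -> q^(d_i) x_i followed by a permutation of the x_i; the
    factor 2 is due to q = t^2. *)
Definition actf s dy d e : expo k :=
  (tdeg e + 2 * (dy * ydeg e + dot d (xdeg e)), zdeg e, ydeg e, col_perm s (xdeg e)).
Definition acti s dy d e : expo k :=
  let v := col_perm s^-1%g (xdeg e) in
  (tdeg e - 2 * (dy * ydeg e + dot d v), zdeg e, ydeg e, v).

Lemma actf_add s dy d e e' : actf s dy d (e + e') = actf s dy d e + actf s dy d e'.
Proof.
rewrite /actf xdegD ydegD tdegD zdegD dotD linearD /=.
congr (_, _, _, _) => /=; ring.
Qed.

Lemma col_permK s v : col_perm s^-1%g (col_perm s v) = v.
Proof. by rewrite -col_permM mulVg col_perm1. Qed.

Lemma actfK s dy d : cancel (actf s dy d) (acti s dy d).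
Proof.
case=> [[[a b] c] v]; rewrite /actf /acti /tdeg /zdeg /ydeg /xdeg /= col_permK.
by rewrite addrK.
Qed.

Lemma actf0 s dy d a (b : int) : actf s dy d (a, b, 0, 0) = (a, b, 0, 0).
Proof.
rewrite /actf /tdeg /zdeg /ydeg /xdeg /= !(dot0, mulr0, addr0).
by rewrite (_ : col_perm s 0 = 0) //; apply/matrixP => i j; rewrite !mxE.
Qed.

Definition actm s dy d : expmap k k :=
  @Expmap k k (actf s dy d) (acti s dy d) (actf_add s dy d) (actfK s dy d)
    (actf0 s dy d) (fun e => erefl).

Definition act s dy d : gser k -> gser k := push (actm s dy d).
HB.instance Definition _ s dy d := GRing.RMorphism.on (act s dy d).

Lemma act_mon s dy d a b c v :
  act s dy d (mon a b c v) = mon (a + 2 * (dy * c + dot d v)) b c (col_perm s v).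
Proof. exact: push_mon. Qed.

Lemma act_qp s dy d a b c v :
  act s dy d (qp a b c v) = qp (a + 2 * (dy * c + dot d v)) b c (col_perm s v).
Proof. exact: push_qp. Qed.

Lemma CT_act s dy d f : CT (act s dy d f) = CT f.
Proof.
apply: gser_eqP => e; rewrite !CTE; case: ifP => // /andP[/eqP ey /eqP ex].
have E : e = actf s dy d e by rewrite [e]expo_eta ey ex actf0.
by rewrite {1}E; exact: push_em.
Qed.

Lemma act_cst s dy d (c : gser k) : CT c = c -> act s dy d c = c.
Proof.
move=> cc; apply: push_eqP => e.
  have [ce|ce] := boolP ((ydeg e == 0) && (xdeg e == 0)).
    have /andP[/eqP ey /eqP ex] := ce.
    by rewrite [e]expo_eta ey ex /= actf0.
  rewrite -cc !CTE (negbTE ce) ifF //; apply: contraNF ce => /=.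
  move=> /andP[/eqP yy /eqP cp]; apply/andP; split; first exact/eqP/yy.
  rewrite -[xdeg e](col_permK s) [col_perm s _](cp : _ = 0).
  by apply/eqP/matrixP => i j; rewrite !mxE.
move=> /(cst_neq0 cc)/andP[/eqP ey /eqP ex]; exists e.
by rewrite [e]expo_eta ey ex /= actf0.
Qed.
End Act.

Lemma embK n : cancel (fun e : expo 0 => (tdeg e, zdeg e, ydeg e, 0) : expo n)
  (fun e : expo n => (tdeg e, zdeg e, ydeg e, 0) : expo 0).
Proof. by case=> [[[a b] c] v]; rewrite [v]thinmx0. Qed.

Lemma emb_add n (e e' : expo 0) : ((tdeg (e + e'), zdeg (e + e'), ydeg (e + e'), 0) : expo n) =
  (tdeg e, zdeg e, ydeg e, 0) + (tdeg e', zdeg e', ydeg e', 0).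
Proof. by congr (_, _, _, _) => /=; rewrite addr0. Qed.

Definition embm n : expmap 0 n :=
  @Expmap 0 n _ _ (@emb_add n) (@embK n) (fun a b => erefl) (fun e => erefl).

(** The right-hand sides contain no x_i, while the recurrences live in n variables; [emb] carries
    the former into the ring of the latter. *)
Definition emb n : gser 0 -> gser n := push (embm n).
HB.instance Definition _ n := GRing.RMorphism.on (emb n).

Lemma emb_mon n a b c : emb n (mon a b c 0) = mon a b c 0.
Proof. exact: push_mon. Qed.
Lemma emb_qp n a b c : emb n (qp a b c 0) = qp a b c 0.
Proof. exact: push_qp. Qed.
Lemma embE n (f : gser 0) a b c : emb n f (a, b, c, 0) = f (a, b, c, 0).
Proof. exact: (@push_em _ _ (embm n) f (a, b, c, 0)). Qed.

Section NatPerm.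
Variables (n : nat) (f : nat -> nat).
Hypotheses (fI : injective f) (fn : forall i, (i < n)%N -> (f i < n)%N).

Lemma natperm_inj : injective (fun i : 'I_n => Ordinal (fn (ltn_ord i))).
Proof. by move=> i j /(congr1 val) /= /fI /val_inj. Qed.
Definition natperm : 'S_n := perm natperm_inj.

Definition xn (i : nat) : 'rV[int]_n := \row_(j < n) ((j == i :> nat) : nat)%:Z.

Lemma natperm_xn i i' : f i' = i -> col_perm natperm (xn i) = xn i'.
Proof.
by move=> <-; apply/rowP => j; rewrite !mxE permE /= (inj_eq fI).
Qed.
End NatPerm.

Lemma xn_xv n (i : 'I_n) : xn n i = xv i.
Proof. by apply/rowP => j; rewrite !mxE. Qed.

Lemma dot_xn n (d : 'rV_n) (i : nat) (ni : (i < n)%N) : dot d (xn n i) = d 0 (Ordinal ni).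
Proof.
rewrite /dot (bigD1 (Ordinal ni)) //= mxE eqxx mulr1 big1 ?addr0 // => j ji.
rewrite mxE; case: eqP => [E|]; last by rewrite mulr0.
by case/eqP: ji; apply: val_inj.
Qed.

Definition swn (a i : nat) : nat := if i == a then a.+1 else if i == a.+1 then a else i.
Lemma swnK a : involutive (swn a).
Proof. by move=> i; rewrite /swn; repeat case: eqP; lia. Qed.
Definition swn_inj a := inv_inj (swnK a).
Lemma swn_lt a n : (a.+1 < n)%N -> forall i, (i < n)%N -> (swn a i < n)%N.
Proof. by move=> an i; rewrite /swn; repeat case: eqP; lia. Qed.

(** Rotates the first m indices and fixes the others, so that one ring in n variables hosts the
    weights of all sizes m <= n. *)
Definition rtn (m i : nat) : nat :=
  if i.+1 == m then 0%N else if (i < m)%N then i.+1 else i.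
Lemma rtn_inj m : injective (rtn m).
Proof.
by move=> i j; rewrite /rtn; repeat case: ifP; move=> *; lia.
Qed.
Lemma rtn_lt m n : (m <= n)%N -> forall i, (i < n)%N -> (rtn m i < n)%N.
Proof. by move=> mn i; rewrite /rtn; repeat case: ifP; move=> *; lia. Qed.

Section AdjacentSwap.
Variables (R : comPzRingType) (m a : nat).
Hypothesis am : (a.+1 < m)%N.

Definition swo (i : 'I_m) : 'I_m := Ordinal (swn_lt am (ltn_ord i)).
Lemma swoK : involutive swo.
Proof. by move=> i; apply: val_inj; rewrite /= swnK. Qed.

Lemma prod_swn (F : nat -> R) : \prod_(i < m) F (swn a i) = \prod_(i < m) F i.
Proof. by rewrite [RHS](reindex_inj (inv_inj swoK)). Qed.

(** Exchanging a and a+1 permutes the pairs i < j among themselves, except (a, a+1), which is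
    reversed. *)
Lemma prod_pairs_swn (P : nat -> nat -> R) : exists rest,
  \prod_(j < m) \prod_(i < j) P i j = P a a.+1 * rest /\
  \prod_(j < m) \prod_(i < j) P (swn a i) (swn a j) = P a.+1 a * rest.
Proof.
have am0 : (a < m)%N by rewrite ltnW.
pose p0 : 'I_m * 'I_m := (Ordinal am0, Ordinal am).
pose big (Q : nat -> nat -> R) := \prod_(p : 'I_m * 'I_m | (p.1 < p.2)%N && (p != p0)) Q p.1 p.2.
have bigE (Q : nat -> nat -> R) : \prod_(j < m) \prod_(i < j) Q i j = Q a a.+1 * big Q.
  rewrite (eq_bigr (fun j : 'I_m => \prod_(i < m | (i < j)%N) Q i j)); last first.
    by move=> j _; rewrite (big_ord_widen m (fun i => Q i j)) // ltnW.
  rewrite (exchange_big_dep predT) //= pair_big_dep /= (bigD1 p0) //=.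
exists (big P); split; first exact: bigE.
rewrite (bigE (fun i j => P (swn a i) (swn a j))) {1 2}/swn eqxx ifN ?eqxx; last by rewrite eqn_leq ltnn.
congr (_ * _); rewrite /big.
pose h (p : 'I_m * 'I_m) := (swo p.1, swo p.2).
have hK : involutive h by move=> [i j]; rewrite /h /= !swoK.
rewrite [RHS](reindex_inj (inv_inj hK)); apply: eq_bigl => -[i j] /=.
rewrite !xpair_eqE /= -!val_eqE /= /swn.
by apply/idP/idP; repeat case: eqP; lia.
Qed.
End AdjacentSwap.

Lemma prod_pairs_rtn (R : comPzRingType) m (P : nat -> nat -> R) :
  \prod_(j < m.+1) \prod_(i < j) P i j =
  (\prod_(j < m) P 0%N j.+1) * \prod_(j < m) \prod_(i < j) P i.+1 j.+1.
Proof.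
rewrite big_ord_recl big_ord0 mul1r -big_split; apply: eq_bigr => j _.
by rewrite lift0 big_ord_recl.
Qed.

Opaque qp mon.

(** * The non-symmetric weight and the q-Aomoto recurrences *)

Section Weight.
Variable n : nat.
Local Notation G := (gser n).
Implicit Types (b : nat).

Definition zz : G := mon 0 1 0 0.
Definition qq : G := mon 2 0 0 0.
Definition xq (i j : nat) : 'rV[int]_n := xn n i - xn n j.

Lemma cst_zz : CT zz = zz. Proof. exact: cst_mon. Qed.
Lemma cst_qq : CT qq = qq. Proof. exact: cst_mon. Qed.
Lemma unit_qq : qq \is a GRing.unit. Proof. exact: mon_unit. Qed.

Lemma xqC i j : xq j i = - xq i j. Proof. by rewrite opprB. Qed.

Definition wpair i j : G :=
  qp 0 0 0 (xq i j) * qp 2 0 0 (xq j i) / (qp 0 1 0 (xq i j) * qp 2 1 0 (xq j i)).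

(** The part of [wpair] that is symmetric in i and j; what remains is (1 - v)(1 - z/v) with v =
    x_i/x_j. *)
Definition ypair i j : G :=
  qp 2 0 0 (xq i j) * qp 2 0 0 (xq j i) / (qp 0 1 0 (xq i j) * qp 0 1 0 (xq j i)).

Lemma ypairC i j : ypair i j = ypair j i.
Proof. by rewrite /ypair mulrC [_ * qp 0 _ _ _]mulrC [qp 2 _ _ _ * _]mulrC mulrC. Qed.

Lemma wpairE i j :
  wpair i j = ypair i j * ((1 - mon 0 0 0 (xq i j)) * (1 - mon 0 1 0 (xq j i))).
Proof.
rewrite /wpair /ypair (qpS 0 0) (qpS 0 1 0 (xq j i)) !add0r.
have u1 : 1 - mon 0 1 0 (xq j i) \is a GRing.unit by exact: unit_1mon.
have u2 : qp 0 1 0 (xq i j) \is a GRing.unit by exact: qp_unit.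
have u3 : qp 2 1 0 (xq j i) \is a GRing.unit by exact: qp_unit.
rewrite !invrM ?unitrM ?u1 ?u2 ?u3 //.
set X := 1 - mon 0 1 0 _ in u1 *; set Y := (qp 0 1 _ _)^-1; set Z := (qp 2 1 _ _)^-1.
have XV : X^-1 * X = 1 by rewrite mulVr.
transitivity ((1 - mon 0 0 0 (xq i j)) * qp 2 0 0 (xq i j) * qp 2 0 0 (xq j i) * Y * Z * (X^-1 * X)).
  by rewrite XV; ring.
by ring.
Qed.

Definition W m : G := \prod_(j < m) \prod_(i < j) wpair i j.

Definition sw a (an : (a.+1 < n)%N) : G -> G := act (natperm (@swn_inj a) (swn_lt an)) 0 0.
HB.instance Definition _ a an := GRing.RMorphism.on (@sw a an).
Definition rotx m (mn : (m <= n)%N) : G -> G :=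
  act (natperm (@rtn_inj m) (rtn_lt mn)) 0 (xn n 0).
HB.instance Definition _ m mn := GRing.RMorphism.on (@rotx m mn).

Lemma sw_xn a (an : (a.+1 < n)%N) i :
  col_perm (natperm (@swn_inj a) (swn_lt an)) (xn n i) = xn n (swn a i).
Proof. by apply: natperm_xn; rewrite swnK. Qed.

Lemma sw_xq a (an : (a.+1 < n)%N) i j :
  col_perm (natperm (@swn_inj a) (swn_lt an)) (xq i j) = xq (swn a i) (swn a j).
Proof. by rewrite linearB /= !sw_xn. Qed.

Lemma CT_sw a (an : (a.+1 < n)%N) f : CT (sw an f) = CT f. Proof. exact: CT_act. Qed.
Lemma sw_cst a (an : (a.+1 < n)%N) (c : G) : CT c = c -> sw an c = c. Proof. exact: act_cst. Qed.
Lemma CT_rot m (mn : (m <= n)%N) f : CT (rotx mn f) = CT f. Proof. exact: CT_act. Qed.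
Lemma rot_cst m (mn : (m <= n)%N) (c : G) : CT c = c -> rotx mn c = c. Proof. exact: act_cst. Qed.

Lemma sw_mon a (an : (a.+1 < n)%N) x b c v : sw an (mon x b c v) =
  mon x b c (col_perm (natperm (@swn_inj a) (swn_lt an)) v).
Proof. by rewrite /sw act_mon dot0l mul0r ?(addr0, mulr0). Qed.

Lemma sw_qp a (an : (a.+1 < n)%N) x b c v : sw an (qp x b c v) =
  qp x b c (col_perm (natperm (@swn_inj a) (swn_lt an)) v).
Proof. by rewrite /sw act_qp dot0l mul0r ?(addr0, mulr0). Qed.

Lemma sw_wpair a (an : (a.+1 < n)%N) i j : sw an (wpair i j) = wpair (swn a i) (swn a j).
Proof.
rewrite /wpair rmorphM rmorphV ?unitrM ?qp_unit //.
by rewrite !rmorphM /= !sw_qp !sw_xq.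
Qed.

Lemma sw_W a (an : (a.+1 < n)%N) m :
  sw an (W m) = \prod_(j < m) \prod_(i < j) wpair (swn a i) (swn a j).
Proof.
rewrite rmorph_prod; apply: eq_bigr => j _; rewrite rmorph_prod.
by apply: eq_bigr => i _; exact: sw_wpair.
Qed.

Section Rot.
Variables (m' : nat) (mn : (m'.+1 <= n)%N).
Let rp := natperm (@rtn_inj m'.+1) (rtn_lt mn).

Lemma rot_xnS i : (i < m')%N -> col_perm rp (xn n i.+1) = xn n i.
Proof.
by move=> im; apply: natperm_xn; rewrite /rtn eqSS ltn_eqF // ltnS ltnW.
Qed.

Lemma rot_xn0 : col_perm rp (xn n 0) = xn n m'.
Proof. by apply: natperm_xn; rewrite /rtn eqxx. Qed.

Lemma dot0_xnS i : (i < n)%N -> dot (xn n 0) (xn n i) = (i == 0%N)%:R.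
Proof. by move=> ni; rewrite dot_xn mxE; case: eqP. Qed.

Lemma rot_wpairS i j : (i < m')%N -> (j < m')%N -> rotx mn (wpair i.+1 j.+1) = wpair i j.
Proof.
move=> im jm; rewrite /wpair rmorphM rmorphV ?unitrM ?qp_unit //.
rewrite !rmorphM /= /rotx !act_qp !linearB /= !rot_xnS // !dotD !dotN !dot0_xnS //; lia.
Qed.

(** Here v = x_0/x_(j+1) becomes q/v' with v' = x_j/x_m', which exchanges v and q/v; the asymmetric
    shape of [wpair] is made for this. *)
Lemma rot_wpair0 j : (j < m')%N -> rotx mn (wpair 0 j.+1) = wpair j m'.
Proof.
move=> jm; rewrite /wpair rmorphM rmorphV ?unitrM ?qp_unit //.
rewrite !rmorphM /= /rotx !act_qp !linearB /= !rot_xnS // !rot_xn0 !dotD !dotN !dot0_xnS //;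
  try lia.
rewrite /= !(mul0r, subr0, sub0r, mulr0, addr0, mulr1, add0r, mulrN1) subrr.
exact: (congr2 (fun x y => x / y) (mulrC _ _) (mulrC _ _)).
Qed.

Lemma rot_W : rotx mn (W m'.+1) = W m'.+1.
Proof.
rewrite {1}/W prod_pairs_rtn rmorphM !rmorph_prod /= /W big_ord_recr /= mulrC.
congr (_ * _); apply: eq_bigr => j _; last by rewrite rot_wpair0.
rewrite rmorph_prod; apply: eq_bigr => i _ /=.
by rewrite rot_wpairS // (ltn_trans (ltn_ord i)).
Qed.

Section Shift.
Variables (tc yc : int) (vc : 'rV[int]_n).
Hypothesis vcP : forall j : 'I_n, (j <= m')%N -> vc 0 j = 0.
Local Notation m := m'.+1.

(** The common factor x^vc is free of the first m variables, hence fixed by swaps and rotation. It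
    is 1 in the main case and the inverse of the next variable in the recurrence in n. *)
Definition u (i : nat) : G := mon tc 0 yc (xn n i + vc).
Definition uV (i : nat) : G := mon (- tc) 0 (- yc) (- (xn n i + vc)).

Lemma u_uV i : u i * uV i = 1.
Proof. by rewrite monM !subrr mon0. Qed.

Lemma sw_vc a (an : (a.+1 < n)%N) : (a.+1 < m)%N ->
  col_perm (natperm (@swn_inj a) (swn_lt an)) vc = vc.
Proof.
move=> am; apply/rowP => j; rewrite !mxE permE.
have [jm|mj] := leqP j m'; last first.
  by congr (vc 0 _); apply: val_inj; rewrite /= /swn; repeat case: eqP; lia.
by rewrite !vcP //= /swn; repeat case: eqP; lia.
Qed.

Lemma sw_u a (an : (a.+1 < n)%N) i : (a.+1 < m)%N -> sw an (u i) = u (swn a i).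
Proof. by move=> am; rewrite sw_mon linearD /= sw_xn sw_vc. Qed.

Lemma rot_vc : col_perm rp vc = vc.
Proof.
apply/rowP => j; rewrite !mxE permE.
have [jm|mj] := leqP j m'; last first.
  by congr (vc 0 _); apply: val_inj; rewrite /= /rtn; repeat case: ifP; lia.
by rewrite !vcP //= /rtn; repeat case: ifP; lia.
Qed.

Lemma dot_vc : dot (xn n 0) vc = 0.
Proof.
rewrite /dot big1 // => i _; rewrite mxE; case: eqP => [i0|]; last by rewrite mul0r.
by rewrite vcP ?i0 // mulr0.
Qed.

Lemma rot_uS i : (i < m')%N -> rotx mn (u i.+1) = u i.
Proof.
move=> im; rewrite /rotx act_mon linearD /= rot_xnS // rot_vc dotD dot_vc.
by rewrite dot0_xnS ?(leq_trans _ mn) //= !(mul0r, addr0, mulr0).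
Qed.

Lemma rot_u0 : rotx mn (u 0) = qq * u m'.
Proof.
rewrite /rotx act_mon linearD /= rot_xn0 rot_vc dotD dot_vc.
by rewrite dot0_xnS ?(leq_trans _ mn) //= monM !(mul0r, addr0, add0r, mulr1) addrC.
Qed.

Section Recursion.
Variables (F : nat -> G) (A D kap : G).
Hypotheses (cA : CT A = A) (cD : CT D = D) (ck : CT kap = kap).

(* Encodes, with D = q B, the q-difference equation of the one-variable weight f(u):
   (q u - D) f(q u) = - kap (1 - A u) f(u). *)
Record qdiff : Prop := Qdiff {
  qd_sw : forall a (an : (a.+1 < n)%N) i, (a.+1 < m)%N -> sw an (F i) = F (swn a i);
  qd_rotS : forall i, (i < m')%N -> rotx mn (F i.+1) = F i;
  qd_rot0 : rotx mn ((u 0 - D) * F 0) = - kap * (1 - A * u m') * F m' }.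
Hypothesis qd : qdiff.

Definition Phi := W m * \prod_(i < m) F i.

(** With r = x_a/x_(a+1), the product (u_(a+1) - z u_a) [wpair] equals [ypair] u_(a+1) (1 - r)(1 - z
    r)(1 - z/r). It changes sign under the swap, so its constant term against swap-invariant factors
    is 0. *)
Lemma CT_swap a (an : (a.+1 < n)%N) p : (a.+1 < m)%N -> sw an p = p ->
  CT (u a.+1 * (p * Phi)) = zz * CT (u a * (p * Phi)).
Proof.
move=> am pa; rewrite -CTZ ?cst_zz //; apply/eqP; rewrite -subr_eq0 -raddfB /=.
set K := (X in CT X).
suff KN : sw an K = - K.
  have : CT K = - CT K by rewrite -{1}(CT_sw an) KN raddfN.
  move=> KK; apply/eqP/gser_eqP => e.
  have := congr1 (fun f : G => f e) KK; rewrite goppE => /eqP.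
  by rewrite -addr_eq0 -mulr2n mulrn_eq0 /= => /eqP.
have [rest [W1 W2]] := prod_pairs_swn am wpair.
have KE : K = p * \prod_(i < m) F i * rest * ((u a.+1 - zz * u a) * wpair a a.+1).
  by rewrite /K /Phi {1 2}/W W1; ring.
have -> : sw an K = p * \prod_(i < m) F i * rest * ((u a - zz * u a.+1) * wpair a.+1 a).
  rewrite /K /Phi rmorphB !rmorphM /= sw_W W2 pa !sw_u // (sw_cst _ cst_zz).
  rewrite {1}/swn eqn_leq ltnn /= eqxx {1}/swn eqxx rmorph_prod.
  under eq_bigr do rewrite /= (qd_sw qd) //.
  by rewrite (prod_swn am F); ring.
rewrite KE -[RHS]mulrN; congr (_ * _); rewrite !wpairE ypairC.
rewrite [xq a.+1 a]xqC; set x := xq a a.+1.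
have -> : u a = mon 0 0 0 x * u a.+1.
  by rewrite monM !add0r addrA subrK.
have -> : mon 0 1 0 x = zz * mon 0 0 0 x by rewrite monM !add0r.
have -> : mon 0 1 0 (- x) = zz * mon 0 0 0 (- x) by rewrite monM !add0r.
have rr : mon 0 0 0 x * mon 0 0 0 (- x) = 1 :> G by rewrite monM (subrr x); exact: mon0.
move: (mon 0 0 0 x) (mon 0 0 0 (- x)) rr => r r' rr.
ring: rr.
Qed.

(** Rotation preserves [W] and the constant term; only the weight of u_0 changes, by its
    q-difference equation, and the factor 1 - A u produces the second term. *)
Lemma CT_shift s : CT ((u 0 - D) * s * Phi) =
  - kap * (CT (rotx mn s * Phi) - A * CT (u m' * (rotx mn s * Phi))).
Proof.
rewrite -(CT_rot mn).
have -> : rotx mn ((u 0 - D) * s * Phi) =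
    - kap * (rotx mn s * Phi - A * (u m' * (rotx mn s * Phi))).
  have -> : (u 0 - D) * s * Phi = ((u 0 - D) * F 0) * (s * W m * \prod_(i < m') F i.+1).
    by rewrite /Phi big_ord_recl; under eq_bigr do rewrite lift0; ring.
  rewrite rmorphM /= (qd_rot0 qd) !rmorphM /= rot_W rmorph_prod.
  under eq_bigr => i _ do rewrite /= (qd_rotS qd) //.
  by rewrite /Phi big_ord_recr /=; ring.
rewrite (CTZ _ (cstN ck)).
by rewrite raddfB /= (CTZ _ cA).
Qed.

Lemma CT_move_last r s : (r <= m')%N ->
  (forall a (an : (a.+1 < n)%N), (r <= a)%N -> (a.+1 < m)%N -> sw an s = s) ->
  CT (u m' * (s * Phi)) = zz ^+ (m' - r) * CT (u r * (s * Phi)).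
Proof.
move=> rm sP.
suff main j : (r + j <= m')%N -> CT (u (r + j)%N * (s * Phi)) = zz ^+ j * CT (u r * (s * Phi)).
  by rewrite -main subnKC.
elim: j => [|j IH] rj; first by rewrite addn0 mul1r.
have an : ((r + j).+1 < n)%N by lia.
rewrite addnS (CT_swap (an := an)) ?sP //; try lia.
by rewrite IH; [rewrite exprS mulrA|lia].
Qed.

Definition EE r := CT (\prod_(i < r) u i * Phi).
Definition HH r := CT (\prod_(i < r) (u i - D) * Phi).

Lemma EE_shifted r : (r <= m')%N -> CT (\prod_(i < r) u i.+1 * Phi) = zz ^+ r * EE r.
Proof.
(* T j has its first j indices lowered. Passing from j to j+1 replaces u_(j+1) by u_j next to
   factors that involve neither, at the cost of one z. *)
move=> rm; pose T j := CT (\prod_(i < j) u i * \prod_(j <= i < r) u i.+1 * Phi).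
suff main j : (j <= r)%N -> CT (\prod_(i < r) u i.+1 * Phi) = zz ^+ j * T j.
  by rewrite (main r) // /T big_geq // mulr1.
elim: j => [|j IH] jr; first by rewrite /T big_ord0 !mul1r big_mkord.
rewrite IH ?(ltnW jr) // exprSr -mulrA; congr (_ * _).
rewrite /T big_ltn // big_ord_recr /=.
set P1 := \prod_(i < j) u i; set P2 := \prod_(j.+1 <= i < r) _.
have an : (j.+1 < n)%N by lia.
have -> : P1 * (u j.+1 * P2) * Phi = u j.+1 * (P1 * P2 * Phi) by ring.
have -> : P1 * u j * P2 * Phi = u j * (P1 * P2 * Phi) by ring.
apply: (CT_swap (an := an)); first by lia.
rewrite /P1 /P2 rmorphM !rmorph_prod /=; congr (_ * _).
  apply: eq_bigr => i _; rewrite sw_u; last by lia.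
  by congr u; rewrite /swn; have := ltn_ord i; repeat case: eqP; lia.
rewrite !big_nat; apply: eq_bigr => i ij; rewrite sw_u; last by lia.
by congr u; rewrite /swn; repeat case: eqP; lia.
Qed.

Lemma sw_prod_lt (H : nat -> G) r a (an : (a.+1 < n)%N) : (r <= a)%N -> (a.+1 < m)%N ->
  (forall i, sw an (H i) = H (swn a i)) -> sw an (\prod_(i < r) H i) = \prod_(i < r) H i.
Proof.
move=> ra am swH; rewrite rmorph_prod; apply: eq_bigr => i _ /=; rewrite swH.
by congr H; rewrite /swn; have := ltn_ord i; repeat case: eqP; lia.
Qed.

Lemma rot_prodS (H : nat -> G) r : (r <= m')%N ->
  (forall i, (i < m')%N -> rotx mn (H i.+1) = H i) ->
  rotx mn (\prod_(i < r) H i.+1) = \prod_(i < r) H i.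
Proof.
move=> rm rH; rewrite rmorph_prod; apply: eq_bigr => i _ /=; rewrite rH //.
exact: leq_trans (ltn_ord i) rm.
Qed.

(** In [CT_shift] for u_1...u_r the unknown EE (r+1) occurs twice: on the left, and on the right
    once the last u has been moved down to index r, which costs z^(m'-r). *)
Lemma EE_rec r : (r <= m')%N ->
  EE r.+1 * (1 - kap * A * zz ^+ (m' - r)) = - (kap - D * zz ^+ r) * EE r.
Proof.
move=> rm; have := CT_shift (\prod_(i < r) u i.+1).
rewrite rot_prodS //; last exact: rot_uS.
rewrite (CT_move_last rm); last first.
  by move=> a an ra am; apply: sw_prod_lt => // i; exact: sw_u.
have -> : u r * (\prod_(i < r) u i * Phi) = \prod_(i < r.+1) u i * Phi.
  by rewrite big_ord_recr /=; ring.
rewrite mulrBl mulrBl raddfB /=.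
have -> : u 0 * \prod_(i < r) u i.+1 * Phi = \prod_(i < r.+1) u i * Phi.
  by rewrite big_ord_recl; under [in RHS]eq_bigr do rewrite lift0.
rewrite -[D * _ * _]mulrA (CTZ _ cD) EE_shifted // -/(EE r) -/(EE r.+1) => E.
have -> : EE r.+1 * (1 - kap * A * zz ^+ (m' - r)) =
   (EE r.+1 - D * (zz ^+ r * EE r)) + D * (zz ^+ r * EE r)
   - kap * A * zz ^+ (m' - r) * EE r.+1 by ring.
by rewrite E; ring.
Qed.

(** The factors u_i - D make the left side of [CT_shift] a single term; on the right u_r is split as
    (u_r - D) + D. *)
Lemma HH_rec r : (r <= m')%N ->
  HH r.+1 * (1 - kap * A * zz ^+ (m' - r)) = - kap * (1 - A * D * zz ^+ (m' - r)) * HH r.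
Proof.
move=> rm; have := CT_shift (\prod_(i < r) (u i.+1 - D)).
rewrite (rot_prodS (H := fun i => u i - D)) //; last first.
  by move=> i im; rewrite rmorphB /= rot_uS // (rot_cst _ cD).
rewrite (CT_move_last rm); last first.
  move=> a an ra am; apply: (sw_prod_lt (H := fun i => u i - D)) => // i.
  by rewrite rmorphB /= sw_u // (sw_cst _ cD).
have -> : u r * (\prod_(i < r) (u i - D) * Phi) =
   \prod_(i < r.+1) (u i - D) * Phi + D * (\prod_(i < r) (u i - D) * Phi).
  by rewrite big_ord_recr /=; ring.
have -> : (u 0 - D) * \prod_(i < r) (u i.+1 - D) * Phi = \prod_(i < r.+1) (u i - D) * Phi.
  by rewrite big_ord_recl; under [in RHS]eq_bigr do rewrite lift0.
rewrite raddfD /= (CTZ _ cD) -/(HH r) -/(HH r.+1) => E.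
have -> : HH r.+1 * (1 - kap * A * zz ^+ (m' - r)) =
   HH r.+1 - kap * A * zz ^+ (m' - r) * HH r.+1 by ring.
by rewrite {1}E; ring.
Qed.

Lemma prod_rev (f : nat -> G) : \prod_(i < m) f (m' - i)%N = \prod_(i < m) f i.
Proof.
rewrite [LHS](reindex_inj rev_ord_inj); apply: eq_bigr => i _ /=.
by rewrite subSS subKn // -ltnS.
Qed.

Lemma EE_prod : EE m * \prod_(r < m) (1 - kap * A * zz ^+ r) =
  \prod_(r < m) (- (kap - D * zz ^+ r)) * EE 0.
Proof.
suff main r : (r <= m)%N -> EE r * \prod_(i < r) (1 - kap * A * zz ^+ (m' - i)) =
    \prod_(i < r) (- (kap - D * zz ^+ i)) * EE 0.
  by rewrite -main // (prod_rev (fun i => 1 - kap * A * zz ^+ i)).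
elim: r => [|r IH] rm; first by rewrite !big_ord0 mul1r mulr1.
rewrite !big_ord_recr /=; set P := \prod_(i < r) (1 - _).
transitivity (EE r.+1 * (1 - kap * A * zz ^+ (m' - r)) * P); first by ring.
rewrite EE_rec //; transitivity (- (kap - D * zz ^+ r) * (EE r * P)); first by ring.
by rewrite IH ?(ltnW rm) //; ring.
Qed.

Lemma HH_prod : HH m * \prod_(r < m) (1 - kap * A * zz ^+ r) =
  \prod_(r < m) (- kap * (1 - A * D * zz ^+ r)) * EE 0.
Proof.
suff main r : (r <= m)%N -> HH r * \prod_(i < r) (1 - kap * A * zz ^+ (m' - i)) =
    \prod_(i < r) (- kap * (1 - A * D * zz ^+ (m' - i))) * EE 0.
  have := main m (leqnn _).
  rewrite (prod_rev (fun i => 1 - kap * A * zz ^+ i)).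
  by rewrite (prod_rev (fun i => - kap * (1 - A * D * zz ^+ i))).
elim: r => [|r IH] rm; first by rewrite !big_ord0 mul1r mulr1 /HH big_ord0 /EE big_ord0.
rewrite !big_ord_recr /=; set P := \prod_(i < r) (1 - kap * A * _).
transitivity (HH r.+1 * (1 - kap * A * zz ^+ (m' - r)) * P); first by ring.
rewrite HH_rec //; transitivity (- kap * (1 - A * D * zz ^+ (m' - r)) * (HH r * P)); first by ring.
by rewrite IH ?(ltnW rm) //; ring.
Qed.
End Recursion.
End Shift.
End Rot.
End Weight.

(** * One-variable weights *)

Lemma wge_prodB k M (I : Type) (r : seq I) (P : pred I) (F F' : I -> gser k) :
  (forall i, P i -> wge 0 (F i)) -> (forall i, P i -> wge 0 (F' i)) ->
  (forall i, P i -> wge M (F i - F' i)) ->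
  wge M (\prod_(i <- r | P i) F i - \prod_(i <- r | P i) F' i).
Proof.
move=> F0 F0' FF; elim: r => [|i r IH]; first by rewrite !big_nil subrr => e; rewrite eqxx.
rewrite !big_cons; case: ifP => // Pi.
set X := \prod_(j <- r | _) F j in IH *; set Y := \prod_(j <- r | _) F' j in IH *.
have -> : F i * X - F' i * Y = F i * (X - Y) + (F i - F' i) * Y by ring.
apply: wgeD; first by apply: wgeMl => //; exact: F0.
by apply: wgeMr; [exact: FF|exact: wge_prod].
Qed.

Lemma wgeMB k M (f f' g g' : gser k) : wge 0 f -> wge 0 g' ->
  wge M (f - f') -> wge M (g - g') -> wge M (f * g - f' * g').
Proof.
move=> f0 g0 ff gg; have -> : f * g - f' * g' = f * (g - g') + (f - f') * g' by ring.
by apply: wgeD; [exact: wgeMl|exact: wgeMr].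
Qed.

Lemma wgeM1 k M (f g : gser k) : wge 0 g ->
  wge M (f - 1) -> wge M (g - 1) -> wge M (f * g - 1).
Proof.
move=> g0 ff gg; have -> : f * g - 1 = (f - 1) * g + (g - 1) by ring.
by apply: wgeD => //; exact: wgeMr.
Qed.

Section BStep.
Variables (n m' : nat) (mn : (m'.+1 <= n)%N) (tc yc : int) (vc : 'rV[int]_n).
Hypothesis vcP : forall j : 'I_n, (j <= m')%N -> vc 0 j = 0.
Local Notation m := m'.+1.
Local Notation G := (gser n).
Local Notation u := (u tc yc vc).
Local Notation zz := (zz n).
Local Notation qq := (qq n).

Lemma EE_0 F : EE m' tc yc vc F 0 = CT (Phi m' F).
Proof. by rewrite /EE big_ord0 mul1r. Qed.

(** Since F (u - D) = u F', the last HH for F is the last EE for F'. Their two product formulas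
    share the factor in 1 - q A z^r and express this number through either constant term. *)
Lemma B_step (F F' : nat -> G) (A D : G) : CT A = A -> CT D = D ->
  (forall r, 1 - qq * A * zz ^+ r \is a GRing.unit) ->
  qdiff mn tc yc vc F A D qq -> qdiff mn tc yc vc F' A (qq * D) qq ->
  (forall i, (i < m)%N -> F i * (u i - D) = u i * F' i) ->
  CT (Phi m' F) * \prod_(r < m) (1 - A * D * zz ^+ r) =
  \prod_(r < m) (1 - D * zz ^+ r) * CT (Phi m' F').
Proof.
move=> cA cD uA qF qF' FF'.
have cqD : CT (qq * D) = qq * D by apply: cstM => //; exact: cst_qq.
have H1 := HH_prod vcP cA cD (cst_qq n) qF.
have H2 := EE_prod vcP cA cqD (cst_qq n) qF'.
rewrite !EE_0 in H1 H2.
have HE : HH m' tc yc vc F D m = EE m' tc yc vc F' m.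
  rewrite /HH /EE /Phi; congr (CT _); rewrite !mulrA.
  rewrite [_ * W n m]mulrC [in RHS](mulrC _ (W n m)) -!mulrA; congr (_ * _).
  rewrite -!big_split; apply: eq_bigr => i _ /=.
  by rewrite mulrC FF'.
rewrite HE in H1.
have {H1 H2} : \prod_(r < m) (- qq * (1 - A * D * zz ^+ r)) * CT (Phi m' F) =
    \prod_(r < m) (- (qq - qq * D * zz ^+ r)) * CT (Phi m' F').
  by rewrite -H1 -H2.
rewrite (eq_bigr (fun r : 'I_m => - qq * (1 - D * zz ^+ r)) (F1 := fun r => - (qq - _))).
  have U : \prod_(i < m) - qq \is a GRing.unit.
    by rewrite prodr_const unitrX // unitrN unit_qq.
  by rewrite !big_split /= -!mulrA => /(mulrI U) E; rewrite mulrC E.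
by move=> r _; ring.
Qed.

Section Family.
Variable al : int.
Local Notation A := (mon al 1 0 0 : G).

Definition pw (k : int) i : G := mon (- (k * tc)) 0 (- (k * yc)) (- (k *: (xn n i + vc))).

(** The weight u^-k (u, q/u)_oo / (A u, B q/u)_oo with A = t^al z and B = t^b4 z. *)
Definition Ft k (b4 : int) i : G := pw k i *
  (qp tc 0 yc (xn n i + vc) * qp (2 - tc) 0 (- yc) (- (xn n i + vc)) /
  (qp (al + tc) 1 yc (xn n i + vc) * qp (b4 + 2 - tc) 1 (- yc) (- (xn n i + vc)))).

(** The weight with k = 0 and B = q^N. The denominator (q^(N+1)/u)_oo carries no z, so its quotient
    with (q/u)_oo is written as a finite product. *)
Definition Fp (N : nat) i : G :=
  qp tc 0 yc (xn n i + vc) / qp (al + tc) 1 yc (xn n i + vc) *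
  qpn (2 - tc) 0 (- yc) (- (xn n i + vc)) N.

Lemma col_permNZ (s : 'S_n) k (v : 'rV[int]_n) :
  col_perm s (- (k *: v)) = - (k *: col_perm s v).
Proof. by apply/rowP => j; rewrite !mxE. Qed.

Lemma sw_xv a (an : (a.+1 < n)%N) i : (a.+1 < m)%N ->
  col_perm (natperm (@swn_inj a) (swn_lt an)) (xn n i + vc) = xn n (swn a i) + vc.
Proof. by move=> am; rewrite linearD /= sw_xn (sw_vc mn vcP). Qed.

Lemma sw_qpn a (an : (a.+1 < n)%N) x b c v N : sw an (qpn x b c v N) =
  qpn x b c (col_perm (natperm (@swn_inj a) (swn_lt an)) v) N.
Proof.
rewrite /qpn rmorph_prod; apply: eq_bigr => l _ /=.
by rewrite rmorphB rmorph1 /= sw_mon.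
Qed.

Lemma rot_xvS i : (i < m')%N ->
  col_perm (natperm (@rtn_inj m) (rtn_lt mn)) (xn n i.+1 + vc) = xn n i + vc.
Proof. by move=> im; rewrite linearD /= rot_xnS // (rot_vc mn vcP). Qed.

Lemma rot_xv0 :
  col_perm (natperm (@rtn_inj m) (rtn_lt mn)) (xn n 0 + vc) = xn n m' + vc.
Proof. by rewrite linearD /= rot_xn0 (rot_vc mn vcP). Qed.

Lemma dot_xvS i : (i < m')%N -> dot (xn n 0) (xn n i.+1 + vc) = 0.
Proof. by move=> im; rewrite dotD (dot_vc vcP) dot0_xnS ?addr0 //; lia. Qed.

Lemma dot_xv0 : dot (xn n 0) (xn n 0 + vc) = 1.
Proof. by rewrite dotD (dot_vc vcP) dot0_xnS ?addr0 //; lia. Qed.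

Lemma dotZ (d v : 'rV[int]_n) k : dot d (k *: v) = k * dot d v.
Proof. by rewrite /dot mulr_sumr; apply: eq_bigr => i _; rewrite mxE; ring. Qed.

Lemma rot_qpS x b c i : (i < m')%N -> rotx mn (qp x b c (xn n i.+1 + vc)) = qp x b c (xn n i + vc).
Proof. by move=> im; rewrite /rotx act_qp rot_xvS // dot_xvS // !(mul0r, addr0, mulr0). Qed.
Lemma rot_qpNS x b c i : (i < m')%N ->
  rotx mn (qp x b c (- (xn n i.+1 + vc))) = qp x b c (- (xn n i + vc)).
Proof.
move=> im; rewrite /rotx act_qp linearN /= rot_xvS // dotN dot_xvS //.
by rewrite !(mul0r, oppr0, addr0, mulr0).
Qed.
Lemma rot_qp0 x b c : rotx mn (qp x b c (xn n 0 + vc)) = qp (x + 2) b c (xn n m' + vc).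
Proof. by rewrite /rotx act_qp rot_xv0 // dot_xv0 // !(mul0r, add0r, mulr1). Qed.
Lemma rot_qpN0 x b c : rotx mn (qp x b c (- (xn n 0 + vc))) = qp (x - 2) b c (- (xn n m' + vc)).
Proof. by rewrite /rotx act_qp linearN /= rot_xv0 // dotN dot_xv0 // !(mul0r, add0r, mulrN1). Qed.

Lemma rot_pwS k i : (i < m')%N -> rotx mn (pw k i.+1) = pw k i.
Proof.
move=> im; rewrite /rotx /pw act_mon col_permNZ rot_xvS // dotN dotZ dot_xvS //.
by rewrite !(mul0r, oppr0, addr0, mulr0).
Qed.
Lemma rot_pw0 k : rotx mn (pw k 0) = mon (- (2 * k)) 0 0 0 * pw k m'.
Proof.
rewrite /rotx /pw act_mon col_permNZ rot_xv0 // dotN dotZ dot_xv0 // monM.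
rewrite addn0 ?add0r; congr (mon _ _ _ _); lia.
Qed.

Lemma u_inv i : mon (- tc) 0 (- yc) (- (xn n i + vc)) = (u i)^-1.
Proof.
have uu : u i \is a GRing.unit by exact: mon_unit.
by apply: (mulrI uu); rewrite u_uV divrr.
Qed.

(* The theta-like numerator and the two denominators each contribute one linear
   factor under u -> q u. *)
Lemma qdiff_Ft k (b4 : int) :
  qdiff mn tc yc vc (Ft k b4) A (mon (b4 + 2) 1 0 0) (mon (2 - 2 * k) 0 0 0).
Proof.
split.
- move=> a an i am; rewrite /Ft !rmorphM rmorphV ?unitrM ?qp_unit // !rmorphM /=.
  by rewrite sw_mon !sw_qp col_permNZ !linearN /= !sw_xv.
- move=> i im; rewrite /Ft !rmorphM rmorphV ?unitrM ?qp_unit // !rmorphM /=.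
  by rewrite rot_pwS // (rot_qpS tc 0 yc im) (rot_qpS (al + tc) 1 yc im)
    (rot_qpNS (2 - tc) 0 (- yc) im) (rot_qpNS (b4 + 2 - tc) 1 (- yc) im).
have ud : qp (al + tc + 2) 1 yc (xn n m' + vc) \is a GRing.unit by exact: qp_unit.
have ue : qp (b4 + 2 - tc) 1 (- yc) (- (xn n m' + vc)) \is a GRing.unit by exact: qp_unit.
have uf : qp (b4 - tc) 1 (- yc) (- (xn n m' + vc)) \is a GRing.unit by exact: qp_unit.
have ug : qp (al + tc) 1 yc (xn n m' + vc) \is a GRing.unit by exact: qp_unit.
rewrite /Ft !rmorphM rmorphV ?unitrM ?qp_unit // !rmorphM rmorphB /=.
rewrite (rot_u0 mn tc yc vcP) (rot_cst mn (@cst_mon _ _ _)) rot_pw0 (rot_qp0 tc 0 yc)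
  (rot_qp0 (al + tc) 1 yc) (rot_qpN0 (2 - tc) 0 (- yc)) (rot_qpN0 (b4 + 2 - tc) 1 (- yc)).
have -> : 2 - tc - 2 = - tc by lia.
have -> : b4 + 2 - tc - 2 = b4 - tc by lia.
rewrite [qp tc _ _ _]qpS [qp (- tc) _ _ _]qpS.
have -> : - tc + 2 = 2 - tc by lia.
have Eg := qpS (al + tc) 1 yc (xn n m' + vc).
have Ef : qp (b4 - tc) 1 (- yc) (- (xn n m' + vc)) =
  (1 - mon (b4 - tc) 1 (- yc) (- (xn n m' + vc))) * qp (b4 + 2 - tc) 1 (- yc) (- (xn n m' + vc)).
  by rewrite {1}qpS (_ : b4 - tc + 2 = b4 + 2 - tc) //; lia.
set g := qp (al + tc) _ _ _ in ug Eg *; set f := qp (b4 - tc) _ _ _ in uf Ef *.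
set d := qp (al + tc + 2) _ _ _ in ud Eg *; set e := qp (b4 + 2 - tc) _ _ _ in ue Ef *.
have Af : A * u m' = mon (al + tc) 1 yc (xn n m' + vc) by rewrite monM !add0r.
have Df : mon (b4 + 2) 1 0 0 = qq * u m' * mon (b4 - tc) 1 (- yc) (- (xn n m' + vc)).
  rewrite !monM; congr (mon _ _ _ _); try lia.
  by rewrite add0r subrr.
have kf : mon (2 - 2 * k) 0 0 0 = qq * mon (- (2 * k)) 0 0 0 by rewrite monM !addr0.
rewrite -/(u m') u_inv Af Df kf; move: Eg Ef.
set y := mon (al + tc) _ _ _; set x := mon (b4 - tc) _ _ _ => Eg Ef.
have Uu : u m' \is a GRing.unit by exact: mon_unit.
have uVE := mulrV Uu; set U := u m' in Uu uVE *.
have ude : d * f \is a GRing.unit by rewrite unitrM ud.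
have uge : g * e \is a GRing.unit by rewrite unitrM ug.
apply: (mulIr ude); apply: (mulIr uge).
have V1 := mulVr ude; have V2 := mulVr uge.
set I1 := (d * f)^-1 in V1 *; set I2 := (g * e)^-1 in V2 *.
set a := qp (tc + 2) _ _ _; set b := qp (2 - tc) _ _ _; set p := pw _ _; set K := mon (- _) _ _ _.
transitivity ((qq * U - qq * U * x) * K * p * a * b * (1 - U^-1) * (I1 * (d * f)) * (g * e)).
  by ring.
transitivity (- (qq * K) * (1 - y) * p * (1 - U) * a * b * (I2 * (g * e)) * (d * f)); last by ring.
rewrite V1 V2 Eg Ef.
transitivity (qq * (U - U * U^-1) * K * p * a * b * (1 - x) * ((1 - y) * d * e)); first by ring.
by rewrite uVE; ring.
Qed.

Lemma qdiff_Fp N : qdiff mn tc yc vc (Fp N) A (mon (2 * N%:Z + 2) 0 0 0) qq.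
Proof.
split.
- move=> a an i am; rewrite /Fp !rmorphM rmorphV ?qp_unit // /=.
  by rewrite !sw_qp sw_qpn !linearN /= !sw_xv.
- move=> i im; rewrite /Fp !rmorphM rmorphV ?qp_unit // /=.
  rewrite (rot_qpS tc 0 yc im) (rot_qpS (al + tc) 1 yc im); congr (_ * _).
  rewrite /qpn rmorph_prod; apply: eq_bigr => l _ /=; rewrite rmorphB rmorph1 /=.
  rewrite /rotx act_mon linearN /= rot_xvS // dotN dot_xvS //.
  by rewrite !(mul0r, oppr0, addr0, mulr0).
have ud : qp (al + tc + 2) 1 yc (xn n m' + vc) \is a GRing.unit by exact: qp_unit.
have ug : qp (al + tc) 1 yc (xn n m' + vc) \is a GRing.unit by exact: qp_unit.
rewrite /Fp !rmorphM rmorphV ?qp_unit // rmorphB /=.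
rewrite (rot_u0 mn tc yc vcP) (rot_cst mn (@cst_mon _ _ _)) (rot_qp0 tc 0 yc) (rot_qp0 (al + tc) 1 yc).
have -> : rotx mn (qpn (2 - tc) 0 (- yc) (- (xn n 0 + vc)) N) =
    qpn (- tc) 0 (- yc) (- (xn n m' + vc)) N.
  rewrite /qpn rmorph_prod; apply: eq_bigr => l _ /=; rewrite rmorphB rmorph1 /=.
  rewrite /rotx act_mon linearN /= rot_xv0 // dotN dot_xv0 //.
  by congr (1 - mon _ _ _ _); lia.
rewrite [qp tc _ _ _]qpS.
have Eg := qpS (al + tc) 1 yc (xn n m' + vc).
set g := qp (al + tc) _ _ _ in ug Eg *; set d := qp (al + tc + 2) _ _ _ in ud Eg *.
have Af : A * u m' = mon (al + tc) 1 yc (xn n m' + vc) by rewrite monM !add0r.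
set x := mon (- tc + (N.*2)%:Z) 0 (- yc) (- (xn n m' + vc)) : G.
have Df : mon (2 * N%:Z + 2) 0 0 0 = qq * u m' * x.
  rewrite !monM; congr (mon _ _ _ _); try lia.
  by rewrite add0r subrr.
(* Both sides are (1/u;q)_(N+1), with the first or the last factor split off. *)
have : (1 - (u m')^-1) * qpn (2 - tc) 0 (- yc) (- (xn n m' + vc)) N =
    qpn (- tc) 0 (- yc) (- (xn n m' + vc)) N * (1 - x).
  by rewrite -qpnS qpnSl u_inv (_ : - tc + 2 = 2 - tc) //; lia.
rewrite -/(u m') Af Df; move: Eg.
set P := qpn _ _ _ _ _; set Q := qpn (- tc) _ _ _ _; set y := mon (al + tc) _ _ _ => Eg PQ.
have Uu : u m' \is a GRing.unit by exact: mon_unit.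
have uVE := mulrV Uu; set U := u m' in Uu uVE PQ *.
apply: (mulIr ud); apply: (mulIr ug).
have V1 := mulVr ud; have V2 := mulVr ug.
set a := qp (tc + 2) _ _ _; set I1 := d^-1 in V1 *; set I2 := g^-1 in V2 *.
transitivity (qq * U * a * (Q * (1 - x)) * (I1 * d) * g); first by ring.
transitivity (- qq * (1 - y) * (1 - U) * a * P * (I2 * g) * d); last by ring.
rewrite V1 V2 Eg -PQ.
transitivity (qq * (U - U * U^-1) * a * P * (1 - y) * d); first by ring.
by rewrite uVE; ring.
Qed.
End Family.
End BStep.

(** * The limit B -> 0 *)

Section Morris.
Variables (n m' : nat) (mn : (m'.+1 <= n)%N) (tc yc al : int) (vc : 'rV[int]_n).
Hypothesis vcP : forall j : 'I_n, (j <= m')%N -> vc 0 j = 0.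
(** In the weight of [wge] these say that u, q/u, A and A u have nonnegative weight. *)
Hypotheses (tc0 : 0 <= tc) (tc2 : tc <= 2) (al2 : 0 <= al + 2) (altc : 0 <= al + tc + 2).
Local Notation m := m'.+1.
Local Notation G := (gser n).
Local Notation u := (u tc yc vc).
Local Notation zz := (zz n).
Local Notation qq := (qq n).
Local Notation A := (mon al 1 0 0 : G).

Lemma zzX r : zz ^+ r = mon 0 r 0 0.
Proof. by rewrite monX mul1n !mul0rn. Qed.

Lemma unit_qAz r : 1 - qq * A * zz ^+ r \is a GRing.unit.
Proof. by rewrite zzX !monM !addr0; apply: unit_1mon; lia. Qed.

Local Notation F1 N := (Ft tc yc vc al 0 (2 * N%:Z)).
Local Notation F2 N := (Fp tc yc vc al N).

Lemma pw0 i : pw tc yc vc 0 i = 1.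
Proof. by rewrite /pw !mul0r scale0r !oppr0 mon0. Qed.

Lemma F1S N i : F1 N i * (u i - mon (2 * N%:Z + 2) 1 0 0) = u i * F1 N.+1 i.
Proof.
rewrite /Ft !pw0 !mul1r; set a := _ * qp (2 - tc) _ _ _; set c := qp (al + tc) _ _ _.
have E : 2 * N.+1%:Z + 2 - tc = 2 * N%:Z + 2 - tc + 2 by lia.
rewrite E; have uc : c \is a GRing.unit by exact: qp_unit.
have Eg := qpS (2 * N%:Z + 2 - tc) 1 (- yc) (- (xn n i + vc)).
have ug : qp (2 * N%:Z + 2 - tc) 1 (- yc) (- (xn n i + vc)) \is a GRing.unit by exact: qp_unit.
have uh : qp (2 * N%:Z + 2 - tc + 2) 1 (- yc) (- (xn n i + vc)) \is a GRing.unit by exact: qp_unit.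
set g := qp (2 * N%:Z + 2 - tc) _ _ _ in ug Eg *; set h := qp _ 1 _ _ in uh Eg *.
set x := mon _ 1 _ _ in Eg.
have -> : mon (2 * N%:Z + 2) 1 0 0 = u i * x.
  by rewrite monM; congr (mon _ _ _ _); rewrite ?subrr //; lia.
rewrite !invrM //; have V1 := mulVr ug; have V2 := mulVr uh.
apply: (mulIr ug); set U := u i.
transitivity (a * c^-1 * U * (1 - x) * (g^-1 * g)); first by ring.
rewrite V1 Eg; transitivity (a * c^-1 * U * (1 - x) * (h^-1 * h)); first by rewrite V2.
by ring.
Qed.

Lemma F2S N i : F2 N i * (u i - mon (2 * N%:Z + 2) 0 0 0) = u i * F2 N.+1 i.
Proof.
rewrite /Fp qpnS; set x := mon (_ + _) 0 _ _.
have -> : mon (2 * N%:Z + 2) 0 0 0 = u i * x.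
  by rewrite monM; congr (mon _ _ _ _); rewrite ?subrr //; lia.
by ring.
Qed.

(** N steps from B = z to B = z q^N; the products are (q A B z^r)_N and (q B z^r)_N at B = z. *)
Lemma chain1 N : CT (Phi m' (F1 0)) * \prod_(r < m) qpn (al + 2) (r + 2) 0 0 N =
  \prod_(r < m) qpn 2 (r + 1) 0 0 N * CT (Phi m' (F1 N)).
Proof.
elim: N => [|N IH].
  by rewrite !big1 ?mul1r ?mulr1 // => r _; rewrite /qpn big_ord0.
under eq_bigr do rewrite qpnS; under [in RHS]eq_bigr do rewrite qpnS.
rewrite !big_split /= mulrA IH -!mulrA; congr (_ * _).
have := B_step (F := F1 N) (F' := F1 N.+1) vcP (cst_mon n al 1) (cst_mon n (2 * N%:Z + 2) 1)
  unit_qAz (qdiff_Ft mn tc yc vcP al 0 (2 * N%:Z)).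
have -> : qq * mon (2 * N%:Z + 2) 1 0 0 = mon (2 * N.+1%:Z + 2) 1 0 0.
  by rewrite monM !addr0; congr (mon _ _ _ _); lia.
move=> /(_ (qdiff_Ft mn tc yc vcP al 0 _) (fun i _ => F1S N i)).
move=> E; transitivity (CT (Phi m' (F1 N)) *
    \prod_(r < m) (1 - A * mon (2 * N%:Z + 2) 1 0 0 * zz ^+ r)).
  congr (_ * _); apply: eq_bigr => r _; rewrite zzX !monM !addr0.
  by congr (1 - mon _ _ _ _); lia.
rewrite E; congr (_ * _); apply: eq_bigr => r _; rewrite zzX !monM !addr0.
by congr (1 - mon _ _ _ _); lia.
Qed.

(** The same walk from B = 1 to B = q^N. *)
Lemma chain2 N : CT (Phi m' (F2 0)) * \prod_(r < m) qpn (al + 2) (r + 1) 0 0 N =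
  \prod_(r < m) qpn 2 r 0 0 N * CT (Phi m' (F2 N)).
Proof.
elim: N => [|N IH].
  by rewrite !big1 ?mul1r ?mulr1 // => r _; rewrite /qpn big_ord0.
under eq_bigr do rewrite qpnS; under [in RHS]eq_bigr do rewrite qpnS.
rewrite !big_split /= mulrA IH -!mulrA; congr (_ * _).
have := B_step (F := F2 N) (F' := F2 N.+1) vcP (cst_mon n al 1) (cst_mon n (2 * N%:Z + 2) 0)
  unit_qAz (qdiff_Fp mn tc yc vcP al N).
have -> : qq * mon (2 * N%:Z + 2) 0 0 0 = mon (2 * N.+1%:Z + 2) 0 0 0.
  by rewrite monM !addr0; congr (mon _ _ _ _); lia.
move=> /(_ (qdiff_Fp mn tc yc vcP al _) (fun i _ => F2S N i)).
move=> E; transitivity (CT (Phi m' (F2 N)) *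
    \prod_(r < m) (1 - A * mon (2 * N%:Z + 2) 0 0 0 * zz ^+ r)).
  congr (_ * _); apply: eq_bigr => r _; rewrite zzX !monM !addr0.
  by congr (1 - mon _ _ _ _); lia.
rewrite E; congr (_ * _); apply: eq_bigr => r _; rewrite zzX !monM !addr0.
by congr (1 - mon _ _ _ _); lia.
Qed.

Lemma wge_wpair i j : wge 0 (wpair n i j).
Proof.
rewrite /wpair invrM ?qp_unit //.
by do ![apply: wge0M]; (apply: wge_qp || apply: wge_qpV).
Qed.

Lemma wge_W : wge 0 (W n m).
Proof. by apply: wge_prod => j _; apply: wge_prod => i _; exact: wge_wpair. Qed.

(** Both weights approximate the one at B = 0, namely (u, q/u)_oo / (A u)_oo, up to order q^N; here
    tc <= 2 enters. *)
Lemma wge_F1F2 N : wge (2 * N%:Z) (CT (Phi m' (F1 N)) - CT (Phi m' (F2 N))).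
Proof.
rewrite -raddfB /= /Phi -mulrBr; apply: wge_CT; apply: wgeMl; last exact: wge_W.
have w1 i : wge 0 (qp tc 0 yc (xn n i + vc) / qp (al + tc) 1 yc (xn n i + vc)).
  by apply: wge0M; [apply: wge_qp|apply: wge_qpV]; lia.
have F1E i : F1 N i = qp tc 0 yc (xn n i + vc) / qp (al + tc) 1 yc (xn n i + vc) *
   (qp (2 - tc) 0 (- yc) (- (xn n i + vc)) *
   (qp (2 * N%:Z + 2 - tc) 1 (- yc) (- (xn n i + vc)))^-1).
  by rewrite /Ft pw0 mul1r invrM ?qp_unit //; ring.
have w2 i : wge 0 (qp (2 - tc) 0 (- yc) (- (xn n i + vc)) *
   (qp (2 * N%:Z + 2 - tc) 1 (- yc) (- (xn n i + vc)))^-1).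
  by apply: wge0M; [apply: wge_qp|apply: wge_qpV]; lia.
have w3 i : wge 0 (qpn (2 - tc) 0 (- yc) (- (xn n i + vc)) N) by apply: wge_qpn; lia.
apply: wge_prodB => i _; first by rewrite F1E; exact: wge0M.
  exact: wge0M.
rewrite F1E /Fp -mulrBr; apply: wgeMl; last exact: w1.
rewrite -[qpn _ _ _ _ _]mulr1; apply: wgeMB; [apply: wge_qp; lia|exact: wge1| |].
  by apply: (wgeW _ (@wge_qpnB _ _ _ _ _ _ _)); lia.
by apply: (wgeW _ (@wge_qpV1 _ _ _ _ _ _ _)); lia.
Qed.

Section Base.
Variables (sy : int) (sd : 'rV[int]_n).
(** A grading in which each u_i has degree 1 and, by [scale0], [W] has degree 0: it is carried by y
    or by the extra variable in vc. *)
Hypothesis scale1 : forall i, (i < m)%N -> sy * yc + dot sd (xn n i + vc) = 1.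
Hypothesis scale0 : forall i, (i < m)%N -> dot sd (xn n i) = 0.

Definition scl (N : int) : G -> G := act 1%g (N * sy) (N *: sd).
HB.instance Definition _ N := GRing.RMorphism.on (scl N).

Lemma dotZl k (d v : 'rV[int]_n) : dot (k *: d) v = k * dot d v.
Proof. by rewrite /dot mulr_sumr; apply: eq_bigr => i _; rewrite mxE mulrA. Qed.

Lemma scl_W N : scl N (W n m) = W n m.
Proof.
rewrite rmorph_prod; apply: eq_bigr => j _; rewrite rmorph_prod; apply: eq_bigr => i _ /=.
have im : (i < m)%N by apply: ltn_trans (ltn_ord i) (ltn_ord j).
rewrite /wpair rmorphM rmorphV ?unitrM ?qp_unit // !rmorphM /= /scl !act_qp !col_perm1.
have dx a b : (a < m)%N -> (b < m)%N -> dot (N *: sd) (xq n a b) = 0.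
  by move=> am bm; rewrite dotZl dotD dotN !scale0 // subrr mulr0.
by rewrite !dx // !(mulr0, addr0).
Qed.

(* Scaling c -> q^N c leaves the constant term unchanged and pushes the one-sided
   weight (u)/(A u) to 1. *)
Lemma CT_F2_0 : CT (Phi m' (F2 0)) = CT (W n m).
Proof.
apply: wge_eq => N; rewrite -(CT_act 1%g (N%:Z * sy) (N%:Z *: sd) (Phi m' _)) -/(scl _ _).
rewrite /Phi rmorphM /= scl_W -raddfB /= -{2}[W n m]mulr1 -mulrBr.
apply: wge_CT; apply: wgeMl; last exact: wge_W.
rewrite rmorph_prod; apply: wge_prod1 => // i _ /=.
rewrite /Fp /qpn big_ord0 mulr1 rmorphM rmorphV ?qp_unit //= /scl !act_qp !col_perm1.
rewrite dotZl -mulrA -mulrDr scale1 // mulr1.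
have E1 : wge N%:Z (qp (tc + 2 * N%:Z) 0 yc (xn n i + vc) - 1).
  by apply: (wgeW _ (@wge_qp1 _ _ _ _ _ _)); lia.
have E2 : wge N%:Z ((qp (al + tc + 2 * N%:Z) 1 yc (xn n i + vc))^-1 - 1).
  by apply: (wgeW _ (@wge_qpV1 _ _ _ _ _ _ _)); lia.
by apply: wgeM1 => //; apply: wge_qpV; lia.
Qed.

(** This is CT = CT(W) prod_r (q A z^r, q B z^r)_oo / (q z^r, q A B z^r)_oo at B = z. Truncating the
    products at N costs weight N, and after truncation the two chains reduce the claim to
    [wge_F1F2]. *)
Theorem morris0 :
  CT (Phi m' (F1 0)) * (\prod_(r < m) qp (al + 2) (r + 2) 0 0 * \prod_(r < m) qp 2 r 0 0) =
  CT (W n m) * (\prod_(r < m) qp (al + 2) (r + 1) 0 0 * \prod_(r < m) qp 2 (r + 1) 0 0).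
Proof.
pose a N := \prod_(r < m) qpn (al + 2) (r + 2) 0 0 N : G.
pose b N := \prod_(r < m) qpn 2 (r + 1) 0 0 N : G.
pose c N := \prod_(r < m) qpn (al + 2) (r + 1) 0 0 N : G.
pose d N := \prod_(r < m) qpn 2 r 0 0 N : G.
have w0 x (s : nat) N : 0 <= x -> wge 0 (\prod_(r < m) qpn x (r + s) 0 0 N : G).
  by move=> x0; apply: wge_prod => r _; apply: wge_qpn; lia.
have wi x (s : nat) : 0 <= x -> wge 0 (\prod_(r < m) qp x (r + s) 0 0 : G).
  by move=> x0; apply: wge_prod => r _; apply: wge_qp; lia.
have wd x (s N : nat) : 0 <= x -> wge N%:Z (\prod_(r < m) qp x (r + s) 0 0 -
    \prod_(r < m) qpn x (r + s) 0 0 N : G).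
  move=> x0; apply: wge_prodB => r _; [apply: wge_qp; lia|apply: wge_qpn; lia|].
  by apply: (wgeW _ (@wge_qpnB _ _ _ _ _ _ _)); lia.
have d0 N : d N = \prod_(r < m) qpn 2 (r + 0) 0 0 N by apply: eq_bigr => r _; rewrite addn0.
have d0' : \prod_(r < m) qp 2 r 0 0 = \prod_(r < m) qp 2 (r + 0) 0 0 :> G.
  by apply: eq_bigr => r _; rewrite addn0.
rewrite d0' -CT_F2_0; set J1 := CT (Phi m' (F1 0)); set J2 := CT (Phi m' (F2 0)).
have wF1 : wge 0 J1.
  rewrite -(subrK J2 J1); apply: wgeD; first exact: (@wge_F1F2 0%N).
  by rewrite /J2 CT_F2_0; apply: wge_CT; exact: wge_W.
have wF2 : wge 0 J2 by rewrite /J2 CT_F2_0; apply: wge_CT; exact: wge_W.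
apply: wge_eq => N.
set X := \prod_(r < m) qp (al + 2) (r + 2) 0 0 * _; set Y := _ * \prod_(r < m) qp 2 (r + 1) 0 0.
have EX : wge N%:Z (X - a N * d N).
  by rewrite d0; apply: wgeMB; [exact: wi|exact: w0|exact: wd|exact: wd].
have EY : wge N%:Z (Y - c N * b N).
  by apply: wgeMB; [exact: wi|exact: w0|exact: wd|exact: wd].
have E : wge N%:Z (J1 * (a N * d N) - J2 * (c N * b N)).
  have H1 := chain1 N; have H2 := chain2 N.
  rewrite mulrA (mulrA J2) H1 H2 -/(b N) -/(d N).
  have -> : b N * CT (Phi m' (F1 N)) * d N - d N * CT (Phi m' (F2 N)) * b N =
    (CT (Phi m' (F1 N)) - CT (Phi m' (F2 N))) * (b N * d N) by ring.
  apply: wgeMr; first by apply: (wgeW _ (@wge_F1F2 N)); lia.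
  by apply: wge0M; [|rewrite d0]; exact: w0.
have -> : J1 * X - J2 * Y = J1 * (X - a N * d N) - J2 * (Y - c N * b N) +
   (J1 * (a N * d N) - J2 * (c N * b N)) by ring.
by apply: wgeD => //; apply: wgeB; apply: wgeMl.
Qed.
End Base.
End Morris.

(** * Constant terms of the non-symmetric weight *)

Section ConstantTerms.
Variable n : nat.
Local Notation G := (gser n).
Local Notation P s := (qp 2 s 0 0 : G).
Local Notation w m := (CT (W n m)).

Lemma unit_qp2 s : P s \is a GRing.unit.
Proof. by case: s => [|s]; [exact: qq_unit|exact: qp_unit]. Qed.

Lemma xn_lt0 m (j : 'I_n) : (j < m)%N -> xn n m 0 j = 0.
Proof. by move=> jm; rewrite mxE ltn_eqF. Qed.

Lemma dot_xnxn i j : (i < n)%N -> dot (xn n i) (xn n j) = (i == j)%:R.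
Proof.
move=> ni; rewrite /dot (bigD1 (Ordinal ni)) //= !mxE eqxx mul1r big1.
  by rewrite addr0 -natz.
by move=> l /eqP li; rewrite mxE; case: eqP => [E|_]; [case: li; apply: val_inj|rewrite mul0r].
Qed.

(* The (m+1)-variable kernel is the m-variable weight with u_i = x_i / x_m. *)
Lemma CT_W_rec m' : (m'.+1 < n)%N ->
  w m'.+2 * (\prod_(r < m'.+1) P (r + 2) * \prod_(r < m'.+1) P r) =
  w m'.+1 * (\prod_(r < m'.+1) P (r + 1) * \prod_(r < m'.+1) P (r + 1)).
Proof.
move=> mn; set m := m'.+1.
have vcP (j : 'I_n) : (j <= m')%N -> (- xn n m) 0 j = 0.
  by move=> jm; rewrite mxE xn_lt0 ?oppr0.
have s1 i : (i < m)%N -> 0 * 0 + dot (- xn n m) (xn n i + - xn n m) = 1.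
  move=> im; rewrite mul0r add0r dotD dotN /dot.
  under eq_bigr do rewrite mxE mulNr.
  under [X in _ - X]eq_bigr do rewrite mxE mulNr.
  by rewrite !sumrN -!/(dot _ _) !dot_xnxn // eqxx gtn_eqF // oppr0 add0r opprK.
have s0 i : (i < m)%N -> dot (- xn n m) (xn n i) = 0.
  move=> im; rewrite /dot; under eq_bigr do rewrite mxE mulNr.
  by rewrite sumrN -/(dot _ _) dot_xnxn // gtn_eqF // oppr0.
have := @morris0 n m' (ltnW mn) 0 0 0 (- xn n m) vcP (lexx _) (ler0n _ 2) (ler0n _ 2) (ler0n _ 2)
  0 (- xn n m) s1 s0.
have -> : Phi m' (Ft 0 0 (- xn n m) 0 0 (2 * 0%:Z)) = W n m.+1.
  have -> : W n m.+1 = W n m * \prod_(i < m) wpair n i m by rewrite /W big_ord_recr.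
  congr (_ * _); apply: eq_bigr => i _.
  by rewrite /Ft pw0 mul1r /wpair (xqC n i m).
by move=> ->.
Qed.

(** The constant term of [W] in m variables is (q z)_oo^m / ((q)_oo^(m-1) (q z^m)_oo): the products
    of the recurrence telescope in the exponent of z. *)
Lemma CT_W m' : (m'.+1 <= n)%N -> w m'.+1 * (P 0%N ^+ m' * P m'.+1) = P 1%N ^+ m'.+1.
Proof.
elim: m' => [|m' IH] mn.
  by rewrite /W big_ord_recl !big_ord0 mulr1 CT1 !mul1r.
have E := CT_W_rec mn; have {}IH := IH (ltnW mn); set m := m'.+1 in mn E IH *.
set A := \prod_(r < m) P (r + 2)%N in E; set B := \prod_(r < m) P r in E.
set C := \prod_(r < m) P (r + 1)%N in E.
have EA : A * P 1%N = C * P m.+1.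
  have -> : C * P m.+1 = \prod_(r < m.+1) P (r + 1)%N by rewrite big_ord_recr /= addn1.
  rewrite big_ord_recl mulrC; congr (_ * _); apply: eq_bigr => r _.
  by rewrite lift0 addn1 addn2.
have EB : B * P m = P 0%N * C.
  have -> : B * P m = \prod_(r < m.+1) P r by rewrite big_ord_recr.
  by rewrite big_ord_recl; congr (_ * _); apply: eq_bigr => r _; rewrite lift0 addn1.
have uC : C \is a GRing.unit by rewrite unitr_prod // => r _; exact: unit_qp2.
have {EA EB}E : w m.+1 * P m.+1 * P 0%N = w m * P 1%N * P m.
  apply: (mulrI uC); apply: (mulrI uC).
  transitivity (w m.+1 * (C * P m.+1) * (P 0%N * C)); first by ring.
  rewrite -EA -EB; transitivity (w m.+1 * (A * B) * P 1%N * P m); first by ring.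
  by rewrite E; ring.
rewrite [in RHS]exprSr -IH; have -> : P 0%N ^+ m = P 0%N * P 0%N ^+ m' by rewrite -exprS.
transitivity (w m.+1 * P m.+1 * P 0%N * P 0%N ^+ m'); first by ring.
by rewrite E; ring.
Qed.
End ConstantTerms.

(** * The constant terms for every integer k *)

Section Aomoto.
Variable n' : nat.
Local Notation n := n'.+1.
Local Notation G := (gser n).
Local Notation F k := (Ft 1 1 (0 : 'rV[int]_n) (-2) k 0).
Local Notation u := (u 1 1 (0 : 'rV[int]_n)).
Local Notation w := (CT (W n n)).

(** The arguments 1, 1, 0, -2, 0 of [Ft] encode u_i = q^(1/2) y x_i, A = z/q and B = z. *)
Definition ek (k : int) : G := CT (Phi n' (F k)).

Let vcP : forall j : 'I_n, (j <= n')%N -> (0 : 'rV[int]_n) 0 j = 0.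
Proof. by move=> j _; rewrite mxE. Qed.

(** The expected value of [ek k] up to factors free of k. Its power q^(nk(k-1)/2) misses q^(nk^2/2)
    by the factor q^(nk/2) hidden in the u_i^k. *)
Definition rho (k : int) : G := (-1) ^ (n%:Z * k) * mon (n%:Z * (k * (k - 1))) 0 0 0 *
  \prod_(r < n) (qp (- 2 * k) (r + 1) 0 0 * qp (2 * (k + 1)) (r + 1) 0 0).

Definition Den : G := \prod_(r < n) qp 0 (r + 2) 0 0 * \prod_(r < n) qp 2 r 0 0.

Lemma ek0 : ek 0 * Den = w * rho 0.
Proof.
have s1 i : (i < n)%N -> 1 * 1 + dot (0 : 'rV[int]_n) (xn n i + 0) = 1.
  by rewrite dot0l mulr1 addr0.
have s0 i : (i < n)%N -> dot (0 : 'rV[int]_n) (xn n i) = 0 by rewrite dot0l.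
have := @morris0 n n' (leqnn _) 1 1 (-2) 0 vcP (ler0n _ 1) _ (lexx _) (ler0n _ 1) 1 0 s1 s0.
move=> /(_ isT) E; rewrite /ek /Den [LHS]E.
rewrite -[rho 0]/((-1) ^ (n%:Z * 0) * mon (n%:Z * 0) 0 0 0 *
  \prod_(r < n) (qp 0 (r + 1) 0 0 * qp 2 (r + 1) 0 0)).
by rewrite mulr0 expr0z mon0 !mul1r big_split.
Qed.

Let qdk k := qdiff_Ft (leqnn n) 1 1 vcP (-2) k 0.

Lemma u_pw k i : u i * pw 1 1 0 k i = pw 1 1 0 (k - 1) i.
Proof.
rewrite monM; congr (mon _ _ _ _); try lia.
by rewrite -[X in X - _]scale1r -scalerBl -scaleNr; congr (_ *: _); lia.
Qed.

(** The weight contains u^-k, so multiplying by all the u_i lowers k; the q-Aomoto recurrence run to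
    its end thus relates k to k - 1. *)
Lemma EE_n k : EE n' 1 1 0 (F k) n = ek (k - 1).
Proof.
rewrite /EE /ek /Phi mulrCA -big_split; congr (CT (_ * _)).
by apply: eq_bigr => i _ /=; rewrite /Ft [LHS]mulrA u_pw.
Qed.

Lemma ek_shift k : ek (k - 1) * \prod_(r < n) (1 - mon (- 2 * k) (r + 1) 0 0) =
  (- mon (2 - 2 * k) 0 0 0) ^+ n * \prod_(r < n) (1 - mon (2 * k) (r + 1) 0 0) * ek k.
Proof.
have := EE_prod vcP (cst_mon n (-2) 1) (cst_mon n (0 + 2) 1) (cst_mon n (2 - 2 * k) 0) (qdk k).
rewrite EE_n EE_0 -/(ek k) => E.
transitivity (ek (k - 1) * \prod_(r < n) (1 - mon (2 - 2 * k) 0 0 0 * mon (-2) 1 0 0 * zz n ^+ r)).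
  congr (_ * _); apply: eq_bigr => r _; rewrite zzX !monM !addr0.
  have -> : 2 - 2 * k - 2 = - 2 * k by lia.
  by rewrite add0n addnC.
rewrite [LHS]E -[X in _ ^+ X]card_ord -prodr_const -big_split /=; congr (_ * _).
apply: eq_bigr => r _; rewrite zzX !mulNr mulrBr mulr1 !monM !addr0.
have -> : 2 - 2 * k + 2 * k = 0 + 2 by lia.
by rewrite add0n addnC.
Qed.

Lemma EE_1 k : EE n' 1 1 0 (F k) 1 * (1 - mon (- 2 * k) n 0 0) =
  - mon (2 - 2 * k) 0 0 0 * (1 - mon (2 * k) 1 0 0) * ek k.
Proof.
have := EE_rec vcP (cst_mon n (-2) 1) (cst_mon n (0 + 2) 1) (cst_mon n (2 - 2 * k) 0) (qdk k)
  (leq0n _).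
rewrite EE_0 -/(ek k) subn0 expr0 mulr1 zzX !monM !addr0 => E.
transitivity (EE n' 1 1 0 (F k) 1 * (1 - mon (2 - 2 * k - 2) (0 + 1 + n')%N 0 0)).
  by have -> : 2 - 2 * k - 2 = - 2 * k by lia.
rewrite [LHS]E; have -> : - mon (2 - 2 * k) 0 0 0 * (1 - mon (2 * k) 1 0 0) =
    - (mon (2 - 2 * k) 0 0 0 - mon (2 - 2 * k + 2 * k) 1 0 0) :> G.
  by rewrite mulNr mulrBr mulr1 monM !addr0.
by have -> : 2 - 2 * k + 2 * k = 0 + 2 by lia.
Qed.

Lemma rho_shift k : rho (k - 1) * \prod_(r < n) (1 - mon (- 2 * k) (r + 1) 0 0) =
  (- mon (2 - 2 * k) 0 0 0) ^+ n * \prod_(r < n) (1 - mon (2 * k) (r + 1) 0 0) * rho k.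
Proof.
rewrite /rho; set s := (-1) ^ (n%:Z * k).
have -> : (-1) ^ (n%:Z * (k - 1)) = s * (-1) ^+ n :> G.
  rewrite mulrBr mulr1 exprzDr ?unitrN1 //; congr (_ * _).
  by rewrite -exprnN invr_sign.
have -> : mon (n%:Z * ((k - 1) * (k - 1 - 1))) 0 0 0 =
   mon (n%:Z * (k * (k - 1))) 0 0 0 * mon (2 - 2 * k) 0 0 0 ^+ n :> G.
  rewrite monX mul0n !mul0rn monM !addr0; congr (mon _ _ _ _).
  by rewrite -mulr_natr natz; lia.
rewrite (exprNn (mon (2 - 2 * k) 0 0 0)); set s' := (-1) ^+ n; set M := mon _ _ _ _; set K := mon (2 - _) _ _ _ ^+ n.
set X := \prod_(r < n) _; set a := \prod_(r < n) _; set b := \prod_(r < n) _.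
set Y := \prod_(r < n) _.
suff E : X * a = b * Y.
  by transitivity (s * s' * (M * K) * (X * a)); [ring|rewrite E; ring].
rewrite /X /Y /a /b -!big_split; apply: eq_bigr => r _ /=.
rewrite [qp (- 2 * k) _ _ _]qpS [qp (2 * (k - 1 + 1)) _ _ _]qpS.
have -> : - 2 * (k - 1) = - 2 * k + 2 by lia.
have -> : 2 * (k - 1 + 1) = 2 * k by lia.
have -> : 2 * k + 2 = 2 * (k + 1) by lia.
by ring.
Qed.

(** Both sides obey the same two-term relation, whose coefficients are units: up to a signed
    monomial they are products of factors 1 - q^j z^s with s > 0. So the induction from k = 0 runs
    in both directions. *)
Lemma ekE k : ek k * Den = w * rho k.
Proof.
have ua j : \prod_(r < n) (1 - mon (- 2 * j) (r + 1) 0 0 : G) \is a GRing.unit.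
  by rewrite unitr_prod // => r _; rewrite unit_1mon ?addn1.
have ub j : (- mon (2 - 2 * j) 0 0 0) ^+ n * \prod_(r < n) (1 - mon (2 * j) (r + 1) 0 0 : G)
    \is a GRing.unit.
  rewrite unitrM unitrX ?unitrN ?mon_unit //=.
  by rewrite unitr_prod // => r _; rewrite unit_1mon ?addn1.
have eqv j : ek j * Den = w * rho j <-> ek (j - 1) * Den = w * rho (j - 1).
  have E1 := ek_shift j; have E2 := rho_shift j; move: E1 E2 (ua j) (ub j).
  set a := \prod_(r < n) _; set b := _ * \prod_(r < n) _ => E1 E2 u_a u_b; split=> H.
    apply: (mulIr u_a); rewrite mulrAC E1.
    transitivity (b * (ek j * Den)); first by ring.
    by rewrite H; transitivity (w * (rho (j - 1) * a)); [rewrite E2|]; ring.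
  apply: (mulrI u_b); rewrite mulrA -E1.
  transitivity (ek (j - 1) * Den * a); first by ring.
  by rewrite H; transitivity (w * (rho (j - 1) * a)); [|rewrite E2]; ring.
elim/int_rec: k => [|k IH|k IH]; first exact: ek0.
  by apply/eqv; have -> : k.+1%:Z - 1 = k by lia.
have -> : - k.+1%:Z = - k%:Z - 1 by lia.
exact: (proj1 (eqv _) IH).
Qed.
End Aomoto.

(** * Symmetrisation *)

Definition tpn (i m j : nat) : nat := if j == i then m else if j == m then i else j.
Lemma tpnK i m : involutive (tpn i m).
Proof. by move=> j; rewrite /tpn; repeat case: eqP; lia. Qed.

Lemma prod_tpn (R : comPzRingType) (i m N : nat) (H : nat -> R) : (i < N)%N -> (m < N)%N ->
  \prod_(j < N) H (tpn i m j) = \prod_(j < N) H j.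
Proof.
move=> iN mN; have tN j : (j < N)%N -> (tpn i m j < N)%N.
  by rewrite /tpn; repeat case: eqP; lia.
pose t (j : 'I_N) : 'I_N := Ordinal (tN j (ltn_ord j)).
have tK : involutive t by move=> j; apply: val_inj; rewrite /= tpnK.
by rewrite [RHS](reindex_inj (inv_inj tK)).
Qed.

Section Symmetrisation.
Variable n : nat.
Local Notation G := (gser n).

Definition X (i : nat) : G := mon 0 0 0 (xn n i).

Lemma sw_X a (an : (a.+1 < n)%N) i : sw an (X i) = X (swn a i).
Proof. by rewrite sw_mon sw_xn. Qed.

Lemma gser_2eq0 (f : G) : f = - f -> f = 0.
Proof.
move=> ff; apply: gser_eqP => e; have := congr1 (fun f : G => f e) ff.
by rewrite goppE => /eqP; rewrite -addr_eq0 -mulr2n mulrn_eq0 /= => /eqP.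
Qed.

Section Antisymmetric.
Variable M : {additive G -> G}.
Hypothesis MZ : forall s p, CT s = s -> M (s * p) = s * M p.
Hypothesis M_sw : forall a (an : (a.+1 < n)%N) p, M (sw an p) = - M p.

Definition sw_fixed (m : nat) (p : G) :=
  forall a (an : (a.+1 < n)%N), (a.+1 < m)%N -> sw an p = p.

(** Conjugating the transposition of i and m by the adjacent swap gives that of i and m+1; three
    sign changes leave one. *)
Lemma transposition i m : (i < m)%N -> (m < n)%N -> exists t : {rmorphism G -> G},
  [/\ forall j, t (X j) = X (tpn i m j), forall p, sw_fixed m.+1 p -> t p = p &
      forall p, M (t p) = - M p].
Proof.
elim: m => // m IH; rewrite ltnS leq_eqVlt => /predU1P[->|im] mn.
  exists (sw mn : {rmorphism G -> G}); split; [|by move=> p; apply|exact: M_sw].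
  by move=> j; exact: sw_X.
have [t [tX tp tM]] := IH im (ltnW mn).
exists (sw mn \o (t \o sw mn) : {rmorphism G -> G}); split.
- move=> j /=; rewrite sw_X tX sw_X; congr X.
  by rewrite /swn /tpn; repeat case: eqP; lia.
- move=> p pP /=; rewrite (pP m mn) // tp ?pP // => a an am.
  by apply: pP; lia.
by move=> p /=; rewrite M_sw tM M_sw opprK.
Qed.

Variable s : G.
Hypothesis cs : CT s = s.

Definition Dl m : G := \prod_(j < m) \prod_(i < j) (X i - s * X j).
Definition dl m : G := \prod_(i < m) X i ^+ (m.-1 - i).
Definition qfact m : G := \prod_(j < m) \sum_(r < j.+1) s ^+ r.
(** Its coefficients are symmetric in the first m variables, and its value at s X_m is the factor
    leading from [Dl m] to [Dl m.+1]. *)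
Definition chi m : {poly G} := \prod_(i < m) ((X i)%:P - 'X).

Lemma size_chi m : (size (chi m) <= m.+1)%N.
Proof.
apply: leq_trans (size_poly_prod_leq _ _) _; rewrite card_ord.
have sz (i : 'I_m) : (size ((X i)%:P - 'X)%R <= 2)%N.
  by rewrite -opprB size_polyN size_XsubC.
apply: (@leq_trans ((m * 2).+1 - m)); last by lia.
rewrite leq_sub2r // ltnS; apply: leq_trans (leq_sum _ (fun i _ => sz i)) _.
by rewrite sum_nat_const card_ord.
Qed.

Lemma sw_chi m r : (m <= n)%N -> sw_fixed m (chi m)`_r.
Proof.
move=> mn a an am; rewrite -[LHS]coef_map; congr (polyseq _)`_r.
rewrite /chi rmorph_prod /= -[RHS](prod_swn am (fun i => (X i)%:P - 'X)).
by apply: eq_bigr => i _; rewrite rmorphB /= map_polyC map_polyX /= sw_X.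
Qed.

(** X_m and X_(m-1-r) both carry the exponent r, so the transposition of m and m-1-r fixes the
    argument while M changes sign. *)
Lemma M_delta_eq0 m r p : (m < n)%N -> (r < m)%N -> sw_fixed m.+1 p ->
  M (dl m * X m ^+ r * p) = 0.
Proof.
move=> mn rm pP; apply: gser_2eq0.
have im : (m.-1 - r < m)%N by lia.
have [t [tX tp tM]] := transposition im mn.
rewrite -tM; congr (M _); rewrite rmorphM /= (tp p pP); congr (_ * _).
pose f j := if j == m then r else (m.-1 - j)%N.
have -> : dl m * X m ^+ r = \prod_(j < m.+1) X j ^+ f j.
  rewrite big_ord_recr /= /f eqxx; congr (_ * _); apply: eq_bigr => j _.
  by rewrite ltn_eqF.
rewrite -[LHS](@prod_tpn _ (m.-1 - r) m m.+1 (fun j => X j ^+ f j)) ?rmorph_prod; try lia.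
apply: eq_bigr => j _ /=; rewrite rmorphXn /= tX; congr (_ ^+ _).
by rewrite /f /tpn; repeat case: eqP; lia.
Qed.

(** Induction on m: expand the new factor chi_m(s X_m) in powers of s. The values K r do not depend
    on r, because consecutive ones differ by a term that contains [dl m] X_m^r times a coefficient
    of [chi m.+1], which [M_delta_eq0] kills. What is left is the factor 1 + s + ... + s^m. *)
Lemma M_vandermonde m p : (m <= n)%N -> sw_fixed m p ->
  M (Dl m * p) = qfact m * M (dl m * p).
Proof.
elim: m p => [|m IH] p mn pP.
  by rewrite /Dl /qfact /dl !big_ord0 !mul1r.
have fixm q : sw_fixed m.+1 q -> sw_fixed m q by move=> qP a an am; apply: qP; lia.
have fixM q q' l : sw_fixed l q -> sw_fixed l q' -> sw_fixed l (q * q').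
  by move=> qP qP' a an am; rewrite rmorphM /= qP ?qP'.
have fixX r : sw_fixed m (X m ^+ r).
  move=> a an am; rewrite rmorphXn /= sw_X; congr (X _ ^+ r).
  by rewrite /swn; repeat case: eqP; lia.
pose K r := M (dl m * ((chi m)`_r * X m ^+ r * p)).
have KS r : (r < m)%N -> K r.+1 = K r.
  move=> rm; have : (chi m.+1)`_r.+1 = (chi m)`_r.+1 * X m - (chi m)`_r.
    by rewrite /chi big_ord_recr /= mulrBr coefB coefMC coefMX.
  move=> /eqP; rewrite eq_sym subr_eq => /eqP E.
  transitivity (M (dl m * X m ^+ r * ((chi m.+1)`_r.+1 * p)) + K r).
    rewrite -raddfD; congr (M _).
    transitivity (dl m * X m ^+ r * (((chi m)`_r.+1 * X m) * p)).
      by rewrite exprS; ring.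
    by rewrite E; ring.
  rewrite M_delta_eq0 ?add0r //; apply: fixM => //; exact: sw_chi.
have KE r : (r <= m)%N -> K r = M (dl m.+1 * p).
  elim: r => [|r IHr] rm; last by rewrite KS // IHr // ltnW.
  (* At r = 0 the coefficient is X_0...X_(m-1), which turns [dl m] into [dl m.+1]. *)
  rewrite /K expr0 mulr1 mulrA; congr (M (_ * _)).
  rewrite -horner_coef0 /chi horner_prod /dl -big_split big_ord_recr /= subnn expr0 mulr1.
  apply: eq_bigr => i _ /=; rewrite !hornerE subr0 -exprSr; congr (_ ^+ _).
  by have := ltn_ord i; lia.
have -> : Dl m.+1 * p = \sum_(r < m.+1) s ^+ r * (Dl m * ((chi m)`_r * X m ^+ r * p)).
  have -> : Dl m.+1 = Dl m * \prod_(i < m) (X i - s * X m) by rewrite /Dl big_ord_recr.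
  have -> : \prod_(i < m) (X i - s * X m) = (chi m).[s * X m].
    by rewrite horner_prod; apply: eq_bigr => i _; rewrite !hornerE.
  rewrite (horner_coef_wide _ (size_chi m)) mulr_sumr mulr_suml.
  by apply: eq_bigr => r _; rewrite exprMn; ring.
rewrite raddf_sum /=.
transitivity (\sum_(r < m.+1) s ^+ r * (qfact m * M (dl m.+1 * p))).
  apply: eq_bigr => r _; rewrite (MZ _ (cstX r cs)).
  rewrite IH; [|exact: ltnW|]; first by rewrite -/(K r) KE // -ltnS.
  apply: (fixM); last exact: fixm.
  by apply: fixM; [apply: sw_chi; exact: ltnW|exact: fixX].
have -> : qfact m.+1 = qfact m * \sum_(r < m.+1) s ^+ r by rewrite /qfact big_ord_recr.
by rewrite -mulr_suml; ring.
Qed.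
End Antisymmetric.

Lemma qfact1 m : qfact 1 m = m`!%:R.
Proof.
elim: m => [|m IH]; first by rewrite /qfact big_ord0.
have -> : qfact 1 m.+1 = qfact 1 m * \sum_(r < m.+1) 1 ^+ r by rewrite /qfact big_ord_recr.
rewrite IH factS mulnC natrM; congr (_ * _).
by under eq_bigr do rewrite expr1n; rewrite sumr_const card_ord.
Qed.

Definition spair i j : G := qp 0 0 0 (xq n i j) * qp 0 0 0 (xq n j i) /
  (qp 0 1 0 (xq n i j) * qp 0 1 0 (xq n j i)).
Definition WS : G := \prod_(j < n) \prod_(i < j) spair i j.

(** Dividing by x_i x_j keeps the symmetry and turns the remaining factors (1 - v)(1 - c/v) into
    polynomials in the X_i. *)
Definition yx i j : G := ypair n i j * mon 0 0 0 (- (xn n i + xn n j)).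
Lemma yxC i j : yx i j = yx j i.
Proof. by rewrite /yx (ypairC n i j) (addrC (xn n i)). Qed.

Lemma sw_yx a (an : (a.+1 < n)%N) i j : sw an (yx i j) = yx (swn a i) (swn a j).
Proof.
rewrite /yx /ypair !rmorphM rmorphV ?unitrM ?qp_unit // !rmorphM /= !sw_qp sw_mon.
by rewrite !sw_xq linearN linearD /= !sw_xn.
Qed.

Lemma pair_cleared (c : G) i j :
  (1 - mon 0 0 0 (xq n i j)) * (1 - c * mon 0 0 0 (xq n j i)) =
  mon 0 0 0 (- (xn n i + xn n j)) * ((X j - X i) * (X i - c * X j)).
Proof.
have E i' j' : mon 0 0 0 (xq n i' j') = X i' * mon 0 0 0 (- xn n j') by rewrite monM !addr0.
have V i' : X i' * mon 0 0 0 (- xn n i') = 1 by rewrite monM (subrr (xn n i')); exact: mon0.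
have -> : mon 0 0 0 (- (xn n i + xn n j)) = mon 0 0 0 (- xn n i) * mon 0 0 0 (- xn n j).
  by rewrite monM !addr0 opprD.
rewrite !E; have Vi := V i; have Vj := V j; move: Vi Vj.
set a := X i; set b := X j; set a' := mon _ _ _ _; set b' := mon _ _ _ (- xn n j) => Vi Vj.
transitivity ((b * b' - a * b') * (a * a' - c * (b * a'))); first by rewrite Vi Vj; ring.
ring.
Qed.

Lemma wpair_yx i j : wpair n i j = yx i j * ((X j - X i) * (X i - zz n * X j)).
Proof.
rewrite wpairE /yx -mulrA -pair_cleared; congr (_ * (_ * (1 - _))).
by rewrite monM !add0r.
Qed.

Lemma spair_yx i j : spair i j = yx i j * ((X j - X i) * (X i - 1 * X j)).
Proof.
rewrite /yx -mulrA -(pair_cleared 1) mul1r /spair /ypair.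
rewrite (qpS 0 0 0 (xq n i j)) (qpS 0 0 0 (xq n j i)) !add0r.
ring.
Qed.

(* The weight W is, up to the symmetric factor yx and the Vandermonde product,
   the deformed Vandermonde product prod_(i<j) (x_i - z x_j), whose
   antisymmetrisation is [n]_z! times the Vandermonde product. *)
Lemma symmetrise (g : G) : (forall a (an : (a.+1 < n)%N), sw an g = g) ->
  CT (g * W n n) * n`!%:R = qfact (zz n) n * CT (g * WS).
Proof.
move=> gP; pose YY := \prod_(j < n) \prod_(i < j) yx i j.
pose De := \prod_(j < n) \prod_(i < j) (X j - X i).
pose M0 p := CT (g * YY * De * p).
have MB : zmod_morphism M0 by move=> p p'; rewrite /M0 mulrBr raddfB.
pose M : {additive G -> G} := HB.pack M0 (GRing.isZmodMorphism.Build G G M0 MB).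
have ME p : M p = CT (g * YY * De * p) by [].
have MZ s p : CT s = s -> M (s * p) = s * M p.
  by move=> cs; rewrite !ME -(CTZ _ cs); congr CT; ring.
have Msw a (an : (a.+1 < n)%N) p : M (sw an p) = - M p.
  have YP : sw an YY = YY.
    have [rest [Y1 Y2]] := prod_pairs_swn an yx.
    rewrite [RHS]Y1 yxC -Y2 rmorph_prod; apply: eq_bigr => j _; rewrite rmorph_prod.
    by apply: eq_bigr => i _; exact: sw_yx.
  have DP : sw an De = - De.
    have [rest [D1 D2]] := prod_pairs_swn an (fun i j => X j - X i).
    rewrite [in RHS]/De D1 -mulNr opprB -D2 rmorph_prod; apply: eq_bigr => j _.
    by rewrite rmorph_prod; apply: eq_bigr => i _; rewrite rmorphB /= !sw_X.
  rewrite !ME -[in RHS](CT_sw an) !rmorphM /= gP YP DP -raddfN; congr CT; ring.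
have key s : CT s = s -> CT (g * \prod_(j < n) \prod_(i < j)
    (yx i j * ((X j - X i) * (X i - s * X j)))) = qfact s n * M (dl n).
  move=> cs; have fix1 : sw_fixed n 1 by move=> a an _; rewrite rmorph1.
  have := M_vandermonde MZ Msw cs (leqnn n) fix1; rewrite !mulr1 => <-.
  rewrite ME; congr CT; rewrite -!mulrA; congr (_ * _).
  rewrite /YY /De /Dl -!big_split; apply: eq_bigr => j _ /=.
  by rewrite -!big_split.
have -> : W n n = \prod_(j < n) \prod_(i < j) (yx i j * ((X j - X i) * (X i - zz n * X j))).
  by apply: eq_bigr => j _; apply: eq_bigr => i _; exact: wpair_yx.
have -> : WS = \prod_(j < n) \prod_(i < j) (yx i j * ((X j - X i) * (X i - 1 * X j))).
  by apply: eq_bigr => j _; apply: eq_bigr => i _; exact: spair_yx.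
rewrite !key; [|exact: CT1|exact: cst_zz].
rewrite qfact1; ring.
Qed.
End Symmetrisation.

(** * Comparison with the right-hand side *)

Section Products.
Variable K : nat.
Local Notation G := (gser K).

Definition PkG (n : nat) (k : int) : G :=
  \prod_(i < n) ((qp (- 2 * k) i.+1 0 0 * qp (2 * (k + 1)) i.+1 0 0) /
                 (qp 0 i.+2 0 0 * qp 2 i 0 0)).
Definition zfact (n : nat) : G := \prod_(l < n) (1 - mon 0 l.+1 0 0).
Definition prefG (n : nat) : G :=
  qp 0 1 0 0 ^+ n / (qp 2 0 0 0 ^+ n.-1 * qp 2 n 0 0 * zfact n).
Definition wkG (n : nat) (k : int) : G :=
  (-1) ^ (n%:Z * k) * mon (n%:Z * (k * k)) 0 (n%:Z * k) 0.
Definition ratG (n : nat) (k : int) : G :=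
  (1 - mon (2 * k) 1 0 0) / (mon 0 n 0 0 - mon (2 * k) 0 0 0).

Lemma unit_zfact n : zfact n \is a GRing.unit.
Proof. by rewrite unitr_prod // => i _; exact: unit_1mon. Qed.

Lemma unit_pref n :
  qp 2 0 0 0 ^+ n.-1 * qp 2 n 0 0 * zfact n \is a @GRing.unit G.
Proof. by rewrite !unitrM unitrX ?unit_qp2 ?unit_zfact. Qed.

Lemma unit_Pk i : qp 0 i.+2 0 0 * qp 2 i 0 0 \is a @GRing.unit G.
Proof. by rewrite unitrM qp_unit ?unit_qp2. Qed.

(** This form shows in which direction 1/(z^n - q^k) is expanded: in powers of z, for every k. *)
Lemma znqkE n k : mon 0 n 0 0 - mon (2 * k) 0 0 0 =
  - mon (2 * k) 0 0 0 * (1 - mon (- 2 * k) n 0 0) :> G.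
Proof.
by rewrite mulrBr mulr1 !mulNr monM (subrr (2 * k)) !addr0 opprK addrC.
Qed.

Lemma unit_znqk n k : (0 < n)%N -> mon 0 n 0 0 - mon (2 * k) 0 0 0 \is a @GRing.unit G.
Proof. by move=> n0; rewrite znqkE unitrM unitrN mon_unit unit_1mon. Qed.

Lemma gnatE m (e : expo K) : gsv (m%:R : G) e = if e == 0 then m%:R else 0.
Proof.
elim: m => [|m IH]; first by rewrite gsv0 /szero; case: ifP.
by rewrite -addn1 natrD gaddE IH gone_E; case: ifP => _; rewrite ?addr0 // natrD.
Qed.

Lemma gsv_nat m : gsv (m%:R : G) = smon m%:R 0.
Proof. by apply/funext => e; rewrite gnatE. Qed.

Lemma signz_mulE (z : int) (f : G) e : gsv ((-1) ^ z * f) e = (-1 : rat) ^ z * f e.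
Proof.
have nE m : gsv ((-1) ^+ m * f) e = (-1) ^+ m * f e.
  elim: m => [|m IH]; first by rewrite !expr0 !mul1r.
  by rewrite !exprS !mulN1r !mulNr goppE IH.
by case: z => m; [exact: nE|rewrite !NegzE -!exprnN !invr_sign; exact: nE].
Qed.

Lemma gsv_wk n k : gsv (wkG n k) =
  smon ((-1) ^ (n%:Z * k)) (n%:Z * (k * k), 0, n%:Z * k, 0).
Proof.
apply/funext => e; rewrite signz_mulE monE /smon.
by case: ifP => _; rewrite ?mulr1 ?mulr0.
Qed.
End Products.

Section Emb.
Variables (n' : nat).
Local Notation n := n'.+1.

Lemma emb_Pk k : emb n (PkG 0 n k) = PkG n n k.
Proof.
rewrite /PkG rmorph_prod; apply: eq_bigr => i _ /=.
by rewrite rmorphM rmorphV ?unit_Pk // !rmorphM /= !emb_qp.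
Qed.

Lemma emb_pref : emb n (prefG 0 n) = prefG n n.
Proof.
rewrite /prefG rmorphM rmorphV ?unit_pref // !rmorphM !rmorphXn /= !emb_qp.
congr (_ / (_ * _)); rewrite /zfact rmorph_prod; apply: eq_bigr => i _ /=.
by rewrite rmorphB rmorph1 /= emb_mon.
Qed.

Lemma emb_wk k : emb n (wkG 0 n k) = wkG n n k.
Proof. by rewrite /wkG rmorphM rmorphXz ?unitrN1 // rmorphN1 /= emb_mon. Qed.

Lemma emb_rat k : emb n (ratG 0 n k) = ratG n n k.
Proof.
rewrite /ratG rmorphM rmorphV ?unit_znqk // !rmorphB rmorph1 /= !emb_mon //.
Qed.
End Emb.

Section Frozen.
Variable n : nat.

Lemma tzE a b : tz a b%:Z = gsv (mon a b 0 0 : gser 0). Proof. by []. Qed.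
Lemma qpoch_tz a b : qpoch (tz a b%:Z) = gsv (qp a b 0 0 : gser 0).
Proof. exact: qpochE. Qed.

Lemma PkE k : Pk n k = gsv (PkG 0 n k).
Proof.
rewrite /Pk /PkG gsv_prod; apply: eq_bigr => i _.
by rewrite gsv_div ?unit_Pk // !gsvM -!qpoch_tz.
Qed.

Lemma zfactE : qpochn (tz 0 1) (tz 0 1) n = gsv (zfact 0 n).
Proof.
rewrite /qpochn /zfact gsv_prod; apply: eq_bigr => l _.
rewrite (tzE 0 1) -gsvX -gsvM gsvB; congr (ssub _ (gsv _)).
by rewrite monX monM mul1n !mul0rn !addr0.
Qed.

Lemma prefE : pref n = gsv (prefG 0 n).
Proof.
rewrite /pref zfactE (qpoch_tz 0 1) (qpoch_tz 2 0) qpoch_tz.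
by rewrite -!gsvX -!gsvM -gsv_div ?unit_pref.
Qed.

Lemma wkE k : wk n k = gsv (wkG 0 n k).
Proof. by rewrite gsv_wk. Qed.

Lemma ratE k : (0 < n)%N ->
  sdiv (ssub (@sone 0) (tz (2 * k) 1)) (ssub (tz 0 n%:Z) (tz (2 * k) 0)) = gsv (ratG 0 n k).
Proof.
by move=> n0; rewrite (tzE _ 1) (tzE 0 n) (tzE _ 0) -gsv1 -!gsvB -gsv_div ?unit_znqk.
Qed.

(* Each power of y receives a single term of the sum over k. *)
Lemma smul_ssumZ (A : gser 0) (U : int -> gser 0) (d : int) : (0 < n)%N ->
  (forall e, A e != 0 -> ydeg e = d) ->
  (forall k e, U k e != 0 -> ydeg e = n%:Z * k) ->
  forall e, (forall k, ydeg e = n%:Z * k + d ->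
      smul (gsv A) (ssumZ (fun k => gsv (U k))) e = (A * U k) e) /\
    ((forall k, ydeg e != n%:Z * k + d) ->
      smul (gsv A) (ssumZ (fun k => gsv (U k))) e = 0).
Proof.
move=> n0 AP UP e; split=> [k ek|ne].
  rewrite gsvM; apply: eq_fsum => e1.
  have [->|/AP e1d] := eqVneq (A e1) 0; first by rewrite !mul0r.
  congr (_ * _); rewrite /ssumZ; apply: fsum1 => j jk.
  apply/eqP; apply: contraNT jk => /UP; rewrite ydegB e1d ek addrK => /eqP.
  have n0' : n%:Z != 0 by lia.
  by rewrite (inj_eq (mulfI n0')) eq_sym.
apply: fsum0 => e1.
have [->|/AP e1d] := eqVneq (A e1) 0; first by rewrite mul0r.
rewrite /ssumZ fsum0 ?mulr0 // => j; apply/eqP; apply: contraT => /UP.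
by rewrite ydegB e1d => /eqP; rewrite subr_eq (negbTE (ne j)).
Qed.
End Frozen.

(** * The left-hand side *)

Lemma prod_offdiag (R : comPzRingType) n (c : nat -> nat -> R) :
  \prod_(i < n) \prod_(j < n | i != j) c i j = \prod_(j < n) \prod_(i < j) (c i j * c j i).
Proof.
transitivity (\prod_(i < n) ((\prod_(j < n | (i < j)%N) c i j) * \prod_(j < n | (j < i)%N) c i j)).
  apply: eq_bigr => i _; rewrite (bigID (fun j : 'I_n => (i < j)%N)) /=.
  congr (_ * _); apply: eq_bigl => j; rewrite -val_eqE /=; case: ltngtP; lia.
rewrite big_split /= (exchange_big_dep predT) //= -big_split; apply: eq_bigr => j _ /=.
rewrite big_split /=; congr (_ * _).
  by rewrite (big_ord_widen n (fun i => c i j)) // ltnW.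
by rewrite (big_ord_widen n (fun i => c j i)) // ltnW.
Qed.

(** Pure elimination, stated over abstract letters so that [ring] meets atoms only; the common
    factor Q De D' Y is the unit to be cancelled. *)
Lemma clear_denominators (R : comPzRingType) (c Q De D' Y e w r pr wk pk zf N M P p : R) :
  c * Q = N * e -> e * De = w * r -> w * D' = P -> pr * (D' * zf) = Y * P ->
  pk * De = p -> M * r = wk * p -> Y * Q = zf ->
  M * c * (Q * De * D' * Y) = N * (pr * (wk * pk)) * (Q * De * D' * Y).
Proof.
move=> E1 E2 E3 E4 E5 E6 E7.
transitivity (M * (c * Q) * De * D' * Y); first by ring.
rewrite E1; transitivity (M * N * (e * De) * D' * Y); first by ring.
rewrite E2; transitivity (N * (M * r) * (w * D') * Y); first by ring.
rewrite E6 E3; transitivity (N * (wk * (pk * De)) * (pr * (D' * (Y * Q)))).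
  by rewrite E7 E4 E5; ring.
by ring.
Qed.

Lemma clear_denominators1 (R : comPzRingType) (a b pr wk pk N x zn z1 rt v Z : R) :
  zn * z1 = Z -> rt * v = - b * x ->
  - Z * x * (a * b) * (N * (pr * (wk * pk))) = N * a * (pr * zn * z1) * (wk * (rt * pk)) * v.
Proof.
move=> E1 E2; transitivity (N * a * (pr * (zn * z1)) * (wk * ((rt * v) * pk))).
  by rewrite E1 E2; ring.
by ring.
Qed.

Lemma solve_opp (R : comPzRingType) (p p' v rt x : R) :
  p * p' = 1 -> rt * (- p * v) = x -> rt * v = - p' * x.
Proof.
move=> pp <-; transitivity (rt * v * (p * p')); first by rewrite pp mulr1.
by ring.
Qed.

Section Left.
Variable n' : nat.
Local Notation n := n'.+1.
Local Notation G := (gser n).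

Definition fG i : G := qp 1 0 1 (xn n i) * qp 1 0 (-1) (- xn n i) /
  (qp (-1) 1 1 (xn n i) * qp 1 1 (-1) (- xn n i)).
Definition pG (m : int) : G := \sum_(i < n) mon 0 0 0 (m *: xn n i).
Definition G0 : G := WS n * \prod_(i < n) fG i.

Lemma F2E m : F2 n m = gsv (G0 * pG m).
Proof.
rewrite /F2 /G0 !gsvM; apply: (f_equal2 (@smul n)); first apply: (f_equal2 (@smul n)).
- have -> : WS n = \prod_(i < n) \prod_(j < n | i != j)
      (qp 0 0 0 (xq n i j) / qp 0 1 0 (xq n i j)).
    rewrite (prod_offdiag n (fun i j => qp 0 0 0 (xq n i j) / qp 0 1 0 (xq n i j))).
    apply: eq_bigr => j _; apply: eq_bigr => i _; rewrite /spair invrM ?qp_unit //.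
    by move: (_^-1) (_^-1) => x y; ring.
  rewrite gsv_prod; apply: eq_bigr => i _; rewrite gsv_prod; apply: eq_bigr => j _.
  by rewrite gsv_div ?qp_unit // /xq !xn_xv -!qpochE.
- rewrite gsv_prod; apply: eq_bigr => i _.
  by rewrite gsv_div ?unitrM ?qp_unit // !gsvM !xn_xv -!qpochE.
by rewrite /pG gsv_sum; apply: eq_bigr => i _; rewrite xn_xv.
Qed.

(* Applied with the scaling x_i -> q x_i, y -> q^-1 y, this gives homogeneity: a nonzero
   coefficient of nonzero weight would recur at arbitrarily negative powers of q. *)
Lemma act_fixed_weight dy d (f : G) e : act 1%g dy d f = f -> f e != 0 ->
  dy * ydeg e + dot d (xdeg e) = 0.
Proof.
move=> ff fe; set dl := _ + _; apply/eqP; apply: contraT => dl0.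
have stepE e' : ydeg e' = ydeg e -> xdeg e' = xdeg e -> f (e' + (2 * dl, 0, 0, 0)) = f e'.
  move=> ey ex; rewrite -[in LHS]ff; rewrite -(push_em (actm 1%g dy d) f e').
  congr (gsv _ _); rewrite /= /actf ey ex -/dl col_perm1 -ex -ey.
  by rewrite [e' in LHS]expo_eta; congr (_, _, _, _) => /=; rewrite addr0.
have up (j : nat) : f (e + (2 * dl * j%:Z, 0, 0, 0)) = f e.
  elim: j => [|j IH].
    by rewrite mulr0 (_ : (0, 0, 0, 0) = 0 :> expo n) // addr0.
  rewrite -IH -[RHS]stepE ?xdegD ?ydegD /ydeg /xdeg /= ?addr0 //; congr (gsv f _).
  by rewrite -addrA; congr (_ + _); congr (_, _, _, _) => /=; rewrite ?addr0 //; lia.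
have dn (j : nat) : f (e - (2 * dl * j%:Z, 0, 0, 0)) = f e.
  elim: j => [|j IH].
    by rewrite mulr0 (_ : (0, 0, 0, 0) = 0 :> expo n) // subr0.
  rewrite -[LHS]stepE ?xdegB ?ydegB /ydeg /xdeg /= ?subr0 // -IH; congr (gsv f _).
  rewrite -addrA; congr (_ + _); congr (_, _, _, _) => /=; rewrite ?addr0 ?subr0 //; lia.
have [L hL] := (gsvP f).2 _ (@yxlin0 n) (zdeg e).
have [dlp|dln] := leP 0 dl.
  have := hL _ _ _; move/(_ (e - (2 * dl * (absz (tdeg e - L)).+1%:Z, 0, 0, 0))).
  by rewrite dn zdegB tdegB /zdeg /tdeg /= subr0 addr0 => /(_ fe (lexx _)); nia.
have := hL _ _ _; move/(_ (e + (2 * dl * (absz (tdeg e - L)).+1%:Z, 0, 0, 0))).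
by rewrite up zdegD tdegD /zdeg /tdeg /= !addr0 => /(_ fe (lexx _)); nia.
Qed.

Local Notation one := (const_mx 1 : 'rV[int]_n).

Lemma dot_one_xn i : (i < n)%N -> dot one (xn n i) = 1.
Proof.
move=> ni; rewrite /dot (bigD1 (Ordinal ni)) //= !mxE eqxx mulr1 big1 ?addr0 // => j ji.
rewrite !mxE; case: eqP => [E|]; last by rewrite mulr0.
by case/eqP: ji; apply: val_inj.
Qed.

Lemma dot_one v : dot one v = \sum_i v 0 i.
Proof. by apply: eq_bigr => i _; rewrite mxE mul1r. Qed.

Lemma act_G0 : act 1%g (-1) one G0 = G0.
Proof.
have ax i j : (i < n)%N -> (j < n)%N -> dot one (xq n i j) = 0.
  by move=> ni nj; rewrite dotD dotN !dot_one_xn // subrr.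
rewrite /G0 rmorphM !rmorph_prod /=; congr (_ * _); apply: eq_bigr => j _.
  rewrite rmorph_prod; apply: eq_bigr => i _ /=; rewrite /spair.
  have nin : (i < n)%N by exact: ltn_trans (ltn_ord i) (ltn_ord j).
  rewrite rmorphM rmorphV ?unitrM ?qp_unit // !rmorphM /= !act_qp !col_perm1.
  by rewrite !ax // !(mulr0, addr0).
rewrite /fG rmorphM rmorphV ?unitrM ?qp_unit // !rmorphM /= !act_qp !col_perm1.
by rewrite dotN !dot_one_xn.
Qed.

Lemma G0p_weight m e : (G0 * pG m) e != 0 -> dot one (xdeg e) = ydeg e + m.
Proof.
rewrite /pG mulr_sumr gsumE => s0.
have [i] : exists i : 'I_n, (G0 * mon 0 0 0 (m *: xn n i)) e != 0.
  apply: contrapT => ne; case/eqP: s0; apply: big1 => i _.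
  by apply/eqP; apply: contraPT ne => h; apply; exists i.
rewrite mulrC mon_mulE => /(act_fixed_weight act_G0).
rewrite ydegB xdegB dotD dotN /ydeg /xdeg /= subr0.
have -> : dot one (m *: xn n i) = m by rewrite dotZ dot_one_xn // mulr1.
by lia.
Qed.

Lemma xcoordE (v : 'rV[int]_n) (i : 'I_n) : xcoord v i = v 0 i.
Proof. by rewrite /xcoord valK. Qed.

Definition diffs (e : expo n) : 'rV[int]_n.-1 :=
  \row_(i < n.-1) (xcoord (xdeg e) i - xcoord (xdeg e) n.-1).

Lemma diffs0 (e : expo n) : diffs e = 0 -> exists s, xdeg e = const_mx s.
Proof.
move=> e0; exists (xdeg e 0 ord_max); apply/rowP => i; rewrite [in RHS]mxE.
have [im|im] := ltnP i n'; last first.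
  by congr (xdeg e 0 _); apply: val_inj => /=; have := ltn_ord i; lia.
have := congr1 (fun v : 'rV[int]_n.-1 => v 0 (Ordinal im)) e0.
rewrite !mxE /= (xcoordE _ i) (xcoordE _ ord_max) => /eqP.
by rewrite subr_eq0 => /eqP.
Qed.

Lemma diffs_const (e : expo n) s : xdeg e = const_mx s -> diffs e = 0.
Proof.
move=> es; apply/rowP => i; rewrite !mxE es.
have im : (i < n)%N by rewrite (leq_trans (ltn_ord i)).
by rewrite (xcoordE _ (Ordinal im)) (xcoordE _ ord_max) !mxE subrr.
Qed.

(** The substitution for x_n collects all exponents with equal entries; by homogeneity their sum is
    c + m, so exactly one of them can contribute. *)
Lemma C2_coef m k (a b c : int) v : c + m = n%:Z * k ->
  C2 n m (a, b, c, v) = (G0 * pG m) (a, b, c, const_mx k).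
Proof.
move=> cmk; rewrite /C2 /subst_last F2E.
rewrite (@fsum1 _ _ (a, b, c, const_mx k)); last first.
  move=> e ek; case: eqP => // E; apply/eqP; apply: contraNT ek => /G0p_weight.
  case: E => ea eb ec /diffs0[s es].
  rewrite es dot_one ec cmk.
  under eq_bigr do rewrite mxE.
  rewrite sumr_const card_ord => ns.
  have sk : s = k by move: ns; rewrite -mulr_natl natz => /mulfI; apply.
  by rewrite [e]expo_eta ea eb ec es sk.
by rewrite -/(diffs _) (@diffs_const _ k) // eqxx.
Qed.

Lemma C2_zero m (a b c : int) v : (forall k, c + m != n%:Z * k) ->
  C2 n m (a, b, c, v) = 0.
Proof.
move=> ck; rewrite /C2 /subst_last F2E; apply: fsum0 => e.
case: eqP => // E; apply/eqP; apply: contraT => /G0p_weight.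
case: E => ea eb ec /diffs0[s es].
rewrite es dot_one ec.
under eq_bigr do rewrite mxE.
rewrite sumr_const card_ord => ns; case/eqP: (ck s).
by rewrite -ns -mulr_natl natz.
Qed.

Local Notation F k := (Ft 1 1 (0 : 'rV[int]_n) (-2) k 0).

Lemma sum_xn : \sum_(i < n) xn n i = one.
Proof.
apply/rowP => j; rewrite summxE mxE (bigD1 j) //= mxE eqxx big1 ?addr0 // => i ij.
by rewrite mxE; case: eqP => // E; case/eqP: ij; apply: val_inj.
Qed.

Lemma prod_F k : \prod_(i < n) F k i =
  mon (- (n%:Z * k)) 0 (- (n%:Z * k)) (- (k *: one)) * \prod_(i < n) fG i.
Proof.
have -> : mon (- (n%:Z * k)) 0 (- (n%:Z * k)) (- (k *: one)) =
    \prod_(i < n) pw 1 1 (0 : 'rV[int]_n) k i.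
  rewrite -sum_xn scaler_sumr -sumrN.
  have gen (l : nat) : \prod_(i < l) pw 1 1 (0 : 'rV[int]_n) k i =
     mon (- (l%:Z * k)) 0 (- (l%:Z * k)) (\sum_(i < l) - (k *: xn n i)).
    elim: l => [|l IH]; first by rewrite !big_ord0 mul0r oppr0 mon0.
    rewrite !big_ord_recr /= IH monM mulr1 addr0.
    by have -> : - (l%:Z * k) - k = - (l.+1%:Z * k) by lia.
  by rewrite gen.
by rewrite -big_split; apply: eq_bigr => i _ /=; rewrite /Ft /fG addr0.
Qed.

Lemma CT_coef (f : G) (s a b c : int) (v : 'rV[int]_n) :
  CT (mon s 0 (- c) (- v) * f) (a, b, 0, 0) = f (a - s, b, c, v).
Proof.
rewrite CTE ifT; last by rewrite /ydeg /xdeg /= !eqxx.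
rewrite mon_mulE; congr (gsv f _).
by congr (_, _, _, _) => /=; rewrite ?subr0 ?sub0r ?opprK.
Qed.

Definition Cs k : G := CT (\prod_(i < n) F k i * WS n).
Definition Cs1 k : G :=
  CT (\prod_(i < n) F k i * (\sum_(i < n) u 1 1 (0 : 'rV[int]_n) i) * WS n).

Lemma vc0P : forall j : 'I_n, (j <= n')%N -> (0 : 'rV[int]_n) 0 j = 0.
Proof. by move=> j _; rewrite mxE. Qed.

Let qdk k := qdiff_Ft (leqnn n) 1 1 vc0P (-2) k 0.

Lemma sw_prod_F a (an : (a.+1 < n)%N) k : sw an (\prod_(i < n) F k i) = \prod_(i < n) F k i.
Proof.
rewrite rmorph_prod -[RHS](prod_swn an (F k)); apply: eq_bigr => i _ /=.
exact: (qd_sw (qdk k)).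
Qed.

Lemma sw_sum_u a (an : (a.+1 < n)%N) : sw an (\sum_(i < n) u 1 1 (0 : 'rV[int]_n) i) =
  \sum_(i < n) u 1 1 (0 : 'rV[int]_n) i.
Proof.
rewrite rmorph_sum [RHS](reindex_inj (inv_inj (swoK an))); apply: eq_bigr => i _ /=.
by rewrite (sw_u (leqnn n) 1 1 vc0P).
Qed.

Lemma CsE k : Cs k * qfact (zz n) n = n`!%:R * ek n' k.
Proof.
have := symmetrise (fun a an => sw_prod_F an k).
rewrite -/(Cs k) => H; rewrite mulrC -H mulrC /ek /Phi.
by rewrite [W n n * _]mulrC.
Qed.

(** By [CT_swap] the term u_i contributes z^i times that of u_0; this geometric sum is the factor (1
    - z^n)/(1 - z) of the statement. *)
Lemma Cs1E k : Cs1 k * qfact (zz n) n =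
  n`!%:R * ((\sum_(i < n) zz n ^+ i) * EE n' 1 1 0 (F k) 1).
Proof.
have := @symmetrise n (\prod_(i < n) F k i * \sum_(i < n) u 1 1 (0 : 'rV[int]_n) i).
rewrite -/(Cs1 k) => H; rewrite mulrC -H; last first.
  by move=> a an; rewrite rmorphM /= sw_prod_F sw_sum_u.
rewrite mulrC; congr (_ * _).
have step i : (i < n)%N -> CT (u 1 1 0 i * Phi n' (F k)) = zz n ^+ i * EE n' 1 1 0 (F k) 1.
  elim: i => [|i IH] ni; first by rewrite expr0 mul1r /EE big_ord_recl big_ord0 mulr1.
  have := CT_swap vc0P (qdk k) (p := 1) (an := ni) ni (rmorph1 _).
  by rewrite mul1r => ->; rewrite IH ?(ltnW ni) // exprS mulrA.
transitivity (CT (\sum_(i < n) u 1 1 0 i * Phi n' (F k))).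
  by rewrite -mulr_suml /Phi; congr CT; ring.
by rewrite raddf_sum mulr_suml; apply: eq_bigr => i _; exact: step.
Qed.

Lemma qfact_zfact : (1 - zz n) ^+ n * qfact (zz n) n = zfact n n.
Proof.
rewrite /qfact /zfact -[X in _ ^+ X]card_ord -prodr_const -big_split.
apply: eq_bigr => i _ /=; have := subrX1 (zz n) i.+1; rewrite zzX => /(congr1 -%R).
by rewrite opprB => ->; rewrite -mulNr opprB.
Qed.

Lemma unit_1z : 1 - zz n \is a GRing.unit. Proof. exact: unit_1mon. Qed.

Lemma unit_qfact : qfact (zz n) n \is a GRing.unit.
Proof.
have := unit_zfact n n; rewrite -qfact_zfact unitrM => /andP[] //.
Qed.

(** The prefactor is assembled from CT(W), the division by [qfact] left by symmetrisation, (z)_oo =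
    (1 - z)(q z)_oo, and (z;z)_n = (1 - z)^n [qfact]. *)
Lemma CsE' k : mon (n%:Z * k) 0 (n%:Z * k) 0 * Cs k =
  n`!%:R * (prefG n n * (wkG n n k * PkG n n k)).
Proof.
have uD : Den n' \is a GRing.unit.
  by rewrite /Den unitrM !unitr_prod // => r _; [exact: unit_qp2|rewrite qp_unit ?addn2].
pose D' : G := qp 2 0 0 0 ^+ n' * qp 2 n 0 0.
have uD' : D' \is a GRing.unit by rewrite unitrM unitrX ?unit_qp2.
have E1 : Cs k * qfact (zz n) n = n`!%:R * ek n' k := CsE k.
have E2 : ek n' k * Den n' = CT (W n n) * rho n' k := ekE n' k.
have E3 : CT (W n n) * D' = qp 2 1 0 0 ^+ n := CT_W (leqnn n).
have E4 : prefG n n * (D' * zfact n n) = qp 0 1 0 0 ^+ n by rewrite /prefG divrK ?unit_pref.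
have E5 : qp 0 1 0 0 = (1 - zz n) * qp 2 1 0 0 by rewrite qpS.
pose R : G := \prod_(r < n) (qp (- 2 * k) (r + 1) 0 0 * qp (2 * (k + 1)) (r + 1) 0 0).
have E6 : PkG n n k * Den n' = R.
  rewrite /Den -big_split /PkG -big_split; apply: eq_bigr => i _ /=.
  by rewrite addn2 addn1 divrK ?unit_Pk.
have E7 : mon (n%:Z * k) 0 (n%:Z * k) 0 * rho n' k = wkG n n k * R.
  rewrite /rho /wkG -/R; set s := (-1) ^ _.
  have -> : mon (n%:Z * (k * k)) 0 (n%:Z * k) 0 =
      mon (n%:Z * k) 0 (n%:Z * k) 0 * mon (n%:Z * (k * (k - 1))) 0 0 0 :> G.
    by rewrite monM !addr0 (_ : n%:Z * k + n%:Z * (k * (k - 1)) = n%:Z * (k * k)) //; lia.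
  by ring.
have U : qfact (zz n) n * Den n' * D' * (1 - zz n) ^+ n \is a GRing.unit.
  by rewrite unitrM (unitrX _ (unit_1z)) andbT unitrM uD' andbT unitrM unit_qfact uD.
apply: (mulIr U); have E8 := qfact_zfact.
rewrite E5 exprMn in E4.
exact: (clear_denominators E1 E2 E3 E4 E6 E7 E8).
Qed.

Lemma Cs1E' k : mon (n%:Z * k - 1) 0 (n%:Z * k - 1) 0 * Cs1 k =
  n`!%:R * mon 1 0 (-1) 0 * (prefG n n * (1 - mon 0 n 0 0) / (1 - mon 0 1 0 0)) *
  (wkG n n k * (ratG n n k * PkG n n k)).
Proof.
set v : G := 1 - mon (- 2 * k) n 0 0.
have uv : v \is a GRing.unit by exact: unit_1mon.
pose x : G := 1 - mon (2 * k) 1 0 0.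
pose K : G := mon (2 - 2 * k) 0 0 0.
have E1 := Cs1E k; have E2 : EE n' 1 1 0 (F k) 1 * v = - K * x * ek n' k := EE_1 n' k.
have E3 := CsE k; have E4 := CsE' k.
pose Z : G := \sum_(i < n) zz n ^+ i.
have E5 : Cs1 k * v = - Z * K * x * Cs k.
  apply: (mulIr unit_qfact).
  transitivity (Cs1 k * qfact (zz n) n * v); first by ring.
  rewrite E1; transitivity (n`!%:R * Z * (EE n' 1 1 0 (F k) 1 * v)); first by rewrite /Z; ring.
  rewrite E2; transitivity (- Z * K * x * (n`!%:R * ek n' k)); first by ring.
  by rewrite -E3; ring.
have E6 : (1 - mon 0 n 0 0) / (1 - mon 0 1 0 0) = Z :> G.
  have := subrX1 (zz n) n; rewrite zzX => /(congr1 -%R).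
  by rewrite opprB -mulNr opprB => ->; rewrite mulrC mulKr // unit_1z.
have E7 : ratG n n k * v = - mon (- 2 * k) 0 0 0 * x.
  have := divrK (unit_znqk n k (ltn0Sn n')) x; rewrite -/(ratG n n k) znqkE -/v.
  apply: solve_opp; rewrite monM !addr0 -[RHS]mon0.
  by have -> : 2 * k + - 2 * k = 0 by lia.
apply: (mulIr uv).
have E8 : mon (n%:Z * k - 1) 0 (n%:Z * k - 1) 0 =
    mon (-1) 0 (-1) 0 * mon (n%:Z * k) 0 (n%:Z * k) 0 :> G.
  by rewrite monM !addr0 addrC.
(* The q^(-1/2) that undoes the normalisation of u_i meets the constant q^(1-k) of the q-difference
   equation; the outcome is the q^(1/2) of the statement and a q^-k absorbed by 1/(z^n - q^k). *)
have E9 : mon (-1) 0 (-1) 0 * K = mon 1 0 (-1) 0 * mon (- 2 * k) 0 0 0.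
  rewrite /K !monM !addr0.
  by have -> : -1 + (2 - 2 * k) = 1 + - 2 * k by lia.
transitivity (mon (n%:Z * k - 1) 0 (n%:Z * k - 1) 0 * (Cs1 k * v)); first by ring.
rewrite E5 E8.
transitivity (- Z * x * (mon (-1) 0 (-1) 0 * K) * (mon (n%:Z * k) 0 (n%:Z * k) 0 * Cs k)).
  by ring.
rewrite E4 E9; exact: (clear_denominators1 _ _ _ _ _ E6 E7).
Qed.

(** The product of the u_i^-k is q^(-nk/2) y^(-nk) (x_1...x_n)^-k: it moves the wanted exponent to
    the constant term, and the monomial on the right restores the powers of q and y. *)
Lemma G0_coef0 k (a b : int) : (G0 * pG 0) (a, b, n%:Z * k, const_mx k) =
  (n%:R * (mon (n%:Z * k) 0 (n%:Z * k) 0 * Cs k)) (a, b, n%:Z * k, 0).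
Proof.
have -> : pG 0 = n%:R.
  rewrite /pG; under eq_bigr do rewrite scale0r mon0.
  by rewrite sumr_const card_ord.
have -> : n%:R * (mon (n%:Z * k) 0 (n%:Z * k) 0 * Cs k) =
    mon (n%:Z * k) 0 (n%:Z * k) 0 * CT (n%:R * (\prod_(i < n) F k i * WS n)).
  by rewrite (CTZ _ (cst_nat n n)) /Cs mulrCA.
rewrite mon_mulE.
have -> : (a, b, n%:Z * k, 0) - (n%:Z * k, 0, n%:Z * k, 0) = (a - n%:Z * k, b, 0, 0) :> expo n.
  by congr (_, _, _, _) => /=; rewrite ?subrr ?subr0.
rewrite prod_F; have -> : k *: one = const_mx k.
  by apply/rowP => i; rewrite !mxE mulr1.
set h := (X in CT X).
have -> : h = mon (- (n%:Z * k)) 0 (- (n%:Z * k)) (- const_mx k) * (G0 * n%:R).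
  by rewrite /h /G0; ring.
by rewrite CT_coef opprK subrK.
Qed.

Lemma G0_coef1 k (a b : int) : (G0 * pG 1) (a, b, n%:Z * k - 1, const_mx k) =
  (mon (n%:Z * k - 1) 0 (n%:Z * k - 1) 0 * Cs1 k) (a, b, n%:Z * k - 1, 0).
Proof.
have E : \sum_(i < n) u 1 1 (0 : 'rV[int]_n) i = mon 1 0 1 0 * pG 1.
  rewrite /pG mulr_sumr; apply: eq_bigr => i _.
  by rewrite /u addr0 monM scale1r (add0r (xn n i)).
rewrite mon_mulE.
have -> : (a, b, n%:Z * k - 1, 0) - (n%:Z * k - 1, 0, n%:Z * k - 1, 0) =
    (a - (n%:Z * k - 1), b, 0, 0) :> expo n.
  by congr (_, _, _, _) => /=; rewrite ?subrr ?subr0.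
rewrite /Cs1 E prod_F; have -> : k *: one = const_mx k.
  by apply/rowP => i; rewrite !mxE mulr1.
set h := (X in CT X).
have -> : h = mon (- (n%:Z * k - 1)) 0 (- (n%:Z * k - 1)) (- const_mx k) * (G0 * pG 1).
  have -> : mon (- (n%:Z * k - 1)) 0 (- (n%:Z * k - 1)) (- const_mx k) =
     mon (- (n%:Z * k)) 0 (- (n%:Z * k)) (- const_mx k) * mon 1 0 1 0 :> G.
    by rewrite monM addr0 (_ : - (n%:Z * k - 1) = - (n%:Z * k) + 1) //; lia.
  by rewrite /h /G0; ring.
by rewrite CT_coef opprK subrK.
Qed.
End Left.

(** * Scalars and y-degrees of the right-hand sides; the final comparison by powers of y *)

Section Support.
Variable k : nat.
Implicit Types c f : gser k.

Lemma cstV c : c \is a GRing.unit -> CT c = c -> CT c^-1 = c^-1.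
Proof. by move=> uc cc; apply: (mulrI uc); rewrite -CTZ // divrr // CT1. Qed.

Lemma cst_div c f : f \is a GRing.unit -> CT c = c -> CT f = f -> CT (c / f) = c / f.
Proof. by move=> uf cc cf; apply: cstM => //; exact: cstV. Qed.

Lemma cst_signz (z : int) : CT ((-1) ^ z : gser k) = (-1) ^ z.
Proof.
by case: z => m; rewrite ?NegzE -?exprnN ?invr_sign; apply/cstX/cstN/CT1.
Qed.

Lemma cst_1mon a b : CT (1 - mon a b 0 0 : gser k) = 1 - mon a b 0 0.
Proof. by apply: cstB; [exact: CT1|exact: cst_mon]. Qed.

Lemma cst_prefG n : CT (prefG k n) = prefG k n.
Proof.
apply: cst_div; [exact: unit_pref|by apply: cstX; exact: cst_qp|].
apply: cstM; first by apply: cstM; [apply: cstX|]; exact: cst_qp.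
by apply: cst_prod => i _; exact: cst_1mon.
Qed.

Lemma cst_PkG n j : CT (PkG k n j) = PkG k n j.
Proof.
apply: cst_prod => i _; apply: cst_div; first exact: unit_Pk.
  by apply: cstM; exact: cst_qp.
by apply: cstM; exact: cst_qp.
Qed.

Lemma cst_ratG n j : (0 < n)%N -> CT (ratG k n j) = ratG k n j.
Proof.
move=> n0; apply: cst_div; [exact: unit_znqk|exact: cst_1mon|].
by apply: cstB; exact: cst_mon.
Qed.

Lemma ydeg_mon_cst a b y c (e : expo k) : CT c = c -> (mon a b y 0 * c) e != 0 -> ydeg e = y.
Proof.
move=> cc; rewrite mon_mulE => /(cst_neq0 cc)/andP[/eqP + _].
by rewrite ydegB /ydeg /= => /eqP; rewrite subr_eq0 => /eqP.
Qed.

Lemma ydeg_wkG n j c (e : expo k) : CT c = c -> (wkG k n j * c) e != 0 -> ydeg e = n%:Z * j.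
Proof.
move=> cc; rewrite /wkG [_ * mon _ _ _ _]mulrC -mulrA; apply: ydeg_mon_cst.
by apply: cstM => //; exact: cst_signz.
Qed.
End Support.

Theorem theorem3p10 (n : nat) (hn : (2 <= n)%N) :
  C2 n 0 = RHS0 n /\ C2 n 1 = RHS1 n.
Proof.
case: n hn => // n' _.
have n0 : (0 < n'.+1)%N by [].
split; apply/funext => -[[[a b] c] v]; rewrite [v]thinmx0.
- pose A : gser 0 := (n'.+1`! * n'.+1)%:R * prefG 0 n'.+1.
  have -> : RHS0 n'.+1 = smul (gsv A) (ssumZ (fun k => gsv (wkG 0 n'.+1 k * PkG 0 n'.+1 k))).
    rewrite /RHS0 /A gsvM gsv_nat prefE; congr (smul _ (ssumZ _)).
    by apply/funext => k; rewrite gsvM wkE PkE.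
  have AP e : A e != 0 -> ydeg e = 0.
    rewrite -[A]mul1r -mon0; apply: ydeg_mon_cst; apply: cstM; first exact: cst_nat.
    exact: cst_prefG.
  have UP k e : (wkG 0 n'.+1 k * PkG 0 n'.+1 k) e != 0 -> ydeg e = n'.+1%:Z * k.
    by apply: ydeg_wkG; exact: cst_PkG.
  have [H1 H2] := smul_ssumZ n0 AP UP (a, b, c, 0).
  (* If the y-degree is n k, a single term of the sum and a single exponent on the left are
     compared; otherwise both sides vanish. *)
  have [[k ck]|nk] := EM (exists k, c = n'.+1%:Z * k).
    rewrite (H1 k) ?addr0 // (@C2_coef n' 0 k) ?addr0 // ck G0_coef0 -(embE n'.+1).
    congr (gsv _ _); rewrite /A; move: (emb_pref n') (emb_wk n' k) (emb_Pk n' k).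
    move: (prefG 0 _) (wkG 0 _ _) (PkG 0 _ _) => p w q Ep Ew Eq.
    by rewrite !rmorphM !rmorph_nat /= Ep Ew Eq CsE' natrM; ring.
  have nk' k : c + 0 != n'.+1%:Z * k by rewrite addr0; apply/eqP => ck; apply: nk; exists k.
  rewrite H2; first exact: C2_zero.
  by move=> k; have := nk' k; rewrite !addr0.
pose A : gser 0 := n'.+1`!%:R * mon 1 0 (-1) 0 *
  (prefG 0 n'.+1 * (1 - mon 0 n'.+1 0 0) / (1 - mon 0 1 0 0)).
have u1 : 1 - mon 0 1 0 0 \is a @GRing.unit (gser 0) by exact: unit_1mon.
have -> : RHS1 n'.+1 = smul (gsv A) (ssumZ (fun k => gsv (wkG 0 n'.+1 k * (ratG 0 n'.+1 k * PkG 0 n'.+1 k)))).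
  rewrite /RHS1 /A !gsvM gsv_nat prefE (tzE 0 n'.+1) (tzE 0 1) -gsv1 -!gsvB -gsvM -gsv_div //.
  congr (smul _ (ssumZ _)).
  by apply/funext => k; rewrite !gsvM wkE PkE ratE.
have AP e : A e != 0 -> ydeg e = -1.
  set B := prefG 0 _ * _ / _ in A *.
  have -> : A = mon 1 0 (-1) 0 * (n'.+1`!%:R * B) by rewrite mulrA [mon _ _ _ _ * _]mulrC.
  apply: ydeg_mon_cst.
  apply: cstM; first exact: cst_nat.
  apply: cst_div => //; last exact: cst_1mon.
  by apply: cstM; [exact: cst_prefG|exact: cst_1mon].
have UP k e : (wkG 0 n'.+1 k * (ratG 0 n'.+1 k * PkG 0 n'.+1 k)) e != 0 -> ydeg e = n'.+1%:Z * k.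
  by apply: ydeg_wkG; apply: cstM; [exact: cst_ratG|exact: cst_PkG].
have [H1 H2] := smul_ssumZ n0 AP UP (a, b, c, 0).
have [[k ck]|nk] := EM (exists k, c = n'.+1%:Z * k - 1).
  rewrite (H1 k) // (@C2_coef n' 1 k) ?ck ?subrK // G0_coef1 -(embE n'.+1).
  congr (gsv _ _); rewrite /A; move: (emb_pref n') (emb_wk n' k) (emb_Pk n' k) (emb_rat n' k).
  move: (prefG 0 _) (wkG 0 _ _) (PkG 0 _ _) (ratG 0 _ _) => p w q r Ep Ew Eq Er.
  rewrite !rmorphM rmorphV // rmorph_nat !rmorphB !rmorph1 /= Ep Ew Eq Er !emb_mon.
  exact: Cs1E'.
rewrite H2; first apply: C2_zero => k.
  by apply/eqP => ck; apply: nk; exists k; rewrite -ck addrK.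
by move=> k; apply/eqP => ck; apply: nk; exists k.
Qed.
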